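(* Let $n\ge 1$, let $b=(b_1,\dots,b_n)$ be a sequence of positive integers, set $b_0=b_{n+1}:=1$ and $N_j:=\mathrm{lcm}(b_j,b_{j-1})$ for $j=1,\dots,n+1$. The lecture hall polytope $P(b)$ is Gorenstein if and only if $$b_j\cdot\left(\frac{1}{N_1}+\cdots+\frac{1}{N_j}\right)\in\mathbb{Z}\quad\text{for each } j=1,\dots,n+1.$$ Moreover, for each fixed $n\ge 1$, there are only finitely many sequences of positive integers $b=(b_1,\dots,b_n)$ such that the lecture hall polytope $P(b)$ is Gorenstein.
   Context: The lecture hall polytope is $P(b):=\{(x_1,\dots,x_n)\in\mathbb{R}^n : 0\le\frac{x_1}{b_1}\le\cdots\le\frac{x_n}{b_n}\le 1\}$. For $p=(p_1,\dots,p_n)\in kP(b)\cap\mathbb{Z}^n$, $k\in\mathbb{Z}_{\ge 0}$, put $t^{(p,k)}:=t_1^{p_1}\cdots t_n^{p_n}t_{n+1}^k$. The Ehrhart ring of $P(b)$ is the graded algebra $E(b):=\bigoplus_{k\ge 0}E(b)_k$, $E(b)_k:=\langle t^{(p,k)}\mid p\in kP(b)\cap\mathbb{Z}^n\rangle_{\mathbb{C}}$, with multiplication $t^{(p,k)}\cdot t^{(q,h)}=t^{(p+q,k+h)}$. The polytope $P(b)$ is said to be Gorenstein if its Ehrhart ring $E(b)$ is a Gorenstein ring. *)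

(* Defs.v *)
From HB Require Import structures.
From mathcomp Require Import all_boot all_order all_algebra.
From mathcomp Require Import boolp classical_sets cardinality reals.
From mathcomp Require Import complex monalg.

Set Implicit Arguments.
Unset Strict Implicit.
Unset Printing Implicit Defensive.

Import Order.TTheory GRing.Theory Num.Theory.

Local Open Scope ring_scope.

(* Gorenstein rings.  Ideals are [idealr_closed] boolean predicates; with the *)
(* classical axioms of boolp these are arbitrary subsets.                     *)

(* [idealr_closed] only covers proper ideals; the unit ideal is always        *)
(* finitely generated.                                                        *)
Definition noetherian (A : comNzRingType) : Prop :=
  forall I : {pred A}, idealr_closed I ->
  exists s : seq A, forall x, x \in I <->
    exists c : 'I_(size s) -> A, x = \sum_(i < size s) c i * s`_i.

Definition maximal_ideal (A : comNzRingType) (M : {pred A}) : Prop :=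
  idealr_closed M /\
  forall J : {pred A}, idealr_closed J -> {subset M <= J} -> {subset J <= M}.

(* [f : A -> S] is a localization of [A] at the complement of the prime [P];  *)
(* such an [f] is unique up to isomorphism.                                   *)
Definition is_localization_at (A : comNzRingType) (P : {pred A})
    (S : comNzRingType) (f : {rmorphism A -> S}) : Prop :=
  [/\ forall s, s \notin P -> exists u, f s * u = 1,
      forall y, exists a s, s \notin P /\ y * f s = f a
    & forall a, f a = 0 -> exists2 s, s \notin P & s * a = 0].

Definition injective_module (A : comNzRingType) (E : lmodType A) : Prop :=
  forall (U V : lmodType A) (i : {linear U -> V}) (f : {linear U -> E}),
  injective i -> exists g : {linear V -> E}, forall u, g (i u) = f u.

(* There is an exact sequence 0 -> M -> I_0 -> ... -> I_d -> 0 with each I_k  *)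
(* injective.                                                                 *)
Definition injdim_le (A : comNzRingType) (M : lmodType A) (d : nat) : Prop :=
  exists (I : nat -> lmodType A) (e : {linear M -> I 0%N})
    (delta : forall k, {linear I k -> I k.+1}),
  [/\ forall k, injective_module (I k),
      injective e,
      forall x, delta 0%N x = 0 <-> exists m, e m = x,
      forall k x, delta k.+1 x = 0 <-> exists y, delta k y = x
    & forall k, (d < k)%N -> forall x : I k, x = 0].

(* [A^o] is [A] as a module over itself. *)
Definition finite_self_injdim (A : comNzRingType) : Prop :=
  exists d, injdim_le A^o d.

Definition gorenstein_ring (A : comNzRingType) : Prop :=
  noetherian A /\
  forall M : {pred A}, maximal_ideal M ->
  exists (S : comNzRingType) (f : {rmorphism A -> S}),
    is_localization_at M f /\ finite_self_injdim S.

(* Coordinates are indexed from 0, so [tnth b i] is b_(i+1). *)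
Definition lecture_hall_polytope (R : realType) (n : nat) (b : n.-tuple nat) :
    set 'rV[R]_n :=
  [set x | [/\ forall i, 0 <= x 0 i / (tnth b i)%:R,
               forall i j : 'I_n, (i <= j)%N ->
                 x 0 i / (tnth b i)%:R <= x 0 j / (tnth b j)%:R
             & forall i, x 0 i / (tnth b i)%:R <= 1]]%classic.

Arguments lecture_hall_polytope R {n} b.

Definition dilate (R : realType) (n k : nat) (P : set 'rV[R]_n) :
    set 'rV[R]_n :=
  [set k%:R *: x | x in P]%classic.

Definition ehrhart_exponent (R : realType) (n : nat) (b : n.-tuple nat)
    (pk : 'rV[int]_n * nat) : bool :=
  `[< dilate pk.2 (lecture_hall_polytope R b) (map_mx intr pk.1) >].

(* The monomials t^(p,k), with (p,k) in the semigroup of lattice points.      *)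
Record ehrhart_monomial (R : realType) (n : nat) (b : n.-tuple nat) :=
  EhrhartMonomial {
    exponent :> 'rV[int]_n * nat;
    exponentP : ehrhart_exponent R b exponent }.

Section EhrhartMonomial.
Variables (R : realType) (n : nat) (b : n.-tuple nat).

Local Notation monomial := (ehrhart_monomial R b).

HB.instance Definition _ := [isSub for @exponent R n b].
HB.instance Definition _ := [Choice of monomial by <:].

Lemma ehrhart_exponent0 : ehrhart_exponent R b (0, 0%N).
Proof.
apply/asboolP; exists 0; last by rewrite /= scaler0 map_mx0.
by split=> [i|i j _|i]; rewrite !mxE !mul0r ?ler01.
Qed.

Lemma ehrhart_exponentD (x y : 'rV[int]_n * nat) :
  ehrhart_exponent R b x -> ehrhart_exponent R b y ->
  ehrhart_exponent R b (x.1 + y.1, (x.2 + y.2)%N).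
Proof.
case: x y => [p k] [q h] /asboolP[u [u0 uu u1] /= pE] /asboolP[v [v0 vv v1] /= qE].
apply/asboolP => /=.
have [/eqP|kh0] := eqVneq (k + h)%N 0%N.
  rewrite addn_eq0 => /andP[/eqP k0 /eqP h0].
  exists u; first by split.
  by rewrite map_mxD -pE -qE k0 h0 !scale0r addr0.
have kh_gt0 : 0 < (k + h)%:R :> R by rewrite ltr0n lt0n.
pose w := (k + h)%:R^-1 *: (k%:R *: u + h%:R *: v).
have wE i : w 0 i / (tnth b i)%:R = (k + h)%:R^-1 *
    (k%:R * (u 0 i / (tnth b i)%:R) + h%:R * (v 0 i / (tnth b i)%:R)).
  by rewrite !mxE -mulrA mulrDl !mulrA.
have w_ge0 : 0 <= (k + h)%:R^-1 :> R by rewrite invr_ge0 ltW.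
exists w; last first.
  by rewrite /w scalerA divff ?gt_eqF// scale1r map_mxD pE qE.
split=> [i|i j ij|i]; rewrite !wE.
- by rewrite mulr_ge0 // addr_ge0 // mulr_ge0.
- by rewrite ler_wpM2l // lerD // ler_wpM2l // ?uu ?vv.
- rewrite mulrC ler_pdivrMr // mul1r natrD lerD //.
  + by rewrite -[leRHS]mulr1 ler_wpM2l.
  + by rewrite -[leRHS]mulr1 ler_wpM2l.
Qed.

Definition ehrhart_one : monomial := EhrhartMonomial ehrhart_exponent0.

Definition ehrhart_mul (x y : monomial) : monomial :=
  EhrhartMonomial (ehrhart_exponentD (exponentP x) (exponentP y)).

Lemma ehrhart_mulA : associative ehrhart_mul.
Proof. by move=> x y z; apply/val_inj; rewrite /= addrA addnA. Qed.

Lemma ehrhart_mul1m : left_id ehrhart_one ehrhart_mul.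
Proof.
by move=> x; apply/val_inj; rewrite /= add0r add0n -surjective_pairing.
Qed.

Lemma ehrhart_mulC : commutative ehrhart_mul.
Proof. by move=> x y; apply/val_inj; rewrite /= addrC addnC. Qed.

Lemma ehrhart_mulm1 : right_id ehrhart_one ehrhart_mul.
Proof. by move=> x; rewrite ehrhart_mulC ehrhart_mul1m. Qed.

Lemma ehrhart_eq_one (x : monomial) : (exponent x).2 = 0%N -> x = ehrhart_one.
Proof.
case: x => [[p k] pkP] /= k0; apply/val_inj => /=.
move: pkP => /asboolP[u _] /=; rewrite k0 scale0r => p0.
congr pair; apply/rowP => i; move/rowP/(_ i): p0; rewrite !mxE.
by move=> /esym/eqP; rewrite intr_eq0 => /eqP.
Qed.

Lemma ehrhart_unitm (x y : monomial) :
  ehrhart_mul x y = ehrhart_one -> x = ehrhart_one /\ y = ehrhart_one.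
Proof.
move=> /(congr1 (fun z : monomial => (exponent z).2)) /= /eqP.
by rewrite addn_eq0 => /andP[/eqP x0 /eqP y0]; split; apply: ehrhart_eq_one.
Qed.

HB.instance Definition _ := Choice_isMonomialDef.Build monomial
  ehrhart_mulA ehrhart_mul1m ehrhart_mulm1 ehrhart_unitm.
HB.instance Definition _ :=
  MonomialDef_isConomialDef.Build monomial ehrhart_mulC.

End EhrhartMonomial.

Definition ehrhart_ring (R : realType) (n : nat) (b : n.-tuple nat) :
    comNzRingType :=
  {malg R[i][ehrhart_monomial R b]}.

Definition gorenstein_polytope (R : realType) (n : nat) (b : n.-tuple nat) :
    Prop :=
  gorenstein_ring (ehrhart_ring R b).

(* b_j for 0 <= j <= n.+1, with b_0 = b_(n+1) = 1. *)
Definition lh_seq (n : nat) (b : n.-tuple nat) (j : nat) : nat :=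
  nth 1%N (1%N :: b) j.

Definition lh_lcm (n : nat) (b : n.-tuple nat) (j : nat) : nat :=
  lcmn (lh_seq b j) (lh_seq b j.-1).

(* Main.v *)
Require Import Defs.
From HB Require Import structures.
From mathcomp Require Import all_boot all_order all_algebra.
From mathcomp Require Import boolp classical_sets cardinality reals.
From mathcomp Require Import finmap complex monalg ring zify.

(* The cone over P(b) is simplicial, with primitive facet equations l_1, ...,  *)
(* l_(n+1), l_j(x) = N_j (x_j / b_j - x_(j-1) / b_(j-1)).  The values of the   *)
(* l_j identify the lattice points of the cone with the points of N^(n+1) in a *)
(* lattice L that contains m Z^(n+1), m = N_1 ... N_(n+1).  So E(b) = A is     *)
(* spanned by the y^s, s in L, and is free over P = C[y_1^m, ..., y_(n+1)^m],  *)
(* with basis the y^s for s in the box of points of L with coordinates below   *)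
(* m.  The divisibility condition says that (1, ..., 1), equivalently          *)
(* s0 = (m-1, ..., m-1), belongs to L.                                         *)
(*   If s0 is in L, then the coefficient of y^s0 is a functional that makes A  *)
(* isomorphic to Hom_P(A, P).  On Hom_C(A, P), the operators                   *)
(* f |-> y_j^m f - f y_j^m commute and are successively surjective, with       *)
(* common kernel Hom_P(A, P); this bounds the injective dimension of A, and an *)
(* injective resolution over a Noetherian domain localizes.                    *)
(*   Conversely, if the local ring of A at the vertex has finite injective     *)
(* dimension over itself, so has its quotient by the regular sequence          *)
(* y_1^m, ..., y_(n+1)^m.  A module of finite injective dimension over an      *)
(* Artinian local ring is injective, and a self-injective local ring has a     *)
(* simple socle: the box has a unique maximal element.  As each l_j is         *)
(* primitive, some box element has j-th coordinate m-1; so that maximum is s0. *)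
(*   Finiteness: the sum of the 1/N_j is an integer at most n+1, a given       *)
(* number is a sum of n+1 unit fractions in finitely many ways, and b_j        *)
(* divides N_j.                                                                *)

Set Implicit Arguments.
Unset Strict Implicit.
Unset Printing Implicit Defensive.

Import Order.TTheory GRing.Theory Num.Theory.
Local Open Scope ring_scope.

(** * Submodules and quotient modules *)

(** The core is [gorenstein_semigroup_ring], about a semigroup K embedded in N^d by coordinates
    [ex], saturated there and containing m e_i for every i. If each coordinate takes the value m-1
    somewhere on K, its monomial algebra A is Gorenstein exactly when (m-1, ..., m-1) lies in K. The
    facet functions of the cone supply the embedding for E(b) ([gorenstein_polytope_facet]). Since
    (m, ..., m) is in the lattice, membership of (m-1, ..., m-1) amounts to membership of (1, ...,
    1), whose coordinates b_j (1/N_1 + ... + 1/N_j) come from telescoping ([facet_rat]).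

    Sufficiency is duality. Let P be the polynomial ring in the y_i^m. The functional [extend h]
    identifies A with Hom_P(A, P) ([injd_dual]). Over the ground field k, the module Hom_k(A, P) is
    injective over A ([theta_maps0_injective]), and Hom_P(A, P) is reached from it by d kernels of
    surjections ([theta_koszul_surjective]), each costing at most one in injective dimension
    ([injd_kernel]). The bound passes to localizations by [injd_localize], which uses [malg_noeth]
    and [malg_domain].

    Necessity only looks at the vertex. Rees' lemma ([injd_regular_quotient]) passes finite
    injective dimension to the Artinian quotient by the y_i^m, where it forces injectivity
    ([injd_rel_injective]), so a socle element is a multiple of any nonzero element
    ([socle_proportional]). Maximal box monomials are socle elements, hence there is only one
    ([box_maximal_unique]), and it dominates box elements that reach m-1 in each coordinate.

    For finiteness, the condition at j = n+1 makes the sum of the 1/N_i an integer of bounded size;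
    [unit_fractions_bounded] then bounds the N_i, hence the b_i. *)

Section SubmoduleType.
Variables (A : comNzRingType) (V : lmodType A) (P : V -> Prop).
Hypotheses (P0 : P 0) (PD : forall a u v, P u -> P v -> P (a *: u + v)).

Record submodule := Submodule { submodule_val : V; _ : `[< P submodule_val >] }.

HB.instance Definition _ := [isSub for submodule_val].
HB.instance Definition _ := [Choice of submodule by <:].

Fact submodule_closed : submod_closed (fun v => `[< P v >]).
Proof.
split=> [|a u v]; first exact/asboolP.
by move=> /asboolP Pu /asboolP Pv; apply/asboolP/PD.
Qed.

HB.instance Definition _ :=
  GRing.SubChoice_isSubLmodule.Build A V (fun v => `[< P v >]) submodule
    submodule_closed.

Lemma submodule_exists : exists (U : lmodType A) (i : {linear U -> V}),
  injective i /\ forall v, P v <-> exists u, i u = v.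
Proof.
exists submodule, (\val : {linear _ -> _}); split; first exact: val_inj.
move=> v; split=> [Pv|[[u Pu] <-]]; last exact/asboolP.
have Pv' : `[< P v >] by apply/asboolP.
by exists (Submodule Pv').
Qed.

Let eqmod v : pred V := fun w => `[< P (v - w) >].
Let nf v := choose (eqmod v) v.

Let PZ a u : P u -> P (a *: u).
Proof. by move=> Pu; rewrite -[_ *: u]addr0; apply: PD. Qed.
Let Pdiff u v : P u -> P v -> P (u + v).
Proof. by move=> Pu Pv; rewrite -[u]scale1r; apply: PD. Qed.
Let Popp u : P u -> P (- u).
Proof. by rewrite -scaleN1r; apply: PZ. Qed.

Let nfP v : P (v - nf v).
Proof.
have : eqmod v (nf v) by apply: chooseP; rewrite /eqmod subrr; apply/asboolP.
by move/asboolP.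
Qed.

(** Congruent elements define the same coset predicate, and [choose] on a satisfied predicate does
    not depend on the default element. *)
Let nf_eq u v : P (u - v) -> nf u = nf v.
Proof.
move=> Puv; rewrite /nf.
have E : eqmod u =1 eqmod v.
  move=> w; apply: asbool_equiv_eq; split=> H.
  - have -> : v - w = - (u - v) + (u - w) by rewrite opprB addrA subrK.
    by apply: Pdiff => //; apply: Popp.
  - have -> : u - w = (u - v) + (v - w) by rewrite addrA subrK.
    exact: Pdiff.
rewrite (eq_choose E); apply: choose_id.
- by rewrite -E /eqmod subrr; apply/asboolP.
- by rewrite /eqmod subrr; apply/asboolP.
Qed.

Let nfK v : nf (nf v) = nf v.
Proof. by apply: nf_eq; rewrite -opprB; apply: Popp. Qed.

(** A coset is stored as its chosen representative, so the quotient is a subtype of [V]. *)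
Record quotient_module :=
  QuotientModule { quotient_repr : V; _ : nf quotient_repr == quotient_repr }.

HB.instance Definition _ := [isSub for quotient_repr].
HB.instance Definition _ := [Choice of quotient_module by <:].

Let nfK' v : nf (nf v) == nf v. Proof. by rewrite nfK. Qed.
Let pr v := QuotientModule (nfK' v).

Let prK q : pr (quotient_repr q) = q.
Proof. by apply: val_inj => /=; case: q => v /= /eqP. Qed.

Let pr_eq u v : P (u - v) -> pr u = pr v.
Proof. by move=> H; apply: val_inj => /=; apply: nf_eq. Qed.

Let qadd p q := pr (quotient_repr p + quotient_repr q).
Let qopp p := pr (- quotient_repr p).
Let qscale a p := pr (a *: quotient_repr p).

Let prD u v : qadd (pr u) (pr v) = pr (u + v).
Proof.
apply: pr_eq => /=; rewrite -opprB; apply: Popp.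
by rewrite opprD addrACA; apply: Pdiff.
Qed.
Let prN u : qopp (pr u) = pr (- u).
Proof. by apply: pr_eq => /=; rewrite opprK addrC; exact: nfP. Qed.
Let prZ a u : qscale a (pr u) = pr (a *: u).
Proof.
apply: pr_eq => /=; rewrite -scalerBr -opprB scalerN.
by apply/Popp/PZ.
Qed.

Let prW (T : quotient_module -> Prop) : (forall v, T (pr v)) -> forall q, T q.
Proof. by move=> H q; rewrite -[q]prK. Qed.

Let qaddA : associative qadd.
Proof.
elim/prW=> u; elim/prW=> v; elim/prW=> w; by rewrite !prD addrA.
Qed.
Let qaddC : commutative qadd.
Proof. by elim/prW=> u; elim/prW=> v; rewrite !prD addrC. Qed.
Let qadd0 : left_id (pr 0) qadd.
Proof. by elim/prW=> u; rewrite prD add0r. Qed.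
Let qaddN : left_inverse (pr 0) qopp qadd.
Proof. by elim/prW=> u; rewrite prN prD addNr. Qed.

HB.instance Definition _ := GRing.isZmodule.Build quotient_module
  qaddA qaddC qadd0 qaddN.

Let qscaleA a b p : qscale a (qscale b p) = qscale (a * b) p.
Proof. by elim/prW: p => u; rewrite !prZ scalerA. Qed.
Let qscale1 : left_id 1 qscale.
Proof. by elim/prW=> u; rewrite prZ scale1r. Qed.
Let qscaleDr : right_distributive qscale +%R.
Proof.
move=> a; elim/prW=> u; elim/prW=> v.
by rewrite /GRing.add /= prZ prZ !prD prZ scalerDr.
Qed.
Let qscaleDl p : {morph qscale^~ p : a b / a + b}.
Proof.
elim/prW: p => u a b; rewrite /= !prZ [RHS]prD.
by rewrite scalerDl.
Qed.

HB.instance Definition _ := GRing.Zmodule_isLmodule.Build A quotient_module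
  qscaleA qscale1 qscaleDr qscaleDl.

Let pr_linear : linear pr.
Proof. by move=> a u v; rewrite -prD -prZ. Qed.

HB.instance Definition _ := GRing.isLinear.Build A V quotient_module *:%R pr
  pr_linear.

Lemma quotient_exists : exists (C : lmodType A) (p : {linear V -> C}),
  (forall c, exists v, p v = c) /\ forall v, p v = 0 <-> P v.
Proof.
exists quotient_module, (pr : {linear _ -> _}); split=> [c|v].
  by exists (quotient_repr c); apply: prK.
split=> [H|Pv]; last by apply: (@pr_eq v 0); rewrite subr0.
move/(congr1 quotient_repr): H => /= H.
have -> : v = (v - nf v) - (0 - nf 0) by rewrite H sub0r opprK subrK.
by apply: Pdiff => //; apply: Popp.
Qed.

End SubmoduleType.

(** * Extension of linear maps *)

Section LinearMaps.
Variable A : comNzRingType.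
Implicit Types U V W E C : lmodType A.

Lemma linear_mk U V (f : U -> V) : linear f ->
  exists g : {linear U -> V}, forall u, g u = f u.
Proof.
move=> fL; pose m := GRing.isLinear.Build A U V *:%R f fL.
pose g : {linear U -> V} := HB.pack f m.
by exists g.
Qed.

Lemma lift_injective U V W (i : {linear U -> V}) (g : {linear W -> V}) :
  injective i -> (forall w, exists u, i u = g w) ->
  exists h : {linear W -> U}, forall w, i (h w) = g w.
Proof.
move=> i_inj /choice[h hE].
have hL : linear h by move=> a u v; apply: i_inj; rewrite linearP !hE linearP.
by have [h' h'E] := linear_mk hL; exists h' => w; rewrite h'E hE.
Qed.

Lemma factor_surjective V C W (p : {linear V -> C}) (g : {linear V -> W}) :
  (forall c, exists v, p v = c) -> (forall v, p v = 0 -> g v = 0) ->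
  exists h : {linear C -> W}, forall v, h (p v) = g v.
Proof.
move=> /choice[s sE] pg.
have gE u v : p u = p v -> g u = g v.
  by move=> uv; apply/subr0_eq; rewrite -linearB pg// linearB uv subrr.
have hL : linear (fun c => g (s c)).
  by move=> a u v /=; rewrite -linearP; apply: gE; rewrite linearP !sE.
by have [h hE] := linear_mk hL; exists h => v; rewrite hE; apply: gE.
Qed.

(* The one-step hypothesis says that a partial map can be extended to one more *)
(* element [v], by sending it to [c].                                          *)
Lemma linear_extension U V E (i : {linear U -> V}) (f : {linear U -> E}) :
  injective i ->
  (forall (D : V -> Prop) (g : V -> E),
     (forall u, D (i u) /\ g (i u) = f u) ->
     (forall a u v, D u -> D v ->
        D (a *: u + v) /\ g (a *: u + v) = a *: g u + g v) ->
     (exists v, ~ D v) ->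
     exists v c, ~ D v /\ forall a, D (a *: v) -> g (a *: v) = a *: c) ->
  exists g : {linear V -> E}, forall u, g (i u) = f u.
Proof.
move=> i_inj step.
pose good (X : set (V * E)) := [/\ forall u, X (i u, f u),
  forall a x y, X x -> X y -> X (a *: x + y) & forall e, X (0, e) -> e = 0].
(* The guard accounts for the empty chain, whose union is empty and so does not contain the graph of
   [f]. *)
pose P (X : set (V * E)) := (exists x, X x) -> good X.
have [F FP Ftot|X [PX Xmax]] := @Zorn_bigcup _ P.
  case=> x [Y FY Yx]; have Ygood : good Y by apply: FP => //; exists x.
  split=> [u|a y z [Y1 FY1 Y1y] [Y2 FY2 Y2z]|e [Y' FY' Y'e]].
  - by exists Y => //; case: Ygood.
  - have [Y12|Y21] := Ftot _ _ FY1 FY2.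
    + exists Y2 => //; have [_ + _] := FP _ FY2 (ex_intro _ z Y2z).
      by apply => //; apply: Y12.
    + exists Y1 => //; have [_ + _] := FP _ FY1 (ex_intro _ y Y1y).
      by apply => //; apply: Y21.
  - by have [_ _] := FP _ FY' (ex_intro _ _ Y'e); apply.
(* An empty maximal [X] would be properly contained in the graph of [f] along [i]. *)
have [Xf XL X0] : good X.
  apply: PX; apply: contrapT => XN.
  apply: (Xmax (fun x => exists u, x = (i u, f u))).
    rewrite properEneq; split; last by move=> x Xx; case: XN; exists x.
    apply/eqP => XE; apply: XN; exists (i 0, f 0); rewrite XE; by exists 0.
  move=> _; split=> [u|a _ _ [u ->] [v ->]|e [u [iu ->]]]; first by exists u.
    by exists (a *: u + v); rewrite !linearP.
  have -> : u = 0 by apply: i_inj; rewrite -iu linear0.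
  by rewrite linear0.
have XB x y : X x -> X y -> X (x - y).
  by move=> Xx Xy; rewrite addrC -scaleN1r; apply: XL.
have Xfun v e1 e2 : X (v, e1) -> X (v, e2) -> e1 = e2.
  move=> X1 X2; apply/subr0_eq/X0.
  have <- : (v, e1) - (v, e2) = (0, e1 - e2) by congr pair; apply: subrr.
  exact: XB.
have X00 : X 0 by have := XB _ _ (Xf 0) (Xf 0); rewrite subrr.
have [Xtot|] := pselect (forall v, exists e, X (v, e)).
  have [g gX] := choice Xtot.
  have gL : linear g.
    by move=> a u v; apply: (Xfun (a *: u + v)) => //; apply: (XL a (u, g u) (v, g v)).
  have [h hE] := linear_mk gL.
  by exists h => u; rewrite hE; apply: (Xfun (i u)).
move=> /existsNP Xntot; exfalso.
pose D v := exists e, X (v, e).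
have [g gX] : exists g : V -> E, forall v, D v -> X (v, g v).
  suff /choice[g gX] : forall v, exists e, D v -> X (v, e) by exists g.
  by move=> v; have [[e Xe]|nD] := pselect (D v); [exists e | exists 0].
have [u|a u v Du Dv||v [c [nDv vc]]] := step D g.
- split; first by exists (f u).
  by apply: (Xfun (i u)) => //; apply: gX; exists (f u).
- have Xuv := XL a _ _ (gX _ Du) (gX _ Dv).
  have Duv : D (a *: u + v) by eexists; exact: Xuv.
  by split=> //; apply: Xfun (gX _ Duv) _; exact: Xuv.
- by case: Xntot => v nv; exists v.
(* Adjoining the multiples of [(v, c)] enlarges the graph; it stays single-valued because [c] is
   compatible with [g] on the multiples of [v] already in [D]. *)
pose Y : set (V * E) := fun y => exists b x, X x /\ y = x + b *: (v, c).
apply: (Xmax Y).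
  rewrite properEneq; split; last first.
    by move=> x Xx; exists 0, x; rewrite scale0r addr0.
  apply/eqP => XE; apply: nDv; exists c; rewrite XE.
  by exists 1, 0; rewrite scale1r add0r.
move=> _; split=> [u|a _ _ [b [x [Xx ->]]] [b' [x' [Xx' ->]]]|e [b [x [Xx xE]]]].
- by exists 0, (i u, f u); rewrite scale0r addr0.
- exists (a * b + b'), (a *: x + x'); split; first exact: XL.
  by rewrite scalerDr scalerDl scalerA addrACA.
- case: x => x1 x2 in Xx xE; case: xE => x1E x2E.
  have bvE : b *: v = - x1.
    by apply/eqP; rewrite -addr_eq0 addrC -x1E.
  have XN : X (b *: v, - x2).
    have := XB _ _ X00 Xx; rewrite sub0r bvE; exact.
  have Db : D (b *: v) by eexists; exact: XN.
  have := vc b Db; rewrite (Xfun _ _ _ (gX _ Db) XN) => x2b.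
  by rewrite x2E -x2b subrr.
Qed.

End LinearMaps.

(** * Injective dimension *)

Section InjectiveDimension.
Variable A : comNzRingType.
Implicit Types (a : A -> Prop) (M N I C D E J U V W X Y : lmodType A).

(** Modules over the quotient of [A] by [a] are encoded as [A]-modules killed by [a], so that
    enlarging [a] does not change the ring. *)
Definition killed a M := forall r, a r -> forall x : M, r *: x = 0.

Definition rel_injective a M :=
  forall U V (i : {linear U -> V}) (f : {linear U -> M}),
  killed a V -> injective i -> exists g : {linear V -> M}, forall u, g (i u) = f u.

Definition short_exact M I C (i : {linear M -> I}) (p : {linear I -> C}) :=
  [/\ injective i, forall c, exists x, p x = c
    & forall x, p x = 0 <-> exists m, i m = x].

(* The injective dimension of [M] in the category of modules killed by [a] is *)
(* at most [e].                                                               *)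
Fixpoint injd a e M : Prop :=
  if e is e'.+1 then
    exists I C (i : {linear M -> I}) (p : {linear I -> C}),
      [/\ killed a I, rel_injective a I, short_exact i p & injd a e' C]
  else killed a M /\ rel_injective a M.

Lemma killed_sub a M I (i : {linear M -> I}) :
  injective i -> killed a I -> killed a M.
Proof. by move=> ii kI r ar x; apply: ii; rewrite linearZ linear0 /= kI. Qed.

Lemma killed_quotient a I C (p : {linear I -> C}) :
  (forall c, exists x, p x = c) -> killed a I -> killed a C.
Proof. by move=> ps kI r ar x; have [y <-] := ps x; rewrite -linearZ kI // linear0. Qed.

Lemma rel_injective_retract a M I (i : {linear M -> I}) (r : {linear I -> M}) :
  (forall m, r (i m) = m) -> rel_injective a I -> rel_injective a M.
Proof.
move=> ri injI U V j f kV jj.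
have [g gE] := injI _ _ j (i \o f) kV jj.
by exists (r \o g) => u /=; rewrite gE /= ri.
Qed.

Lemma rel_injective_prod a M I :
  rel_injective a M -> rel_injective a I -> rel_injective a (M * I)%type.
Proof.
move=> injM injI U V j f kV jj.
have [g gE] := injM _ _ j (fst \o f) kV jj.
have [h hE] := injI _ _ j (snd \o f) kV jj.
have [k kE] : exists k : {linear V -> (M * I)%type}, forall v, k v = (g v, h v).
  by apply: linear_mk => b u v; rewrite !linearP.
by exists k => u; rewrite kE gE hE /=; case: (f u).
Qed.

Lemma short_exact_coker M I (i : {linear M -> I}) : injective i ->
  exists C (p : {linear I -> C}), short_exact i p.
Proof.
move=> ii.
have [|b u v [m <-] [m' <-]|C [p [ps pE]]] :=
  @quotient_exists A I (fun x => exists m, i m = x).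
- by exists 0; rewrite linear0.
- by exists (b *: m + m'); rewrite linearP.
by exists C, p.
Qed.

Lemma short_exact_comp M I C (i : {linear M -> I}) (p : {linear I -> C}) m :
  short_exact i p -> p (i m) = 0.
Proof. by case=> _ _ pE; apply/pE; exists m. Qed.

(** Injectivity of [M] gives a retraction [r]; the remainder [x - i (r x)] vanishes on [M], so it
    descends to a section of [p]. *)
Lemma split_retraction a M I C (i : {linear M -> I}) (p : {linear I -> C}) :
  killed a I -> rel_injective a M -> short_exact i p ->
  exists (r : {linear I -> M}) (s : {linear C -> I}),
    [/\ forall m, r (i m) = m, forall c, p (s c) = c,
        forall c, r (s c) = 0 & forall x, x = i (r x) + s (p x)].
Proof.
move=> kI injM ex; have [ii ps pE] := ex.
have [r rE] := injM _ _ i idfun kI ii.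
have [t tE] : exists t : {linear I -> I}, forall x, t x = x - i (r x).
  by apply: linear_mk => b u v; rewrite (linearP r) (linearP i) opprD scalerBr addrACA.
have [|s sE] := @factor_surjective _ _ _ _ p t ps.
  by move=> x /pE[m <-]; rewrite tE rE subrr.
exists r, s; split=> // [c|c|x].
- by have [x <-] := ps c; rewrite sE tE linearB (short_exact_comp _ ex) subr0.
- by have [x <-] := ps c; rewrite sE tE linearB rE subrr.
- by rewrite sE tE addrC subrK.
Qed.

Lemma rel_injective_quotient a M I C (i : {linear M -> I}) (p : {linear I -> C}) :
  killed a I -> rel_injective a M -> rel_injective a I -> short_exact i p ->
  rel_injective a C.
Proof.
move=> kI injM injI ex.
have [r [s [_ ps _ _]]] := split_retraction kI injM ex.
exact: rel_injective_retract ps injI.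
Qed.

Lemma rel_injective_extension a M I C (i : {linear M -> I}) (p : {linear I -> C}) :
  killed a I -> rel_injective a M -> rel_injective a C -> short_exact i p ->
  rel_injective a I.
Proof.
move=> kI injM injC ex.
have [r [s [_ _ _ xE]]] := split_retraction kI injM ex.
have [j jE] : exists j : {linear I -> (M * C)%type}, forall x, j x = (r x, p x).
  by apply: linear_mk => b u v; rewrite !linearP.
have [k kE] : exists k : {linear (M * C)%type -> I}, forall x, k x = i x.1 + s x.2.
  by apply: linear_mk => b u v; rewrite !linearP scalerDr addrACA.
apply: (@rel_injective_retract a I _ j k); last exact: rel_injective_prod.
by move=> x; rewrite jE kE -xE.
Qed.

Lemma rel_injective_triv a M : (forall x : M, x = 0) -> rel_injective a M.
Proof.
move=> M0 U V i f _ _; have [g _] : exists g : {linear V -> M}, forall v, g v = 0.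
  by apply: linear_mk => b u v; rewrite scaler0 addr0.
by exists g => u; rewrite [LHS]M0 [RHS]M0.
Qed.

Lemma injdS a e M : injd a e M -> injd a e.+1 M.
Proof.
elim: e M => [|e IH] M; last first.
  by move=> [I [C [i [p [kI iI ex /IH]]]]]; exists I, C, i, p.
move=> [kM iM]; have [C [p ex]] := @short_exact_coker M M idfun (@inj_id _).
exists M, C, idfun, p; split=> //.
have C0 (c : C) : c = 0.
  by case: ex => _ ps pE; have [x <-] := ps c; apply/pE; exists x.
by split; [move=> r _ x; rewrite [LHS]C0 | apply: rel_injective_triv].
Qed.

Lemma injd_iso a e M N (h : {linear M -> N}) : injective h ->
  (forall y, exists x, h x = y) -> injd a e M -> injd a e N.
Proof.
move=> ih hs; have [y|r rE] := lift_injective (g := idfun) ih.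
  by have [x <-] := hs y; exists x.
case: e => [|e].
  move=> [kM iM]; split; first exact: killed_quotient kM.
  exact: (rel_injective_retract rE iM).
move=> [I [C [i [p [kI iI [ii ps pE] dC]]]]].
exists I, C, (i \o r), p; split=> //; split=> // [u v /= /ii uv|x].
  by rewrite -[u]rE -[v]rE uv.
rewrite pE; split=> -[m <-]; last by exists (r m).
by exists (h m) => /=; congr (i _); apply: ih; rewrite rE.
Qed.

End InjectiveDimension.

(** * Injective dimension in short exact sequences *)

Section Horseshoe.
Variable A : comNzRingType.
Implicit Types (M I C D E J U V W X Y : lmodType A).
Let a0 (r : A) := r = 0.

Lemma killed0 M : killed a0 M.
Proof. by move=> _ -> x; rewrite scale0r. Qed.
Hint Resolve killed0 : core.

(** Horseshoe lemma: [C] embeds in the product of [I] and [J] by an extension of [i1] to [C]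
    together with [i2 \o p], and the cokernel is an extension of [D'] by [Y'], to which induction
    applies. *)
Lemma injd_extension e Y C D (i : {linear Y -> C}) (p : {linear C -> D}) :
  short_exact i p -> injd a0 e Y -> injd a0 e D -> injd a0 e C.
Proof.
elim: e Y C D i p => [|e IH] Y C D i p ex.
  by move=> [_ iY] [_ iD]; split=> //; apply: rel_injective_extension ex.
have [ii ps pE] := ex.
move=> [I [Y' [i1 [p1 [_ iI ex1 dY']]]]] [J [D' [i2 [p2 [_ iJ ex2 dD']]]]].
have [ii1 ps1 pE1] := ex1; have [ii2 ps2 pE2] := ex2.
have [r rE] := iI _ _ i i1 (@killed0 C) ii.
have [f fE] : exists f : {linear C -> (I * J)%type}, forall c, f c = (r c, i2 (p c)).
  by apply: linear_mk => b u v; rewrite !linearP.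
have fi : injective f.
  move=> u v; rewrite !fE => -[ruv puv]; apply/subr0_eq.
  have /pE[y yE] : p (u - v) = 0 by rewrite linearB (ii2 _ _ puv) subrr.
  suff -> : u - v = i 0 by rewrite linear0.
  rewrite -yE; congr (i _); apply: ii1.
  by rewrite -rE yE linearB ruv subrr linear0.
have [C' [q exq]] := @short_exact_coker _ _ _ f fi.
have [_ qs qE] := exq.
exists (I * J)%type, C', f, q; split=> //; first exact: rel_injective_prod.
have [g gE] : exists g : {linear I -> C'}, forall x, g x = q (x, 0).
  apply: linear_mk => b u v; rewrite -linearP; congr (q _).
  by congr pair; rewrite /= scaler0 addr0.
have [x /pE1[y <-]|j jE] := @factor_surjective _ _ _ _ p1 g ps1.
  rewrite gE; apply/qE; exists (i y); rewrite fE rE.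
  by rewrite (short_exact_comp _ ex) linear0.
have [_ /qE[c <-]|k kE] := @factor_surjective _ _ _ _ q (p2 \o snd) qs.
  by rewrite fE /= (short_exact_comp _ ex2).
apply: (IH _ _ _ j k _ dY' dD'); split.
- move=> u v /eqP; rewrite -subr_eq0 -linearB => /eqP uv; apply/subr0_eq.
  have [x xE] := ps1 (u - v); move: uv; rewrite -xE jE gE => /qE[c].
  rewrite fE => -[rx pc0]; apply/pE1.
  have /pE[y yE] : p c = 0 by apply: ii2; rewrite pc0 linear0.
  by exists y; rewrite -rE yE.
- by move=> d; have [z <-] := ps2 d; exists (q (0, z)); rewrite kE.
- move=> x; have [[u v] <-] := qs x; rewrite kE /=; split.
    move=> /pE2[d]; have [c <-] := ps d => vE.
    exists (p1 (u - r c)); rewrite jE gE; apply/subr0_eq; rewrite -linearB.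
    apply/qE; exists (- c); rewrite linearN fE vE.
    congr pair; rewrite /= ?sub0r //.
    by rewrite addrC addKr.
  move=> [y]; have [z <-] := ps1 y; rewrite jE gE => /eqP.
  rewrite eq_sym -subr_eq0 -linearB => /eqP /qE[c]; rewrite fE => -[_].
  by rewrite subr0 => <-; rewrite (short_exact_comp _ ex2).
Qed.

(** With [X] inside an injective [I], the quotient I/M is an extension of I/X by Y = X/M, so the
    horseshoe lemma bounds its injective dimension. *)
Lemma injd_kernel e M X Y (i : {linear M -> X}) (p : {linear X -> Y}) :
  short_exact i p -> injd a0 e X -> injd a0 e Y -> injd a0 e.+1 M.
Proof.
case: e => [|e] ex.
  by move=> [_ iX] iY; exists X, Y, i, p; split.
move=> [I [D [i1 [p1 [_ iI ex1 dD]]]]] dY.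
have [ii ps pE] := ex; have [ii1 ps1 pE1] := ex1.
have [C [q exq]] := @short_exact_coker _ _ _ (i1 \o i) (inj_comp ii1 ii).
have [_ qs qE] := exq.
exists I, C, (i1 \o i), q; split=> //.
have [x /pE[m <-]|j jE] := @factor_surjective _ _ _ _ p (q \o i1) ps.
  exact: (short_exact_comp _ exq).
have [x /qE[m <-]|k kE] := @factor_surjective _ _ _ _ q p1 qs.
  exact: (short_exact_comp _ ex1).
apply: (@injd_extension e.+1 _ _ _ j k) (injdS dD); last exact: dY.
split=> [u v /eqP|d|x].
- rewrite -subr_eq0 -linearB => /eqP uv; apply/subr0_eq.
  have [x xE] := ps (u - v); move: uv; rewrite -xE jE => /qE[m] /= mE.
  by apply/pE; exists m; apply: ii1.
- by have [z <-] := ps1 d; exists (q z); rewrite kE.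
- have [u <-] := qs x; rewrite kE; split=> [/pE1[z <-]|[y]].
    by exists (p z); rewrite jE.
  have [z <-] := ps y; rewrite jE /= => /eqP.
  rewrite eq_sym -subr_eq0 -linearB => /eqP /qE[m] /= mE.
  have -> : u = i1 (i m + z) by rewrite linearD mE subrK.
  exact: (short_exact_comp _ ex1).
Qed.

End Horseshoe.

(** * Comparison with injective resolutions *)

Section InjdimLe.
Variable A : comNzRingType.
Implicit Types (M I C : lmodType A).
Let a0 (r : A) := r = 0.

Lemma injective_moduleP M : injective_module M <-> rel_injective a0 M.
Proof.
split=> [iM U V i f _ ii|iM U V i f ii]; first exact: iM.
by apply: iM => //; apply: killed0.
Qed.

Lemma zero_module_exists : exists Z : lmodType A, forall x : Z, x = 0.
Proof.
have [//|b u v -> ->|Z [i [ii iE]]] := @submodule_exists A A^o (fun x => x = 0).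
  by rewrite scaler0 addr0.
by exists Z => x; apply: ii; rewrite linear0; apply/iE; exists x.
Qed.

(** The short exact sequences of the recursion are spliced at their cokernels; the terms past the
    end are the zero module. *)
Lemma injd_injdim_le e M : injd a0 e M -> injdim_le M e.
Proof.
elim: e M => [|e IH] M.
  move=> [_ iM]; have [Z Z0] := zero_module_exists.
  pose I k : lmodType A := if k is 0 then M else Z.
  pose d k : {linear I k -> I k.+1} := \0.
  exists I, idfun, d; split=> //.
  - by case=> [|k]; apply/injective_moduleP; [exact iM | exact: rel_injective_triv].
  - by move=> x; split=> // _; exists x.
  - by move=> k x; split=> // _; exists 0; rewrite linear0 [RHS]Z0.
  - by case.
move=> [I [C [i [p [_ iI [ii ps pE] /IH [J [j [d [iJ ij jE dE dJ]]]]]]]]].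
pose K k : lmodType A := if k is k'.+1 then J k' else I.
pose dK k : {linear K k -> K k.+1} :=
  match k with 0 => (j \o p : {linear _ -> _}) | k'.+1 => d k' end.
exists K, i, dK; split=> //.
- by case=> [|k]; [apply/injective_moduleP; exact iI | exact: iJ].
- move=> x; rewrite -pE /=; split=> [|->]; last by rewrite linear0.
  by rewrite -(linear0 j) => /ij.
- case=> [|k] x /=; last exact: dE.
  rewrite jE; split=> [[c <-]|[y <-]]; last by exists (p y).
  by have [y <-] := ps c; exists y.
- by case=> // k; apply: dJ.
Qed.

(** The cokernel of the first embedding is the kernel of the map out of [I 1], resolved by the
    shifted sequence. In dimension zero [I 1] vanishes, so the embedding is onto. *)
Lemma injdim_le_injd e M : injdim_le M e -> injd a0 e M.
Proof.
elim: e M => [|e IH] M [I [i [d [iI ii iE dE dI]]]].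
  split; first exact: killed0.
  have [x|r rE] := lift_injective (g := idfun) ii.
    by apply/iE; apply: dI.
  apply: (@rel_injective_retract _ _ _ (I 0%N) i r); last exact/injective_moduleP.
  by move=> m; apply: ii; rewrite rE.
have [|b u v|C [j [jj jE]]] := @submodule_exists A (I 1%N) (fun x => d 1%N x = 0).
- by rewrite linear0.
- by rewrite linearP => -> ->; rewrite scaler0 addr0.
have [x|p pE] := lift_injective (g := d 0%N) jj.
  by apply/jE/dE; exists x.
exists (I 0%N), C, i, p; split; first exact: killed0.
- exact/injective_moduleP.
- split=> // [c|x].
    have /dE[x xE] : d 1%N (j c) = 0 by apply/jE; exists c.
    by exists x; apply: jj; rewrite pE.
  rewrite -iE -pE; split=> [->|]; first by rewrite linear0.
  by rewrite -[RHS](linear0 j) => /jj.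
apply: IH; exists (fun k => I k.+1), j, (fun k => d k.+1); split=> // k ke.
exact: dI.
Qed.

End InjdimLe.

(** * Extension of maps defined on ideals *)

Section Baer.
Variable A : comNzRingType.
Implicit Types (a J : A -> Prop) (M I C D X : lmodType A).

Definition ideal J := J 0 /\ forall r x y, J x -> J y -> J (r * x + y).

Lemma ideal0 J : ideal J -> J 0. Proof. by case. Qed.
Lemma idealD J x y : ideal J -> J x -> J y -> J (x + y).
Proof. by move=> [_ H] Jx Jy; rewrite -[x]mul1r; apply: H. Qed.
Lemma idealM J r x : ideal J -> J x -> J (r * x).
Proof. by move=> [J0 H] Jx; rewrite -[_ * _]addr0; apply: H. Qed.
Lemma idealN J x : ideal J -> J x -> J (- x).
Proof. by move=> iJ Jx; rewrite -mulN1r; apply: idealM. Qed.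
Lemma idealB J x y : ideal J -> J x -> J y -> J (x - y).
Proof. by move=> iJ Jx Jy; apply: idealD => //; apply: idealN. Qed.

Definition ideal_linear J M (f : A -> M) :=
  forall r x y, J x -> J y -> f (r * x + y) = r *: f x + f y.

(** [f] is a map on J/a, a submodule of A/a; [y] is the value at 1 of an extension to A/a. *)
Lemma baer_extension a J M (f : A -> M) :
  ideal a -> ideal J -> (forall r, a r -> J r) -> ideal_linear J f ->
  (forall r, a r -> f r = 0) -> rel_injective a M ->
  exists y, forall r, J r -> f r = r *: y.
Proof.
move=> ia iJ aJ fL fa iM.
have [||V [p [ps pE]]] := @quotient_exists A A^o a.
- exact: ideal0.
- by case: ia.
have [|b _ _ [x [Jx <-]] [y [Jy <-]]|U [i [ii iE]]] :=
  @submodule_exists A V (fun v => exists x, J x /\ p x = v).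
- by exists 0; rewrite linear0; split=> //; apply: ideal0.
- by exists (b * x + y); split; [case: iJ => _; apply | rewrite (linearP p)].
have /choice[h hE] : forall u, exists x, J x /\ p x = i u.
  by move=> u; apply/iE; exists u.
have f_eq x y : J x -> J y -> p x = p y -> f x = f y.
  move=> Jx Jy /eqP; rewrite -subr_eq0 -linearB => /eqP /pE /fa fxy.
  apply/subr0_eq; rewrite -[RHS]fxy.
  by rewrite [x - y]addrC -mulN1r fL // scaleN1r addrC.
have fhL : linear (fun u => f (h u)).
  move=> b u v /=; have [Ju pu] := hE u; have [Jv pv] := hE v.
  rewrite -fL //; apply: f_eq.
  - by case: (hE (b *: u + v)).
  - by case: iJ => _; apply.
  - by case: (hE (b *: u + v)) => _ ->; rewrite (linearP p) pu pv linearP.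
have [g gE] := linear_mk fhL.
have kV : killed a V.
  move=> r ar v; have [x <-] := ps v; rewrite -linearZ; apply/pE.
  by rewrite /= /GRing.scale /= mulrC; apply: idealM.
have [k kE] := iM _ _ i g kV ii.
exists (k (p 1)) => r Jr.
have [u uE] : exists u, i u = p r.
  by apply/iE; exists r.
rewrite -linearZ -linearZ /= [r *: 1]mulr1 -uE kE gE.
by have [Ju pu] := hE u; apply: f_eq => //; rewrite pu uE.
Qed.

End Baer.

(** * Reduction modulo a regular element *)

Section Rees.
Variable A : comNzRingType.
Implicit Types (a m : A -> Prop) (M I C D X N T : lmodType A).

Definition add_gen a x r := exists al rho, a al /\ r = al + rho * x.

Lemma ideal_add_gen a x : ideal a -> ideal (add_gen a x).
Proof.
move=> ia; split=> [|r _ _ [al [rho [aal ->]]] [al' [rho' [aal' ->]]]].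
  by exists 0, 0; rewrite mul0r addr0; split=> //; apply: ideal0.
exists (r * al + al'), (r * rho + rho'); split; first by case: ia => _; apply.
by rewrite mulrDr mulrDl mulrA addrACA.
Qed.

Lemma add_gen_sub a x r : a r -> add_gen a x r.
Proof. by move=> ar; exists r, 0; rewrite mul0r addr0. Qed.

(** The last hypothesis makes al + rho x |-> f al + rho z well defined on the ideal a + xA;
    extending it to [A] produces [y]. *)
Lemma ideal_linear_extension (b a : A -> Prop) M (f : A -> M) x z :
  ideal b -> ideal a -> (forall r, b r -> a r) -> ideal_linear a f ->
  (forall r, b r -> f r = 0) -> rel_injective b M ->
  (forall r, a (r * x) -> f (r * x) = r *: z) ->
  exists y : M, (forall r, a r -> f r = r *: y) /\ x *: y = z.
Proof.
move=> ib ia ba fL fb iM xz.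
have fD u v : a u -> a v -> f (u + v) = f u + f v.
  by move=> au av; rewrite -{1}[u]mul1r fL // scale1r.
have f0 : f 0 = 0 by apply: (addrI (f 0)); rewrite -fD ?addr0; try exact: ideal0.
have fM r u : a u -> f (r * u) = r *: f u.
  by move=> au; rewrite -[r * u]addr0 fL ?f0 ?addr0 //; apply: ideal0.
have [g gE] : exists g : A -> M,
    forall al rho, a al -> g (al + rho * x) = f al + rho *: z.
  suff /choice[g gE] : forall r, exists y : M,
      forall al rho, a al -> r = al + rho * x -> y = f al + rho *: z.
    by exists g => al rho aal; exact: (gE _ al rho aal erefl).
  move=> r; have [[al [rho [aal ->]]]|nr] := pselect (add_gen a x r); last first.
    exists 0 => al rho aal rE; case: nr.
    by exists al, rho.
  exists (f al + rho *: z) => al' rho' aal' E.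
  have E' : (rho - rho') * x = al' - al.
    by rewrite -[al'](addrK (rho' * x)) -E; ring.
  have ad : a (al' - al) by exact: idealB.
  have fal : f al' = f al + (rho - rho') *: z.
    by rewrite -xz E' // -fD // addrC subrK.
  by rewrite fal scalerBl -addrA subrK.
have gL : ideal_linear (add_gen a x) g.
  move=> r _ _ [al [rho [aal ->]]] [al' [rho' [aal' ->]]].
  rewrite mulrDr mulrA addrACA -mulrDl !gE //; last by case: ia => _; apply.
  by rewrite fL // scalerDl scalerDr scalerA addrACA.
have gf r : a r -> g r = f r.
  by move=> ar; rewrite -[r in LHS]addr0 -(mul0r x) gE // scale0r addr0.
have [r br|r br|y yE] := baer_extension ib (ideal_add_gen x ia) _ gL _ iM.
- by apply/add_gen_sub/ba.
- by rewrite gf ?fb //; apply: ba.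
have gx : g x = z.
  by rewrite -[x]mul1r -[1 * x]add0r gE ?scale1r ?f0 ?add0r //; apply: ideal0.
exists y; split=> [r ar|].
  by rewrite -yE ?gf //; apply: add_gen_sub.
rewrite -gx yE //.
by exists 0, 1; rewrite mul1r add0r; split=> //; apply: ideal0.
Qed.

Lemma cyclic_extension a M x z : ideal a -> rel_injective a M ->
  (forall r, a (r * x) -> r *: z = 0) -> exists y : M, x *: y = z.
Proof.
move=> ia iM xz.
have [|r arx|y [_ yz]] :=
  @ideal_linear_extension a a M (fun=> 0) x z ia ia (fun _ => id) _
    (fun _ _ => erefl) iM.
- by move=> r u v _ _; rewrite scaler0 addr0.
- by rewrite xz.
by exists y.
Qed.

(** An embedding of [X] in an injective [J] induces one of N = X/I in J/I, which is injective and
    leaves the same cokernel [C]. *)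
Lemma injd_quotient a e I X N (i : {linear I -> X}) (p : {linear X -> N}) :
  rel_injective a I -> short_exact i p -> injd a e X -> injd a e N.
Proof.
case: e => [|e] iI ex.
  move=> [kX iX]; split; first by case: ex => _ ps _; apply: killed_quotient kX.
  exact: rel_injective_quotient ex.
have [ii ps pE] := ex.
move=> [J [C [j [q [kJ iJ exq dC]]]]]; have [ij qs qE] := exq.
have [K [k exk]] := @short_exact_coker _ _ _ (j \o i) (inj_comp ij ii).
have [_ ks kE] := exk.
have [x /pE[u <-]|f fE] := @factor_surjective _ _ _ _ p (k \o j) ps.
  exact: (short_exact_comp _ exk).
have [x /kE[u <-]|g gE] := @factor_surjective _ _ _ _ k q ks.
  exact: (short_exact_comp _ exq).
exists K, C, f, g; split=> //; first exact: killed_quotient kJ.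
  exact: rel_injective_quotient exk.
split=> [u v /eqP|c|x].
- rewrite -subr_eq0 -linearB => /eqP uv; apply/subr0_eq.
  have [x xE] := ps (u - v); move: uv; rewrite -xE fE => /kE[z] /= /ij <-.
  exact: (short_exact_comp _ ex).
- by have [y <-] := qs c; exists (k y); rewrite gE.
- have [y <-] := ks x; rewrite gE; split=> [/qE[z <-]|[u]].
    by exists (p z); rewrite fE.
  have [z <-] := ps u; rewrite fE /= => /eqP.
  rewrite eq_sym -subr_eq0 -linearB => /eqP /kE[v] /= vE.
  have -> : y = j (i v + z) by rewrite linearD vE subrK.
  exact: (short_exact_comp _ exq).
Qed.

Definition torsion_of x X T (j : {linear T -> X}) :=
  injective j /\ forall v, x *: v = 0 <-> exists t, j t = v.

Lemma torsion_of_exists x X : exists T (j : {linear T -> X}), torsion_of x j.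
Proof.
apply: submodule_exists => [|r u v xu xv]; first by rewrite scaler0.
by rewrite scalerDr scalerA mulrC -scalerA xu xv scaler0 addr0.
Qed.

Lemma torsion_of_scale x X T (j : {linear T -> X}) (t : T) :
  torsion_of x j -> x *: t = 0.
Proof. by move=> [ij jE]; apply: ij; rewrite linear0 linearZ; apply/jE; exists t. Qed.

Lemma torsion_of_map x X I (TX TI : lmodType A) (j : {linear TX -> X}) (k : {linear TI -> I})
    (f : {linear X -> I}) : torsion_of x j -> torsion_of x k ->
  exists g : {linear TX -> TI}, forall t, k (g t) = f (j t).
Proof.
move=> jT [ik kE]; apply: (lift_injective (g := f \o j)) => // t; apply/kE.
by rewrite -linearZ (torsion_of_scale _ jT) linear0.
Qed.

Variables (a : A -> Prop) (x : A).
Hypotheses (ia : ideal a) (xreg : forall r, a (r * x) -> a r).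

Lemma injective_divisible M : killed a M -> rel_injective a M ->
  forall z : M, exists y, x *: y = z.
Proof.
move=> kM iM z; apply: (@cyclic_extension a) => // r /xreg ar.
exact: kM.
Qed.

Lemma killed_torsion X T (j : {linear T -> X}) :
  killed a X -> torsion_of x j -> killed (add_gen a x) T.
Proof.
move=> kX jT _ [al [rho [aal ->]]] t.
rewrite scalerDl -scalerA (torsion_of_scale _ jT) scaler0 addr0.
by case: jT => ij _; apply: (killed_sub ij kX).
Qed.

Lemma rel_injective_torsion X T (j : {linear T -> X}) :
  rel_injective a X -> torsion_of x j -> rel_injective (add_gen a x) T.
Proof.
move=> iX jT U V i f kV ii; have [ij jE] := jT.
have kV' : killed a V by move=> r ar; apply: kV; apply: add_gen_sub.
have [g gE] := iX _ _ i (j \o f) kV' ii.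
have [v|h hE] := lift_injective (g := g) ij.
  apply/jE; rewrite -linearZ kV ?linear0 //.
  by exists 0, 1; rewrite mul1r add0r; split=> //; apply: ideal0.
by exists h => u; apply: ij; rewrite hE gE.
Qed.

(** Divisibility of [X] keeps [0 -> X -> I -> C -> 0] exact on [x]-torsion, and [C], a quotient of
    the divisible [I], is divisible in turn. *)
Lemma injd_torsion e X T (j : {linear T -> X}) :
  injd a e X -> (forall z : X, exists y, x *: y = z) -> torsion_of x j ->
  injd (add_gen a x) e T.
Proof.
elim: e X T j => [|e IH] X T j dX Xdiv jT.
  by case: dX => kX iX; split; [apply: killed_torsion jT | apply: rel_injective_torsion jT].
have [I [C [i [p [kI iI ex dC]]]]] := dX; have [ii ps pE] := ex.
have [TI [jI jTI]] := torsion_of_exists x I.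
have [TC [jC jTC]] := torsion_of_exists x C.
have [f fE] := torsion_of_map i jT jTI; have [g gE] := torsion_of_map p jTI jTC.
exists TI, TC, f, g; split.
- exact: killed_torsion jTI.
- exact: rel_injective_torsion jTI.
- have [ij jE] := jT; have [ijI jIE] := jTI; have [ijC jCE] := jTC.
  split=> [u v uv|c|t].
  + by apply/ij/ii; rewrite -!fE uv.
  + have /jCE : exists t, jC t = jC c by exists c.
    have [y yE] := ps (jC c); rewrite -yE -linearZ => /pE[u uE].
    have [u' u'E] := Xdiv u.
    have /jIE[t tE] : x *: (y - i u') = 0.
      by rewrite scalerBr -linearZ u'E uE subrr.
    exists t; apply: ijC; rewrite gE tE linearB (short_exact_comp _ ex) subr0.
    by rewrite yE.
  + split=> [t0|[u <-]]; last first.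
      by apply: ijC; rewrite gE fE (short_exact_comp _ ex) linear0.
    have /pE[u uE] : p (jI t) = 0 by rewrite -gE t0 linear0.
    have /jE[s sE] : x *: u = 0.
      by apply: ii; rewrite linearZ uE linear0 -linearZ (torsion_of_scale _ jTI) linear0.
    by exists s; apply: ijI; rewrite fE sE.
- apply: (IH _ _ jC) => // c; have [y <-] := ps c.
  by have [z <-] := injective_divisible kI iI y; exists (p z); rewrite linearZ.
Qed.

(** Rees' lemma. As [M] has no [x]-torsion and [I] is divisible, the snake lemma gives 0 -> I[x] ->
    C[x] -> M/xM -> 0, where I[x] is injective over the quotient by a + xA. *)
Lemma injd_regular_quotient e M N (q : {linear M -> N}) :
  injd a e M -> (forall u : M, x *: u = 0 -> u = 0) ->
  (forall v, exists u, q u = v) -> (forall u, q u = 0 <-> exists v, x *: v = u) ->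
  injd (add_gen a x) e N.
Proof.
move=> dM Mreg qs qE.
case: e dM => [[kM iM]|e [I [C [i [p [kI iI ex dC]]]]]].
  have N0 (v : N) : v = 0.
    by have [u <-] := qs v; apply/qE; apply: injective_divisible.
  by split; [move=> r _ v; rewrite [LHS]N0 | apply: rel_injective_triv].
have [ii ps pE] := ex.
have [TI [jI jTI]] := torsion_of_exists x I.
have [TC [jC jTC]] := torsion_of_exists x C.
have [ijI jIE] := jTI; have [ijC jCE] := jTC.
have [f fE] := torsion_of_map p jTI jTC.
have Idiv := injective_divisible kI iI.
(* The graph of the connecting map: lift [c] to [I], multiply by [x], and read the result in [M]
   modulo [x]. *)
pose R c v := exists y u, [/\ p y = jC c, x *: y = i u & v = q u].
have Rtot c : exists v, R c v.
  have /jCE : exists t, jC t = jC c by exists c.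
  by have [y yE] := ps (jC c); rewrite -yE -linearZ => /pE[u uE]; exists (q u), y, u.
have Rlin b c v c' v' : R c v -> R c' v' -> R (b *: c + c') (b *: v + v').
  move=> [y [u [yE uE ->]]] [y' [u' [yE' uE' ->]]].
  exists (b *: y + y'), (b *: u + u'); split.
  - by rewrite linearP yE yE' linearP.
  - by rewrite linearP -uE -uE' scalerDr !scalerA [x * b]mulrC.
  - by rewrite linearP.
have R0 v : R 0 v -> v = 0.
  move=> [y [u [yE uE ->]]]; move: yE; rewrite linear0 => /pE[w wE].
  by apply/qE; exists w; apply: ii; rewrite linearZ wE.
have Rfun c v v' : R c v -> R c v' -> v = v'.
  move=> Rv Rv'; apply/subr0_eq/R0.
  by have := Rlin (-1) _ _ _ _ Rv' Rv; rewrite !scaleN1r ![- _ + _]addrC subrr.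
have [d dR] := choice Rtot.
have dL : linear d by move=> b u v; apply: (Rfun (b *: u + v)) => //; apply: Rlin.
have [g gE] := linear_mk dL.
have exf : short_exact f g.
  split=> [u v uv|v|c].
  - apply/subr0_eq/ijI; rewrite linear0.
    have /pE[w wE] : p (jI (u - v)) = 0 by rewrite -fE linearB uv subrr linear0.
    rewrite -wE (Mreg w) ?linear0 //; apply: ii.
    by rewrite linearZ wE linear0 -linearZ (torsion_of_scale _ jTI) linear0.
  - have [u <-] := qs v; have [y yE] := Idiv (i u).
    have /jCE[c cE] : x *: p y = 0 by rewrite -linearZ yE (short_exact_comp _ ex).
    by exists c; rewrite gE; apply: (Rfun c) => //; exists y, u.
  - rewrite gE; split=> [d0|[t <-]].
      have [y [u [yE uE]]] := dR c; rewrite d0 => /esym/qE[w wE].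
      have /jIE[t tE] : x *: (y - i w) = 0.
        by rewrite scalerBr -linearZ wE uE subrr.
      exists t; apply: ijC; rewrite fE tE linearB (short_exact_comp _ ex) subr0.
      exact: yE.
    apply: (Rfun (f t)) => //; exists (jI t), 0; rewrite fE !linear0; split=> //.
    by rewrite -linearZ (torsion_of_scale _ jTI) linear0.
apply: injdS; apply: injd_quotient exf _; first exact: rel_injective_torsion jTI.
apply: injd_torsion dC _ jTC => c; have [y <-] := ps c.
by have [z <-] := Idiv y; exists (p z); rewrite linearZ.
Qed.

End Rees.

(** * Modules of finite injective dimension over an Artinian local ring *)

Section Artinian.
Variables (A : comNzRingType) (a m : A -> Prop) (w : A) (n : nat).
Hypotheses (ia : ideal a) (im : ideal m) (am : forall r, a r -> m r)
  (munit : forall r, ~ m r -> exists s, s * r = 1)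
  (mnil : forall s : seq A, size s = n -> (forall r, r \in s -> m r) ->
     a (\prod_(r <- s) r))
  (aw : ~ a w) (mw : forall r, m r -> a (r * w)).
Implicit Types (M I C D : lmodType A).

(** [w] represents a nonzero socle element modulo [a], so its annihilator is proper and contains no
    unit. *)
Lemma annihilator_socle r : a (r * w) -> m r.
Proof.
move=> arw; apply: contrapT => /munit[s sr]; apply: aw.
by rewrite -[w]mul1r -sr -mulrA; apply: idealM.
Qed.

(* [f] extends over [I] to [r |-> r *: y]; the image of [y] in [D] is killed by *)
(* [m], hence of the form [w *: z] as [D] is injective, and subtracting [w *:] a *)
(* lift of [z] moves [y] into [C].                                              *)
Lemma maximal_extension C I D (i : {linear C -> I}) (p : {linear I -> D})
    (f : A -> C) :
  killed a I -> rel_injective a I -> rel_injective a D -> short_exact i p ->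
  ideal_linear m f -> (forall r, a r -> f r = 0) ->
  exists c, forall r, m r -> f r = r *: c.
Proof.
move=> kI iI iD ex fL fa; have [ii ps pE] := ex.
have [b x y mx my|r ar|y yE] := @baer_extension _ a m I (i \o f) ia im am _ _ iI.
- by rewrite /= fL // linearP.
- by rewrite /= fa // linear0.
have [r arw|z zE] := @cyclic_extension _ a D w (p y) ia iD.
  by rewrite -linearZ -yE /= ?(short_exact_comp _ ex) //; apply: annihilator_socle.
have [z' z'E] := ps z.
have /pE[c cE] : p (y - w *: z') = 0 by rewrite linearB linearZ /= z'E zE subrr.
exists c => r mr; apply: ii; rewrite linearZ /= cE scalerBr scalerA (kI _ (mw mr)).
by rewrite subr0 -yE.
Qed.

(** Otherwise [v0] could be multiplied by arbitrarily many elements of [m] without entering [D],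
    against nilpotence. *)
Lemma maximal_step_exists (V : lmodType A) (D : V -> Prop) (kV : killed a V) :
  D 0 -> (exists v, ~ D v) -> exists v, ~ D v /\ forall r, m r -> D (r *: v).
Proof.
move=> D0 [v0 nDv0]; apply: contrapT => none.
have step k : exists s : seq A, [/\ size s = k, forall r, r \in s -> m r &
    ~ D ((\prod_(r <- s) r) *: v0)].
  elim: k => [|k [s [sz sm nDs]]].
    by exists [::]; split=> //; rewrite big_nil scale1r.
  apply: contrapT => nxt; apply: none; exists ((\prod_(r <- s) r) *: v0).
  split=> // r mr; apply: contrapT => nDr; apply: nxt; exists (r :: s); split.
  - by rewrite /= sz.
  - by move=> t; rewrite inE => /orP[/eqP->|/sm].
  - by rewrite big_cons -scalerA.
by have [s [sz sm]] := step n; apply; rewrite (kV _ (mnil sz sm)).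
Qed.

(** Testing extensions from the maximal ideal suffices: a partial map misses some [v] with all of
    [m v] in its domain, and only multiples of [v] by elements of [m] lie in that domain. *)
Lemma rel_injective_maximal C : killed a C ->
  (forall f : A -> C, ideal_linear m f -> (forall r, a r -> f r = 0) ->
     exists c, forall r, m r -> f r = r *: c) ->
  rel_injective a C.
Proof.
move=> kC H U V i f kV ii; apply: linear_extension => // D g Di Dlin nD.
have D0 : D 0 by have [+ _] := Di 0; rewrite linear0.
have g0 : g 0 = 0 by have [_] := Di 0; rewrite !linear0.
have [v [nDv mv]] := maximal_step_exists kV D0 nD.
have [b x y mx my|r ar|c cE] := H (fun r => g (r *: v)).
- by have [_ <-] := Dlin b _ _ (mv _ mx) (mv _ my); rewrite scalerDl scalerA.
- by rewrite kV.
exists v, c; split=> // r Drv; apply: cE; apply: contrapT => /munit[s sr].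
apply: nDv; rewrite -[v]scale1r -sr -scalerA.
by have [] := Dlin s _ _ Drv D0; rewrite addr0.
Qed.

(** The resolution collapses from its far end: once the cokernel is injective, [maximal_extension]
    makes [M] injective. *)
Lemma injd_rel_injective e M : injd a e M -> rel_injective a M.
Proof.
elim: e M => [|e IH] M; first by case.
move=> [I [C [i [p [kI iI ex /IH iC]]]]].
apply: rel_injective_maximal; first by case: ex => ii _ _; exact: killed_sub ii kI.
by move=> f fL fa; apply: (maximal_extension kI iI iC ex).
Qed.

(** [M] is A/a, which is self-injective here. Sending [u] to the socle element [v] is well defined,
    as the annihilator of [u] lies in [m], and an extension of this map is multiplication by some
    [r]. *)
Lemma socle_proportional e M (p : {linear A^o -> M}) u v :
  injd a e M -> (forall y, exists x, p x = y) -> (forall x, p x = 0 <-> a x) ->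
  ~ a u -> (forall r, m r -> a (r * v)) -> exists r, a (v - r * u).
Proof.
move=> dM ps pE au mv.
have [r aru|y yE] := @cyclic_extension _ a M u (p v) ia (injd_rel_injective dM).
  rewrite -linearZ; apply/pE; apply: mv; apply: contrapT => /munit[s sr].
  by apply: au; rewrite -[u]mul1r -sr -mulrA; apply: idealM.
have [r rE] := ps y; exists r; apply/pE.
by rewrite linearB -yE -rE -linearZ /GRing.scale /= mulrC subrr.
Qed.

End Artinian.

(** * Noetherian rings *)

Section Noetherian.
Implicit Types A Q : comNzRingType.

Definition generated A (s : seq A) (x : A) :=
  forall J, ideal J -> (forall y, y \in s -> J y) -> J x.

Lemma ideal_generated A (s : seq A) : ideal (generated s).
Proof.
split=> [J iJ _|r x y gx gy J iJ sJ]; first exact: ideal0.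
by case: (iJ) => _; apply; [apply: gx | apply: gy].
Qed.

Lemma generated_mem A (s : seq A) y : y \in s -> generated s y.
Proof. by move=> ys J _; apply. Qed.

Lemma generated_sub A (s t : seq A) x :
  (forall y, y \in s -> generated t y) -> generated s x -> generated t x.
Proof. by move=> st; apply => //; apply: ideal_generated. Qed.

Definition noeth A := forall J : A -> Prop, ideal J ->
  exists s : seq A, (forall y, y \in s -> J y) /\ forall x, J x -> generated s x.

Lemma noeth_field (k : fieldType) : noeth k.
Proof.
move=> J iJ; have [[x [Jx x0]]|nJ] := pselect (exists x, J x /\ x != 0).
  exists [:: 1]; split=> [y|y _].
    by rewrite inE => /eqP->; rewrite -(mulVf x0); apply: idealM.
  rewrite -[y]mulr1; apply: (idealM _ (ideal_generated _)).
  by apply: generated_mem; apply: mem_head.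
exists [::]; split=> // y Jy.
have [->|y0] := eqVneq y 0; first exact: (ideal0 (ideal_generated _)).
by case: nJ; exists y.
Qed.

Lemma noeth_surjective Q A (phi : {rmorphism Q -> A}) :
  (forall x, exists q, phi q = x) -> noeth Q -> noeth A.
Proof.
move=> phis nQ J iJ.
have ipre (I : A -> Prop) : ideal I -> ideal (fun q => I (phi q)).
  move=> iI; split=> [|r x y Ix Iy]; first by rewrite rmorph0; apply: ideal0.
  by rewrite rmorphD rmorphM; case: iI => _; apply.
have [s [sJ Js]] := nQ _ (ipre J iJ).
exists [seq phi q | q <- s]; split=> [_ /mapP[q qs ->]|x]; first exact: sJ.
have [q <-] := phis x => /Js gq I iI sI; apply: (gq (fun q => I (phi q))).
  exact: ipre.
by move=> y ys; apply/sI/map_f.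
Qed.

Lemma seq_choice (S T : eqType) (R : S -> T -> Prop) (s : seq S) :
  (forall c, c \in s -> exists f, R c f) ->
  exists t : seq T, (forall f, f \in t -> exists2 c, c \in s & R c f) /\
    forall c, c \in s -> exists2 f, f \in t & R c f.
Proof.
elim: s => [|c s IH] H; first by exists [::].
have [|t [tR sR]] := IH; first by move=> d ds; apply: H; rewrite inE ds orbT.
have [|f cf] := H c; first exact: mem_head.
exists (f :: t); split=> [g|d]; rewrite inE => /orP[/eqP->|].
- by exists c => //; apply: mem_head.
- by move=> /tR[d ds dg]; exists d => //; rewrite inE ds orbT.
- by exists f => //; apply: mem_head.
- by move=> /sR[g gt dg]; exists g => //; rewrite inE gt orbT.
Qed.

(** * Hilbert's basis theorem *)

Section Hilbert.
Variables (A : comNzRingType) (nA : noeth A) (J : {poly A} -> Prop) (iJ : ideal J).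

Let size_lin (r : A) (f g : {poly A}) n :
  (size f <= n)%N -> (size g <= n)%N -> (size (r%:P * f + g)%R <= n)%N.
Proof.
move=> fn gn; rewrite (leq_trans (size_polyD _ _)) // geq_max gn andbT.
by rewrite mul_polyC (leq_trans (size_scale_leq _ _)).
Qed.

Lemma leading_ideal_generated n (s : seq A) (t : seq {poly A}) :
  (forall c, c \in s -> exists f, [/\ generated t f, (size f <= n.+1)%N & f`_n = c]) ->
  forall c, generated s c ->
    exists f, [/\ generated t f, (size f <= n.+1)%N & f`_n = c].
Proof.
move=> H c gc.
apply: (gc (fun c => exists f, [/\ generated t f, (size f <= n.+1)%N & f`_n = c])) => //.
split=> [|r x y [f [gf sf <-]] [g [gg sg <-]]].
  by exists 0; rewrite size_poly0 coef0; split=> //; exact: (ideal0 (ideal_generated _)).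
exists (r%:P * f + g); split; last by rewrite coefD coefCM.
- by case: (ideal_generated t) => _; apply.
- exact: size_lin.
Qed.

Lemma size_sub_leading (f g : {poly A}) n :
  (size f <= n.+1)%N -> (size g <= n.+1)%N -> f`_n = g`_n -> (size (f - g)%R <= n)%N.
Proof.
move=> fn gn fg; apply/leq_sizeP => j; rewrite leq_eqVlt => /orP[/eqP<-|nj].
  by rewrite coefB fg subrr.
by rewrite coefB !nth_default ?subrr // (leq_trans _ nj).
Qed.

(** Induction on the bound: the [n]-th coefficients of elements of [J] of size at most [n.+1] form a
    finitely generated ideal, and lifts of its generators cancel the top coefficient. *)
Lemma bounded_degree_generated n : exists t : seq {poly A},
  (forall f, f \in t -> J f) /\
  forall f, J f -> (size f <= n)%N -> generated t f.
Proof.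
elim: n => [|n [t [tJ Jt]]].
  exists [::]; split=> // f _; rewrite leqn0 size_poly_eq0 => /eqP->.
  exact: (ideal0 (ideal_generated _)).
pose R c (f : {poly A}) := [/\ J f, (size f <= n.+1)%N & f`_n = c].
have [|s [sL Ls]] := nA (J := fun c => exists f, R c f).
  split=> [|r x y [f [Jf sf <-]] [g [Jg sg <-]]].
    by exists 0; rewrite /R size_poly0 coef0; split=> //; apply: ideal0.
  exists (r%:P * f + g); split; last by rewrite coefD coefCM.
  - by case: iJ => _; apply.
  - exact: size_lin.
have [u [uR sR]] := seq_choice sL.
exists (u ++ t); split=> [f|f Jf fn].
  by rewrite mem_cat => /orP[/uR[c _ []] //|]; apply: tJ.
have sub_u g : generated u g -> generated (u ++ t) g.
  by apply: generated_sub => y yu; apply: generated_mem; rewrite mem_cat yu.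
have sub_t g : generated t g -> generated (u ++ t) g.
  by apply: generated_sub => y yt; apply: generated_mem; rewrite mem_cat yt orbT.
have [c cs|g [gg gn gf]] :=
  @leading_ideal_generated n s u _ f`_n (Ls _ (ex_intro _ f (And3 Jf fn erefl))).
  by have [g gu [Jg gn gc]] := sR c cs; exists g; split=> //; apply: generated_mem.
have Jfg : J (f - g).
  by apply: (idealB iJ) => //; apply: (gg J) => // y /uR[c' _ []].
rewrite -[f](subrK g); apply: (idealD (ideal_generated _)); last exact: sub_u.
exact: (sub_t _ (Jt _ Jfg (size_sub_leading fn gn (esym gf)))).
Qed.

(** Above size [n0] the leading coefficient is cancelled by shifts of finitely many elements of [J];
    what remains is covered by [bounded_degree_generated]. *)
Lemma hilbert_basis_ideal : exists t : seq {poly A},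
  (forall f, f \in t -> J f) /\ forall f, J f -> generated t f.
Proof.
pose R c (f : {poly A}) := J f /\ exists n, (size f <= n.+1)%N /\ f`_n = c.
have shift (f : {poly A}) n k :
    (size f <= n.+1)%N -> (size ('X^k * f)%R <= (n + k).+1)%N.
  move=> fn; rewrite (leq_trans (size_polyMleq _ _)) // size_polyXn.
  by rewrite addSn /= addnC -addSn leq_add2r.
have [|s [sL Ls]] := nA (J := fun c => exists f, R c f).
  split=> [|r x y [f [Jf [n [sf <-]]]] [g [Jg [k [sg <-]]]]].
    exists 0; split; first exact: ideal0.
    by exists 0%N; rewrite size_poly0 coef0.
  (* The shifts bring both leading coefficients to the common degree [n + k]. *)
  exists (r%:P * ('X^k * f) + 'X^n * g); split.
    by case: (iJ) => _; apply; apply: idealM.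
  exists (n + k)%N; split.
    by apply: size_lin; [exact: shift | rewrite addnC; exact: shift].
  rewrite coefD coefCM !coefXnM ltnNge leq_addl /= addnK.
  by rewrite ltnNge leq_addr /= addKn.
have [u [uR sR]] := seq_choice sL.
have [N uN] : exists N, forall f, f \in u -> (size f <= N)%N.
  elim: {uR sR} u => [|f u [N IH]]; first by exists 0%N.
  exists (maxn (size f) N) => g; rewrite inE => /orP[/eqP->|/IH gN].
    exact: leq_maxl.
  by rewrite (leq_trans gN) ?leq_maxr.
have [n0 sN] : exists n0, forall c, c \in s ->
    exists f n, [/\ f \in u, (n <= n0)%N, (size f <= n.+1)%N & f`_n = c].
  elim: (s) sR => [|c s' IH] sR; first by exists 0%N.
  have [|n0 IH0] := IH; first by move=> d ds; apply: sR; rewrite inE ds orbT.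
  have [|f fu [_ [n [fn fc]]]] := sR c; first exact: mem_head.
  exists (maxn n n0) => d; rewrite inE => /orP[/eqP->|/IH0[g [k [gu kn gk gd]]]].
    by exists f, n; rewrite leq_maxl.
  by exists g, k; rewrite (leq_trans kn) ?leq_maxr.
have [t [tJ Jt]] := bounded_degree_generated n0.
have uJ f : f \in u -> J f by move=> /uR[c _ []].
exists (u ++ t); split=> [f|f Jf].
  by rewrite mem_cat => /orP[/uJ|/tJ].
have sub_u g : generated u g -> generated (u ++ t) g.
  by apply: generated_sub => y yu; apply: generated_mem; rewrite mem_cat yu.
have sub_t g : generated t g -> generated (u ++ t) g.
  by apply: generated_sub => y yt; apply: generated_mem; rewrite mem_cat yt orbT.
have [n fn] := ubnP (size f); elim: n f fn Jf => // n IH f fn Jf.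
have [fn0|] := leqP (size f) n0; first exact: (sub_t _ (Jt _ Jf fn0)).
case fE : (size f) => [//|k]; rewrite ltnS => n0k.
have Lf : exists g, R f`_k g by exists f; split=> //; exists k; rewrite fE.
have [c cs|g [gg gn gf]] := @leading_ideal_generated k s u _ f`_k (Ls _ Lf).
  have [g [j [gu jn gj gc]]] := sN c cs.
  exists ('X^(k - j) * g); split.
  - by apply: (idealM _ (ideal_generated _)); exact: generated_mem.
  - by rewrite -{2}(subnKC (leq_trans jn n0k)) shift.
  - by rewrite coefXnM ltnNge leq_subr /= subKn // (leq_trans jn).
rewrite -[f](subrK g); apply: (idealD (ideal_generated _)); last exact: sub_u.
apply: IH; last by apply: (idealB iJ) => //; apply: (gg J).
by rewrite ltnS in fn; rewrite (leq_trans _ fn) // fE ltnS; apply: size_sub_leading; rewrite ?fE.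
Qed.

End Hilbert.

Lemma noeth_poly A : noeth A -> noeth {poly A}.
Proof. by move=> nA J; apply: hilbert_basis_ideal. Qed.

(** [Q] is an iterated polynomial ring over [k], with one variable for each element of [gs]. *)
Lemma noeth_cover (k : fieldType) A (io : {rmorphism k -> A}) (gs : seq A) :
  exists (Q : comNzRingType) (phi : {rmorphism Q -> A}), [/\ noeth Q,
    forall c, exists q, phi q = io c & forall g, g \in gs -> exists q, phi q = g].
Proof.
elim: gs => [|g gs [Q [phi [nQ phik phig]]]].
  by exists k, io; split=> //; [exact: noeth_field | move=> c; exists c].
have cg : commr_rmorph phi g by move=> x; apply: mulrC.
exists {poly Q}, (horner_morph cg : {rmorphism _ -> _}); split.
- exact: noeth_poly.
- by move=> c; have [q <-] := phik c; exists q%:P; rewrite /= horner_morphC.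
- move=> h; rewrite inE => /orP[/eqP->|/phig[q <-]].
    by exists 'X; rewrite /= horner_morphX.
  by exists q%:P; rewrite /= horner_morphC.
Qed.

Lemma noeth_noetherian A : noeth A -> noetherian A.
Proof.
move=> nA I [I0 _ Ilin].
have [|s [sI Is]] := nA (fun x => x \in I).
  by split=> // r x y xI yI; apply: Ilin.
exists s => x; split=> [/Is gx|[c ->]].
  apply: (gx (fun x => exists c : 'I_(size s) -> A, x = \sum_(i < size s) c i * s`_i)).
    split=> [|r _ _ [c ->] [d ->]].
      by exists (fun=> 0); rewrite big1 // => i _; rewrite mul0r.
    exists (fun i => r * c i + d i); rewrite mulr_sumr -big_split /=.
    by apply: eq_bigr => i _; rewrite mulrDl mulrA.
  move=> y /(nthP 0)[i si <-]; exists (fun j => (j == Ordinal si)%:R).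
  rewrite (bigD1 (Ordinal si)) //= eqxx mul1r big1 ?addr0 // => j /negbTE->.
  by rewrite mul0r.
elim/big_rec: _ => // i x0 _ xI; apply: Ilin => //; apply: sI; exact: mem_nth.
Qed.

End Noetherian.

(** * Localization of injective resolutions *)

Definition restrict_scalars (A S : comNzRingType) (f : {rmorphism A -> S})
  (V : lmodType S) : Type := V.

Section RestrictScalars.
Variables (A S : comNzRingType) (f : {rmorphism A -> S}) (V : lmodType S).

HB.instance Definition _ := GRing.Zmodule.on (restrict_scalars f V).

Let rscale (a : A) (v : restrict_scalars f V) : restrict_scalars f V :=
  f a *: (v : V).

Let rscaleA a b v : rscale a (rscale b v) = rscale (a * b) v.
Proof. by rewrite /rscale scalerA rmorphM. Qed.
Let rscale1 : left_id 1 rscale.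
Proof. by move=> v; rewrite /rscale rmorph1 scale1r. Qed.
Let rscaleDr : right_distributive rscale +%R.
Proof. by move=> a u v; rewrite /rscale scalerDr. Qed.
Let rscaleDl v : {morph rscale^~ v : a b / a + b}.
Proof. by move=> a b; rewrite /rscale rmorphD scalerDl. Qed.

HB.instance Definition _ := GRing.Zmodule_isLmodule.Build A
  (restrict_scalars f V) rscaleA rscale1 rscaleDr rscaleDl.

Lemma restrict_scaleE (a : A) (v : restrict_scalars f V) :
  a *: v = f a *: (v : V).
Proof. by []. Qed.

Lemma semilinearD (M : lmodType A) (l : {linear M -> restrict_scalars f V}) x y :
  l (x + y) = (l x : V) + (l y : V) :> V.
Proof. exact: (linearD l). Qed.

Lemma semilinearZ (M : lmodType A) (l : {linear M -> restrict_scalars f V}) a x :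
  l (a *: x) = f a *: (l x : V) :> V.
Proof. exact: (linearZ_LR l). Qed.

End RestrictScalars.

Section LocalizeInjdim.
Variables (A S : comNzRingType) (f : {rmorphism A -> S}) (T : A -> Prop).
Hypotheses (nA : noeth A) (T1 : T 1) (TM : forall s t, T s -> T t -> T (s * t))
  (Treg : forall t r, T t -> t * r = 0 -> r = 0)
  (funit : forall s, T s -> exists u, f s * u = 1)
  (ffrac : forall y, exists a s, T s /\ y * f s = f a)
  (fker : forall a, f a = 0 -> exists2 s, T s & s * a = 0).
Implicit Types (M I C G : lmodType A) (N : lmodType S).
Let a0 (r : A) := r = 0.
Let b0 (r : S) := r = 0.

Lemma ideal_a0 : ideal a0.
Proof. by split=> // r x y -> ->; rewrite mulr0 addr0. Qed.

Lemma scale_unit_inj N t (x y : N) : T t -> f t *: x = f t *: y -> x = y.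
Proof.
move=> /funit[u fu] xy.
by rewrite -[x]scale1r -[y]scale1r -fu mulrC -!scalerA xy.
Qed.

Lemma scale_unit_surj N t (x : N) : T t -> exists y, f t *: y = x.
Proof. by move=> /funit[u fu]; exists (u *: x); rewrite scalerA fu scale1r. Qed.

(** The increasing union of the colon ideals (J : t^n) is finitely generated, so it is reached at a
    finite stage. *)
Lemma torsion_chain (J : A -> Prop) t : ideal J ->
  exists n, forall r, J (r * t ^+ n.+1) -> J (r * t ^+ n).
Proof.
move=> iJ; have [|s [sJ Js]] := nA (J := fun r => exists n, J (r * t ^+ n)).
  split=> [|r x y [i Ji] [j Jj]].
    by exists 0%N; rewrite mul0r; apply: ideal0.
  exists (i + j)%N; rewrite exprD.
  have -> : (r * x + y) * (t ^+ i * t ^+ j) =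
    (r * t ^+ j) * (x * t ^+ i) + t ^+ i * (y * t ^+ j) by ring.
  by apply: idealD => //; apply: idealM.
have [n sn] : exists n, forall y, y \in s -> J (y * t ^+ n).
  elim: (s) sJ => [|x s' IH] sJ; first by exists 0%N.
  have [|n nP] := IH; first by move=> y ys; apply: sJ; rewrite inE ys orbT.
  have [m mP] := sJ x (mem_head _ _).
  exists (n + m)%N => y; rewrite inE exprD => /orP[/eqP->|/nP Jy].
    by rewrite mulrCA; apply: idealM.
  by rewrite mulrA mulrC; apply: idealM.
exists n => r Jr; have gr : generated s r by apply: Js; exists n.+1.
apply: (gr (fun r => J (r * t ^+ n))) => //; split=> [|c x y Jx Jy].
  by rewrite mul0r; apply: ideal0.
by rewrite mulrDl -mulrA; case: iJ => _; apply.
Qed.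

Definition T_torsion M (m : M) := exists t, T t /\ t *: m = 0.

(* By [torsion_chain], a partial map into the torsion that is killed by [t]   *)
(* vanishes on multiples of [t ^+ n.+1], so it extends to an element of [I]   *)
(* that [t ^+ n.+1] kills.                                                    *)
Lemma T_torsion_injective I G (j : {linear G -> I}) :
  rel_injective a0 I -> injective j ->
  (forall x, T_torsion x <-> exists g, j g = x) -> rel_injective a0 G.
Proof.
move=> iI ij jE U V i h _ ii; apply: linear_extension => // D g Di Dlin [v nDv].
have D0 : D 0 by have [+ _] := Di 0; rewrite linear0.
have g0 : g 0 = 0 by have [_] := Di 0; rewrite !linear0.
pose J r := D (r *: v).
have iJ : ideal J.
  split=> [|r x y Jx Jy]; first by rewrite /J scale0r.
  by rewrite /J scalerDl -scalerA; have [] := Dlin r _ _ Jx Jy.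
have gL r x y : J x -> J y -> g ((r * x + y) *: v) = r *: g (x *: v) + g (y *: v).
  by move=> Jx Jy; have [_ <-] := Dlin r _ _ Jx Jy; rewrite scalerDl scalerA.
have gM r x : J x -> g ((r * x) *: v) = r *: g (x *: v).
  by move=> Jx; rewrite -[r * x]addr0 gL ?scale0r ?g0 ?addr0 //; apply: ideal0.
have Gtor (x : G) : exists t, T t /\ t *: x = 0.
  have [t [Tt tx]] : T_torsion (j x) by apply/jE; exists x.
  by exists t; split=> //; apply: ij; rewrite linearZ linear0.
(* A single [t] kills all values, as it need only kill those at finitely many generators of [J]. *)
have [t [Tt tJ]] : exists t, T t /\ forall r, J r -> t *: g (r *: v) = 0.
  have [s [sJ Js]] := nA iJ.
  have [t [Tt ts]] : exists t, T t /\ forall r, r \in s -> t *: g (r *: v) = 0.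
    elim: {sJ Js} s => [|r s [t [Tt ts]]]; first by exists 1.
    have [u [Tu ur]] := Gtor (g (r *: v)).
    exists (t * u); split; first exact: TM.
    move=> q; rewrite inE => /orP[/eqP->|/ts tq].
      by rewrite -scalerA ur scaler0.
    by rewrite mulrC -scalerA tq scaler0.
  exists t; split=> // r Jr.
  have [] : J r /\ t *: g (r *: v) = 0; last by [].
  apply: (Js r Jr (fun r => J r /\ t *: g (r *: v) = 0)); last first.
    by move=> y ys; split; [apply: sJ | apply: ts].
  split=> [|q x y [Jx tx] [Jy ty]].
    by rewrite scale0r g0 scaler0; split=> //; apply: ideal0.
  split; first by case: iJ => _; apply.
  by rewrite gL // scalerDr ty addr0 scalerA mulrC -scalerA tx scaler0.
have [n nP] := torsion_chain t iJ.
have Tn : T (t ^+ n.+1) by elim: (n.+1) => [|k Tk]; rewrite ?expr0 // exprS; apply: TM.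
have [|r x y Jx Jy|r r0|r Jr|y [yE ty]] :=
  @ideal_linear_extension _ a0 J I (fun r => j (g (r *: v))) (t ^+ n.+1) 0
    ideal_a0 iJ _ _ _ iI.
- by move=> r; rewrite /a0 => ->; apply: ideal0.
- by rewrite gL // linearP.
- by rewrite (r0 : r = 0) scale0r g0 linear0.
- by rewrite scaler0 exprS mulrCA gM ?tJ ?linear0 //; apply: nP.
have /jE[c cE] : T_torsion y by exists (t ^+ n.+1).
by exists v, c; split=> // r Jr; apply: ij; rewrite yE // linearZ /= cE.
Qed.

(** The localization of [M], characterized by its kernel and its fractions instead of being
    constructed. *)
Definition is_locmod M N (l : {linear M -> restrict_scalars f N}) :=
  (forall m, l m = 0 <-> T_torsion m) /\
  (forall n : N, exists t m, T t /\ f t *: n = l m).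

Lemma T_torsion_exists M : exists G (j : {linear G -> M}),
  injective j /\ forall x, T_torsion x <-> exists g, j g = x.
Proof.
apply: submodule_exists => [|a u v [s [Ts su]] [t [Tt tv]]].
  by exists 1; rewrite scaler0.
exists (s * t); split; first exact: TM.
rewrite scalerDr -[_ *: v]scalerA tv scaler0 addr0 scalerA.
have -> : s * t * a = t * a * s by ring.
by rewrite -scalerA su scaler0.
Qed.

Lemma T_divisible I : rel_injective a0 I -> forall t (z : I), T t ->
  exists y, t *: y = z.
Proof.
move=> iI t z Tt; apply: cyclic_extension ideal_a0 iI _ => r.
by rewrite /a0 mulrC => /(Treg Tt) ->; rewrite scale0r.
Qed.

(** Since [M] is divisible by [T], it maps onto [N] with kernel its torsion, which is injective; so
    [N] is injective over [A]. As [A]-linear maps between [S]-modules are [S]-linear, it is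
    injective over [S] too. *)
Lemma locmod_injective M N (l : {linear M -> restrict_scalars f N}) :
  rel_injective a0 M -> is_locmod l -> rel_injective b0 N.
Proof.
move=> iM [lk ls].
have [G [j [ij jE]]] := T_torsion_exists M.
have ex : short_exact j l.
  split=> // [n|x]; last by rewrite lk.
  have [t [m [Tt tn]]] := ls n; have [m' m'E] := T_divisible iM m Tt.
  exists m'; apply: (scale_unit_inj (t := t)) => //.
  by rewrite -restrict_scaleE -linearZ /= m'E.
have irN := rel_injective_quotient (@killed0 _ M) (T_torsion_injective iM ij jE) iM ex.
move=> U V i h _ ii.
have [i' i'E] : exists i' : {linear restrict_scalars f U -> restrict_scalars f V},
    forall u, i' u = i u.
  by apply: linear_mk => a u v; rewrite !restrict_scaleE linearP.
have [h' h'E] : exists h' : {linear restrict_scalars f U -> restrict_scalars f N},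
    forall u, h' u = h u.
  by apply: linear_mk => a u v; rewrite !restrict_scaleE linearP.
have ii' : injective i' by move=> u v; rewrite !i'E => /ii.
have [g gE] := irN _ _ i' h' (@killed0 _ _) ii'.
have [k kE] : exists k : {linear V -> N}, forall v, k v = g v.
  apply: linear_mk => s u v; rewrite -[LHS]/(g ((s *: u : V) + v)) linearD; congr (_ + _).
  have [a [t [Tt sa]]] := ffrac s; apply: (scale_unit_inj (t := t)) => //.
  have E : t *: ((s *: u : V) : restrict_scalars f V) = a *: (u : restrict_scalars f V).
    by rewrite !restrict_scaleE scalerA mulrC sa.
  rewrite -[LHS]restrict_scaleE -[LHS](linearZ_LR g) E [LHS]linearZ_LR restrict_scaleE.
  by rewrite -sa scalerA mulrC.
by exists k => u; rewrite kE -h'E -gE i'E.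
Qed.

Lemma locmod_map M N N' (l : {linear M -> restrict_scalars f N})
    (h : {linear M -> restrict_scalars f N'}) :
  is_locmod l -> exists g : {linear N -> N'}, forall m, g (l m) = h m.
Proof.
move=> [lk ls].
pose R (n : N) (n' : N') :=
  exists t m, [/\ T t, f t *: n = l m & f t *: n' = h m].
have Rtot n : exists n', R n n'.
  have [t [m [Tt tn]]] := ls n; have [n' n'E] := scale_unit_surj (h m : N') Tt.
  by exists n', t, m.
have R0 n' : R 0 n' -> n' = 0.
  move=> [t [m [Tt lm hm]]]; move: lm; rewrite scaler0 => /esym/lk[s [Ts sm]].
  apply: (scale_unit_inj (t := s * t)); first exact: TM.
  rewrite scaler0 rmorphM -scalerA hm -[LHS]restrict_scaleE -linearZ /= sm.
  exact: linear0.
have RL s n n' k k' : R n n' -> R k k' -> R (s *: n + k) (s *: n' + k').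
  move=> [t [m [Tt nm nm']]] [u [q [Tu kq kq']]].
  have [a [v [Tv sa]]] := ffrac s.
  exists (v * (t * u)), (a *: (u *: m) + (v * t) *: q).
  split; first by do 2?apply: TM => //.
  - have -> : l (a *: (u *: m) + (v * t) *: q) =
        f a *: (f u *: (l m : N)) + f (v * t) *: (l q : N).
      by rewrite semilinearD !semilinearZ.
    rewrite -nm -kq !rmorphM scalerDr !scalerA; congr (_ *: _ + _ *: _).
    + by rewrite -sa; ring.
    + by ring.
  - have -> : h (a *: (u *: m) + (v * t) *: q) =
        f a *: (f u *: (h m : N')) + f (v * t) *: (h q : N').
      by rewrite semilinearD !semilinearZ.
    rewrite -nm' -kq' !rmorphM scalerDr !scalerA; congr (_ *: _ + _ *: _).
    + by rewrite -sa; ring.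
    + by ring.
have Rfun n n' n'' : R n n' -> R n n'' -> n' = n''.
  move=> Rn Rn'; apply/subr0_eq/R0.
  by have := RL (-1) _ _ _ _ Rn' Rn; rewrite !scaleN1r ![- _ + _]addrC subrr.
have [g gR] := choice Rtot.
have gL : linear g by move=> s n k; apply: (Rfun (s *: n + k)) => //; apply: RL.
have [g' g'E] := linear_mk gL; exists g' => m; rewrite g'E.
by apply: (Rfun (l m)) => //; exists 1, m; rewrite rmorph1 !scale1r.
Qed.

Section BijectiveScaling.
Variable C : lmodType A.
Hypotheses (Tinj : forall t (x : C), T t -> t *: x = 0 -> x = 0)
  (Tdiv : forall t (x : C), T t -> exists y, t *: y = x).

(** When [T] acts bijectively on [C], the fraction a/t acts on [C] itself, sending c to the unique d
    with t d = a c. *)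
Definition localized : Type := C.
HB.instance Definition _ := GRing.Zmodule.on localized.

Let R (s : S) (c d : C) := exists a t, [/\ T t, s * f t = f a & t *: d = a *: c].

Let Rtot s c : exists d, R s c d.
Proof.
have [a [t [Tt sa]]] := ffrac s; have [d dE] := Tdiv (a *: c) Tt.
by exists d, a, t.
Qed.

Let Tinj2 t (x y : C) : T t -> t *: x = t *: y -> x = y.
Proof. by move=> Tt xy; apply/subr0_eq/(Tinj Tt); rewrite scalerBr xy subrr. Qed.

Let Rall s c d a t : R s c d -> T t -> s * f t = f a -> t *: d = a *: c.
Proof.
move=> [b [u [Tu sb dE]]] Tt sa.
have [|v Tv vE] := fker (a := b * t - a * u).
  by rewrite rmorphB !rmorphM -sa -sb; ring.
have E (x : C) : (b * t) *: x = (a * u) *: x.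
  by apply/(Tinj2 Tv)/subr0_eq; rewrite -scalerBr -scalerBl scalerA vE scale0r.
apply: (Tinj2 Tu); rewrite scalerA mulrC -scalerA dE !scalerA.
by rewrite mulrC E mulrC.
Qed.

Let Rfun s c d d' : R s c d -> R s c d' -> d = d'.
Proof.
by move=> [a [t [Tt sa dE]]] /Rall - /(_ a t Tt sa) d'E; apply: (Tinj2 Tt); rewrite d'E.
Qed.

Let lscale (s : S) (c : localized) : localized := projT1 (cid (Rtot s c)).
Let lscaleP s c : R s c (lscale s c).
Proof. exact: (projT2 (cid (Rtot s c))). Qed.

Let lscaleA s s' c : lscale s (lscale s' c) = lscale (s * s') c.
Proof.
apply: (Rfun (s := s * s') (c := c)) => //.
have [a [t [Tt sa dE]]] := lscaleP s (lscale s' c).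
have [a' [t' [Tt' sa' dE']]] := lscaleP s' c.
exists (a * a'), (t * t'); split; first exact: TM.
  by rewrite !rmorphM -sa -sa'; ring.
by rewrite [t * t']mulrC -!scalerA dE scalerA [t' * a]mulrC -scalerA dE'.
Qed.
Let lscale1 : left_id 1 lscale.
Proof.
move=> c; apply: (Rfun (s := 1) (c := c)) => //.
by exists 1, 1; rewrite mul1r scale1r.
Qed.
Let lscaleDr : right_distributive lscale +%R.
Proof.
move=> s c c'; apply: (Rfun (s := s) (c := c + c')) => //.
have [a [t [Tt sa]]] := ffrac s; exists a, t; split=> //.
by rewrite !scalerDr !(Rall (lscaleP _ _) Tt sa).
Qed.
Let lscaleDl c : {morph lscale^~ c : s s' / s + s'}.
Proof.
move=> s s'; apply: (Rfun (s := s + s') (c := c)) => //.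
have [a [t [Tt sa dE]]] := lscaleP s c; have [a' [t' [Tt' sa' dE']]] := lscaleP s' c.
exists (a * t' + a' * t), (t * t'); split; first exact: TM.
  by rewrite rmorphD !rmorphM -sa -sa'; ring.
have E : (t * t') *: lscale s c = (a * t') *: c.
  by rewrite [t * t']mulrC -!scalerA dE !scalerA [t' * a]mulrC.
have E' : (t * t') *: lscale s' c = (a' * t) *: c.
  by rewrite -!scalerA dE' !scalerA [t * a']mulrC.
by rewrite [LHS]scalerDr [RHS]scalerDl -E -E'.
Qed.

HB.instance Definition _ := GRing.Zmodule_isLmodule.Build S localized
  lscaleA lscale1 lscaleDr lscaleDl.

Lemma localized_exists : exists (N : lmodType S)
  (l : {linear C -> restrict_scalars f N}), injective l /\ forall n, exists c, l c = n.
Proof.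
have [l lE] : exists l : {linear C -> restrict_scalars f localized},
    forall c, l c = c.
  apply: linear_mk => a u v; congr (_ + _).
  apply: (Rfun (s := f a) (c := u)); last exact: lscaleP.
  by exists a, 1; rewrite rmorph1 mulr1 scale1r.
by exists localized, l; split=> [u v|n]; [rewrite !lE | exists n; rewrite lE].
Qed.

End BijectiveScaling.

(** [T] acts bijectively on the quotient of the divisible module [I] by its torsion, so this
    quotient already is the localization. *)
Lemma locmod_exists I : rel_injective a0 I ->
  exists N (l : {linear I -> restrict_scalars f N}), is_locmod l.
Proof.
move=> iI; have [G [j [ij jE]]] := T_torsion_exists I.
have [C [p [_ ps pE]]] := short_exact_coker ij.
have [t x Tt|t x Tt|N [l [il ls]]] := @localized_exists C.
- have [y <-] := ps x; rewrite -linearZ => /pE/jE[s [Ts sy]].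
  by apply/pE/jE; exists (s * t); rewrite -scalerA; split=> //; apply: TM.
- have [y <-] := ps x; have [z <-] := T_divisible iI y Tt.
  by exists (p z); rewrite linearZ.
exists N, (l \o p); split=> [m|n].
  rewrite /= jE -pE; split=> [|->]; last by rewrite linear0.
  by rewrite -(linear0 l) => /il.
have [c <-] := ls n; have [y <-] := ps c.
by exists 1, y; rewrite rmorph1 scale1r.
Qed.

(** The embedding of [M] in [I] localizes to an injective map whose cokernel is the localization of
    [C]. *)
Lemma injd_localize e M N (l : {linear M -> restrict_scalars f N}) :
  injd a0 e M -> is_locmod l -> injd b0 e N.
Proof.
elim: e M N l => [|e IH] M N l.
  move=> [_ iM] lM; split; first exact: killed0.
  exact: locmod_injective lM.
move=> [I [C [i [p [_ iI [ii ps pE] dC]]]]] lM; have [lk ls] := lM.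
have [NI [lI lIM]] := locmod_exists iI; have [lIk lIs] := lIM.
have [g gE] := locmod_map (lI \o i) lM.
have ig : injective g.
  move=> x y /eqP; rewrite -subr_eq0 -linearB => /eqP; set n := _ - _ => gn.
  apply/subr0_eq; rewrite -/n; have [t [m [Tt tn]]] := ls n.
  apply: (scale_unit_inj Tt); rewrite scaler0 tn; apply/lk.
  have /lIk[s [Ts sm]] : lI (i m) = 0.
    by rewrite -[LHS](gE m) -tn linearZ /= gn scaler0.
  by exists s; split=> //; apply: ii; rewrite linearZ linear0.
have [NC [q exq]] := short_exact_coker ig; have [_ qs qE] := exq.
have [q' q'E] : exists q' : {linear restrict_scalars f NI -> restrict_scalars f NC},
    forall x, q' x = q x.
  by apply: linear_mk => a u v; rewrite !restrict_scaleE linearP.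
have [x /pE[m <-]|lC lCE] := @factor_surjective _ _ _ _ p (q' \o lI) ps.
  by rewrite /= q'E; apply/qE; exists (l m); rewrite gE.
exists NI, NC, g, q; split=> //; first exact: killed0.
  exact: locmod_injective lIM.
apply: (IH _ _ lC dC); split=> [c|n].
  have [x <-] := ps c; rewrite lCE /= q'E qE; split.
    move=> [n nE]; have [t [m [Tt tn]]] := ls n.
    have /lIk[s [Ts sx]] : lI (i m - t *: x) = 0.
      rewrite linearB linearZ /= restrict_scaleE -nE -linearZ /= tn.
      by rewrite [g _]gE subrr.
    exists (s * t); split; first exact: TM.
    have -> : (s * t) *: p x = - p (s *: (i m - t *: x)).
      have pim : p (i m) = 0 by apply/pE; exists m.
      by rewrite (linearZ_LR p) (linearB p) (linearZ_LR p) pim sub0r scalerN opprK scalerA.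
    by rewrite sx linear0 oppr0.
  move=> [t [Tt]]; rewrite -[X in X = _](linearZ_LR p) => /pE[m mE].
  have [n nE] := scale_unit_surj (l m : N) Tt; exists n.
  apply: (scale_unit_inj Tt); rewrite -linearZ /= nE [LHS]gE /= mE.
  by rewrite linearZ.
have [x <-] := qs n; have [t [y [Tt ty]]] := lIs x.
exists t, (p y); split=> //.
by rewrite lCE /= q'E -ty linearZ.
Qed.

End LocalizeInjdim.

(** * Existence of localizations of a domain *)

(** An alias of [A] that can carry an integral domain structure, so that its fraction field can be
    formed. *)
Definition domain_copy (A : comNzRingType)
  (dom : forall x y : A, x * y = 0 -> x = 0 \/ y = 0) : Type := A.

Section DomainCopy.
Variables (A : comNzRingType) (dom : forall x y : A, x * y = 0 -> x = 0 \/ y = 0).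
Local Notation D := (domain_copy dom).

HB.instance Definition _ := GRing.ComNzRing.on D.

Let dunit : {pred D} := fun x => `[< exists y, y * x = 1 >].
Let dinv (x : D) : D :=
  if pselect (exists y : D, y * x = 1) is left h then projT1 (cid h) else x.

Let dmulVr : {in dunit, left_inverse 1 dinv *%R}.
Proof.
move=> x /asboolP ux; rewrite /dinv; case: pselect => // h.
exact: (projT2 (cid h)).
Qed.
Let dunitP x y : y * x = 1 -> x \in dunit.
Proof. by move=> yx; apply/asboolP; exists y. Qed.
Let dinv_out : {in [predC dunit], dinv =1 id}.
Proof. by move=> x /asboolP ux; rewrite /dinv; case: pselect. Qed.

HB.instance Definition _ :=
  GRing.ComNzRing_hasMulInverse.Build D dmulVr dunitP dinv_out.

Let dmulf_eq0 : GRing.integral_domain_axiom D.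
Proof. by move=> x y /dom[] ->; rewrite eqxx ?orbT. Qed.

HB.instance Definition _ := GRing.ComUnitRing_isIntegral.Build D dmulf_eq0.

End DomainCopy.

Section LocalizationExists.
Variables (A : comNzRingType) (dom : forall x y : A, x * y = 0 -> x = 0 \/ y = 0).
Variable M : {pred A}.
Hypotheses (M0 : 0 \in M) (M1 : 1 \notin M)
  (MM : forall s t, s \notin M -> t \notin M -> s * t \notin M).
Local Notation D := (domain_copy dom).
Local Notation F := {fraction D}.
Let inF (x : A) : F := @FracField.tofrac D x.

Let inF1 : inF 1 = 1. Proof. exact: tofrac1. Qed.
Let inFD x y : inF (x + y) = inF x + inF y. Proof. exact: tofracD. Qed.
Let inFN x : inF (- x) = - inF x. Proof. exact: tofracN. Qed.
Let inFM x y : inF (x * y) = inF x * inF y. Proof. exact: tofracM. Qed.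
Let inF_eq0 x : (inF x == 0) = ((x : A) == 0). Proof. exact: tofrac_eq0. Qed.

Definition local_fraction : {pred F} :=
  fun y => `[< exists a s, s \notin M /\ y * inF s = inF a >].

Fact local_fraction_closed : subring_closed local_fraction.
Proof.
split=> [|x y|x y].
- by apply/asboolP; exists 1, 1; rewrite mul1r.
- move=> /asboolP[a [s [sM xs]]] /asboolP[b [t [tM yt]]]; apply/asboolP.
  exists (a * t - b * s), (s * t); split; first exact: MM.
  by rewrite inFD inFN !inFM -xs -yt; ring.
- move=> /asboolP[a [s [sM xs]]] /asboolP[b [t [tM yt]]]; apply/asboolP.
  exists (a * b), (s * t); split; first exact: MM.
  by rewrite !inFM -xs -yt; ring.
Qed.

Record local_ring := LocalRing { local_val : F; _ : local_val \in local_fraction }.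
HB.instance Definition _ := [isSub for local_val].
HB.instance Definition _ := [Choice of local_ring by <:].
HB.instance Definition _ := GRing.SubChoice_isSubComNzRing.Build F local_fraction
  local_ring local_fraction_closed.

Fact local_in_subproof (a : A) : inF a \in local_fraction.
Proof. by apply/asboolP; exists a, 1; rewrite inF1 mulr1. Qed.
Definition local_in (a : A) : local_ring := LocalRing (local_in_subproof a).

Fact local_in_zmod : zmod_morphism local_in.
Proof. by move=> x y; apply: val_inj; rewrite /= inFD inFN. Qed.
Fact local_in_monoid : monoid_morphism local_in.
Proof. by split=> [|x y]; apply: val_inj; rewrite /= ?inF1 ?inFM. Qed.
HB.instance Definition _ := GRing.isZmodMorphism.Build A local_ring local_in
  local_in_zmod.
HB.instance Definition _ := GRing.isMonoidMorphism.Build A local_ring local_in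
  local_in_monoid.

Lemma localization_exists : exists (S : comNzRingType) (f : {rmorphism A -> S}),
  is_localization_at M f.
Proof.
exists local_ring, (local_in : {rmorphism _ -> _}); split=> [s sM|y|a].
- have s0 : inF s != 0 by rewrite inF_eq0; apply: contraNneq sM => ->.
  have us : (inF s)^-1 \in local_fraction.
    by apply/asboolP; exists 1, s; rewrite inF1 mulVf.
  by exists (LocalRing us); apply: val_inj; rewrite /= divff.
- case: y => y /[dup] /asboolP[a [s [sM ys]]] yl.
  by exists a, s; split=> //; apply: val_inj.
- move=> /(congr1 val) /= /eqP; rewrite inF_eq0 => /eqP->.
  by exists 1; rewrite // mulr0.
Qed.

End LocalizationExists.

(** * Modules of functions on the ring *)

Section PrecompositionModule.
Variables (A : comNzRingType) (P : (A -> A) -> Prop).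
Hypotheses (P0 : P (fun=> 0))
  (Padd : forall f, P f -> forall x y, f (x + y) = f x + f y)
  (Plin : forall a f g, P f -> P g -> P (fun x => f (a * x) + g x)).

(* [A] acts on functions through their argument. *)
Record precomposition := Precomposition { pre_val : A -> A; _ : `[< P pre_val >] }.
HB.instance Definition _ := [isSub for pre_val].
HB.instance Definition _ := [Choice of precomposition by <:].

Let preP (n : precomposition) : P (pre_val n).
Proof. by case: n => f /= /asboolP. Qed.
Let mk f (Pf : P f) : precomposition := Precomposition (introT (asboolP _) Pf).
Let preE (n n' : precomposition) : (forall x, pre_val n x = pre_val n' x) -> n = n'.
Proof. by move=> H; apply: val_inj; apply: funext. Qed.

Let pre0 f : P f -> f 0 = 0.
Proof. by move=> Pf; apply: (addrI (f 0)); rewrite -Padd // !addr0. Qed.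
Let preN f x : P f -> f (- x) = - f x.
Proof.
by move=> Pf; apply: (addrI (f x)); rewrite -Padd // !subrr pre0.
Qed.

Let addP n n' : P (fun x => pre_val n x + pre_val n' x).
Proof.
have := Plin 1 (preP n) (preP n').
by under eq_fun do rewrite mul1r.
Qed.
Let scaleP a n : P (fun x => pre_val n (a * x)).
Proof.
have := Plin a (preP n) P0.
by under eq_fun do rewrite addr0.
Qed.
Let oppP n : P (fun x => - pre_val n x).
Proof.
have := scaleP (-1) n.
by under eq_fun do rewrite mulN1r preN //.
Qed.

Let padd n n' := mk (addP n n').
Let popp n := mk (oppP n).
Let pscale a n := mk (scaleP a n).

Let paddA : associative padd.
Proof. by move=> a b c; apply: preE => x /=; rewrite addrA. Qed.
Let paddC : commutative padd.
Proof. by move=> a b; apply: preE => x /=; rewrite addrC. Qed.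
Let padd0 : left_id (mk P0) padd.
Proof. by move=> a; apply: preE => x /=; rewrite add0r. Qed.
Let paddN : left_inverse (mk P0) popp padd.
Proof. by move=> a; apply: preE => x /=; rewrite addNr. Qed.

HB.instance Definition _ := GRing.isZmodule.Build precomposition
  paddA paddC padd0 paddN.

Let pscaleA a b n : pscale a (pscale b n) = pscale (a * b) n.
Proof. by apply: preE => x /=; rewrite mulrA [b * a]mulrC. Qed.
Let pscale1 : left_id 1 pscale.
Proof. by move=> n; apply: preE => x /=; rewrite mul1r. Qed.
Let pscaleDr : right_distributive pscale +%R.
Proof. by move=> a n n'; apply: preE => x. Qed.
Let pscaleDl n : {morph pscale^~ n : a b / a + b}.
Proof. by move=> a b; apply: preE => x /=; rewrite mulrDl Padd. Qed.

HB.instance Definition _ := GRing.Zmodule_isLmodule.Build A precomposition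
  pscaleA pscale1 pscaleDr pscaleDl.

Lemma precomposition_module : exists (N : lmodType A) (ev : N -> A -> A),
  [/\ forall n n', ev n = ev n' -> n = n', forall f, P f <-> exists n, ev n = f &
      forall a n n' x, ev (a *: n + n') x = ev n (a * x) + ev n' x].
Proof.
exists precomposition, pre_val; split=> // [n n'|f]; first exact: val_inj.
by split=> [Pf|[n <-]]; [exists (mk Pf) | exact: preP].
Qed.

End PrecompositionModule.

(** Maximal ideals are prime: writing 1 = a s + b and 1 = c t + e with b, e in [M] and multiplying
    shows that s t cannot lie in [M]. *)
Lemma maximal_ideal_mul (A : comNzRingType) (M : {pred A}) : maximal_ideal M ->
  forall s t : A, s \notin M -> t \notin M -> s * t \notin M.
Proof.
move=> [[M0 M1 Mlin] Mmax].
have comax s : s \notin M -> exists a b, b \in M /\ 1 = a * s + b.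
  move=> sM; apply: contrapT => no.
  pose J : {pred A} := fun x => `[< exists a b, b \in M /\ x = a * s + b >].
  have JM : {subset M <= J}.
    by move=> x xM; apply/asboolP; exists 0, x; rewrite mul0r add0r.
  suff : s \in M by rewrite (negbTE sM).
  apply: (Mmax J) => //; last first.
    by apply/asboolP; exists 1, 0; rewrite mul1r addr0.
  split; first exact: JM.
    by apply/asboolP => -[a [b [bM H]]]; apply: no; exists a, b.
  move=> r _ _ /asboolP[a [b [bM ->]]] /asboolP[a' [b' [bM' ->]]]; apply/asboolP.
  exists (r * a + a'), (r * b + b'); split; first exact: Mlin.
  by ring.
move=> s t sM tM; apply/negP => st; case/negP: M1.
have [a [b [bM E]]] := comax s sM; have [c [e [eM E']]] := comax t tM.
have -> : 1 = (a * c) * (s * t) + (a * s * e + (b * c * t + b * e)) :> A.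
  have -> : 1 = (a * s + b) * (c * t + e) :> A by rewrite -E -E' mulr1.
  by ring.
apply: (Mlin) => //; apply: (Mlin) => //.
have -> : b * c * t + b * e = (c * t + e) * b + 0 by ring.
exact: Mlin.
Qed.

(** * Normal simplicial semigroup rings *)

Lemma digits_inj (b d : nat) (f g : nat -> nat) :
  (forall i, (i < d)%N -> (f i < b)%N /\ (g i < b)%N) ->
  (\sum_(i < d) f i * b ^ i = \sum_(i < d) g i * b ^ i)%N ->
  forall i, (i < d)%N -> f i = g i.
Proof.
elim: d f g => // d IH f g fgb.
have [f0 g0] := fgb 0%N isT.
rewrite !big_ord_recl /= !expn0 !muln1.
have E (h : nat -> nat) : (\sum_(i < d) h (bump 0 i) * b ^ bump 0 i =
    b * \sum_(i < d) h i.+1 * b ^ i)%N.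
  by rewrite big_distrr /=; apply: eq_bigr => i _; rewrite /bump add1n expnS; lia.
rewrite (E f) (E g) => Sfg; have b0 : (0 < b)%N by apply: leq_trans f0.
have fg0 : f 0%N = g 0%N.
  have := congr1 (modn^~ b) Sfg; rewrite /= ![(b * _)%N]mulnC.
  by rewrite !(addnC (_ 0%N)) !modnMDl !modn_small.
have {}Sfg : (\sum_(i < d) f i.+1 * b ^ i = \sum_(i < d) g i.+1 * b ^ i)%N.
  by move/eqP: Sfg; rewrite fg0 eqn_add2l eqn_pmul2l // => /eqP.
by case=> // i; rewrite ltnS; apply: (IH (f \o S) (g \o S)) => // j; apply: (fgb j.+1).
Qed.

Lemma seq_bounded (T : eqType) (w : T -> nat) (l : seq T) :
  exists B, forall t, t \in l -> (w t <= B)%N.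
Proof.
elim: l => [|x l [B IH]]; first by exists 0%N.
exists (maxn (w x) B) => t; rewrite inE => /orP[/eqP->|/IH tB].
  exact: leq_maxl.
by rewrite (leq_trans tB) ?leq_maxr.
Qed.

Lemma seq_max (T : eqType) (w : T -> nat) (x : T) (l : seq T) : x \in l ->
  exists2 s, s \in l & forall t, t \in l -> (w t <= w s)%N.
Proof.
elim: l x => // y l IH x _.
have [->|[z zl]] : l = [::] \/ exists z, z \in l.
  by case: (l) => [|z l']; [left | right; exists z; apply: mem_head].
  by exists y; rewrite ?mem_head // => t; rewrite inE => /eqP->.
have [s sl smax] := IH z zl; have [ys|sy] := leqP (w y) (w s).
  by exists s; rewrite ?inE ?sl ?orbT // => t /orP[/eqP->|/smax].
exists y; rewrite ?mem_head // => t; rewrite inE => /orP[/eqP->//|/smax ts].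
by rewrite (leq_trans ts) // ltnW.
Qed.

Section SemigroupRing.
Variables (k : fieldType) (K : conomType) (d m : nat).
Variables (ex : K -> 'I_d -> nat) (th : 'I_d -> K).
Hypotheses (m_gt0 : (0 < m)%N) (ex1 : forall i, ex mone i = 0%N)
  (exM : forall x y i, ex (mmul x y) i = (ex x i + ex y i)%N)
  (ex_inj : forall x y, (forall i, ex x i = ex y i) -> x = y)
  (ex_div : forall x y, (forall i, ex y i <= ex x i)%N -> exists z, x = mmul y z)
  (exth : forall i j, ex (th i) j = if i == j then m else 0%N).
Local Notation A := {malg k[K]}.
Implicit Types (s t u : K) (x y : A).

Definition X s : A := << s >>.

Lemma mmulI s t u : mmul s t = mmul s u -> t = u.
Proof. by move=> E; apply: ex_inj => i; apply: (@addnI (ex s i)); rewrite -!exM E. Qed.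

Lemma X1 : X mone = 1. Proof. by []. Qed.

Lemma XM s t : X (mmul s t) = X s * X t.
Proof. by rewrite malgM_def fgmulUU mulr1. Qed.

Lemma mcoeffX s t : (X s)@_t = (s == t)%:R.
Proof. exact: mcoeffU1. Qed.

Lemma malg_sum x : x = \sum_(s <- msupp x) x@_s *: X s.
Proof.
rewrite {1}[x]monalgE; apply: eq_bigr => s _; apply/malgP => t.
by rewrite mcoeffZ mcoeffX mcoeffU mulr_natr.
Qed.

Lemma malg_ind (P : A -> Prop) x : P 0 -> (forall y z, P y -> P z -> P (y + z)) ->
  (forall s, x@_s != 0 -> P (x@_s *: X s)) -> P x.
Proof.
move=> P0 PD PX; rewrite [x]malg_sum big_seq_cond.
by apply: big_ind => // s /andP[sx _]; apply: PX; rewrite mcoeff_neq0.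
Qed.

Lemma mcoeffM_sum x y u : (x * y)@_u =
  \sum_(s <- msupp x) \sum_(t <- msupp y) (x@_s * y@_t) *+ (mmul s t == u).
Proof. exact: mcoeffMl. Qed.

Lemma mcoeffMX x s t : (x * X s)@_(mmul t s) = x@_t.
Proof.
rewrite [x in LHS]malg_sum mulr_suml raddf_sum /= [RHS](congr1 (mcoeff t) (malg_sum x)).
rewrite raddf_sum /=; apply: eq_bigr => u _.
rewrite -scalerAl -XM !mcoeffZ !mcoeffX.
have -> // : (mmul u s == mmul t s) = (u == t).
by apply/eqP/eqP => [|->//]; rewrite ![mmul _ s]mulmC => /mmulI.
Qed.

Lemma mcoeffMX_neq0 x s u : (x * X s)@_u != 0 -> exists t, u = mmul t s.
Proof.
move=> H; apply: contrapT => nt; move/eqP: H; apply.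
rewrite [x]malg_sum mulr_suml raddf_sum /= big1 // => t _.
rewrite -scalerAl -XM mcoeffZ mcoeffX; case: eqP => [E|]; last by rewrite mulr0.
by case: nt; exists t.
Qed.

Lemma mcoeffM1 x y : (x * y)@_mone = x@_mone * y@_mone.
Proof. by rewrite mcoeff1g_is_multiplicative. Qed.

(* Kronecker substitution: reading exponents as digits in a large base makes *)
(* [w] additive and injective on the supports, so top terms do not cancel.   *)
Lemma malg_domain x y : x * y = 0 -> x = 0 \/ y = 0.
Proof.
move=> xy0; apply: contrapT => /not_orP[/eqP x0 /eqP y0].
have [B BP] : exists B, forall s, s \in msupp x ++ msupp y -> forall i, (ex s i < B)%N.
  have [B BP] := seq_bounded (fun s => \max_(i < d) ex s i) (msupp x ++ msupp y).
  by exists B.+1 => s /BP sB i; rewrite ltnS (leq_trans _ sB) // leq_bigmax.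
pose w s := (\sum_(i < d) ex s i * B ^ i)%N.
have wM s t : w (mmul s t) = (w s + w t)%N.
  by rewrite /w -big_split /=; apply: eq_bigr => i _; rewrite exM mulnDl.
have w_inj s t : s \in msupp x ++ msupp y -> t \in msupp x ++ msupp y ->
    w s = w t -> s = t.
  move=> /BP sB /BP tB; rewrite /w => wst; apply: ex_inj => i.
  pose g u j := if insub j is Some j' then ex u (j' : 'I_d) else 0%N.
  have gE u (j : 'I_d) : g u j = ex u j by rewrite /g valK.
  rewrite -!gE; apply: (@digits_inj B d (g s) (g t)) => // [j jd|].
    by rewrite (gE s (Ordinal jd)) (gE t (Ordinal jd)).
  transitivity (w s); first by apply: eq_bigr => j _; rewrite gE.
  by rewrite /w wst; apply: eq_bigr => j _; rewrite gE.
have nz (z : A) : z != 0 -> exists s, s \in msupp z.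
  move=> z0; apply: contrapT => nz; move/eqP: z0; apply; apply/malgP => s.
  rewrite mcoeff0; apply/eqP; rewrite mcoeff_eq0; apply/negP => sz; apply: nz.
  by exists s.
have [s1 /(seq_max w)[s sx smax]] := nz _ x0.
have [t1 /(seq_max w)[t ty tmax]] := nz _ y0.
have : (x * y)@_(mmul s t) = 0 by rewrite xy0 mcoeff0.
have key s' t' : s' \in msupp x -> t' \in msupp y -> mmul s' t' = mmul s t ->
    s' = s /\ t' = t.
  move=> s'x t'y E.
  have := congr1 w E; rewrite !wM => wE.
  have ws := smax _ s'x; have wt := tmax _ t'y.
  by split; apply: w_inj; rewrite ?mem_cat ?s'x ?sx ?t'y ?ty ?orbT //; lia.
have inner : \sum_(t' <- msupp y) (x@_s * y@_t') *+ (mmul s t' == mmul s t) =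
    x@_s * y@_t.
  rewrite (bigD1_seq t) ?fset_uniq //= eqxx mulr1n big1_seq ?addr0 // => t'.
  case/andP=> t't t'y; case: eqP => // E.
  by have [_ t'E] := key s t' sx t'y E; rewrite t'E eqxx in t't.
rewrite mcoeffM_sum (bigD1_seq s) ?fset_uniq //= inner big1_seq ?addr0; last first.
  move=> s' /andP[s's s'x]; rewrite big1_seq // => t' /andP[_ t'y].
  case: eqP => // E; have [s'E _] := key s' t' s'x t'y E.
  by rewrite s'E eqxx in s's.
by move/eqP; rewrite mulf_eq0 !mcoeff_eq0 sx ty.
Qed.

(** * The box and the Noetherian property *)

Lemma th_divides s i : (m <= ex s i)%N -> exists t, s = mmul (th i) t.
Proof.
move=> ms; apply: ex_div => j; rewrite exth; case: eqP => [<-|] //.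
Qed.

Definition deg s := (\sum_(i < d) ex s i)%N.

Lemma degM s t : deg (mmul s t) = (deg s + deg t)%N.
Proof. by rewrite /deg -big_split /=; apply: eq_bigr => i _; rewrite exM. Qed.

Lemma deg_th i : deg (th i) = m.
Proof.
rewrite /deg (bigD1 i) //= exth eqxx big1 ?addn0 // => j ji.
by rewrite exth eq_sym (negbTE ji).
Qed.

Lemma deg_eq0 s : deg s = 0%N -> s = mone.
Proof.
move=> /eqP; rewrite sum_nat_eq0 => /forallP s0; apply: ex_inj => i.
by rewrite ex1; apply/eqP; apply: s0.
Qed.

Definition box s := forall i, (ex s i < m)%N.

Lemma box_ind (P : K -> Prop) : (forall s, box s -> P s) ->
  (forall i s, P s -> P (mmul (th i) s)) -> forall s, P s.
Proof.
move=> Pb Pth s; have [n] := ubnP (deg s); elim: n s => // n IH s sn.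
have [/Pb //|/existsNP[i /negP]] := pselect (box s).
rewrite -leqNgt => /th_divides[t E]; rewrite E; apply/Pth/IH.
by move: sn; rewrite E degM deg_th; lia.
Qed.

Lemma box_seq : exists l : seq K, forall s, box s -> s \in l.
Proof.
pose o (g : {ffun 'I_d -> 'I_m}) :=
  if pselect (exists s, forall i, ex s i = g i) is left h
  then Some (projT1 (cid h)) else None.
exists (pmap o (enum {: {ffun 'I_d -> 'I_m}})) => s sb.
rewrite mem_pmap; apply/mapP; exists [ffun i => Ordinal (sb i)].
  by rewrite mem_enum.
rewrite /o; case: pselect => [h|[]]; last by exists s => i; rewrite ffunE.
congr Some; apply: ex_inj => i; rewrite (projT2 (cid h)) ffunE //.
Qed.

(** The finitely many box monomials and the [th i] generate [A] as an algebra. *)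
Lemma malg_noeth : noeth (A : comNzRingType).
Proof.
have [l lP] := box_seq.
pose gs := [seq X s | s <- l] ++ [seq X (th i) | i : 'I_d].
have [Q [phi [nQ phik phig]]] := @noeth_cover k A (@malgC K k : {rmorphism _ -> _}) gs.
apply: (noeth_surjective _ nQ (phi := phi)) => x.
have phiX s : exists q, phi q = X s.
  elim/box_ind: s => [s /lP sl|i s [q qE]].
    by apply: phig; rewrite mem_cat map_f.
  have [r rE] : exists r, phi r = X (th i).
    by apply: phig; rewrite mem_cat; apply/orP; right; apply/mapP; exists i; rewrite // mem_enum.
  by exists (r * q); rewrite rmorphM rE qE XM.
apply: (@malg_ind (fun x => exists q, phi q = x)) => [|_ _ [q <-] [r <-]|s _].
- by exists 0; rewrite rmorph0.
- by exists (q + r); rewrite rmorphD.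
have [q qE] := phiX s; have [c cE] := phik x@_s.
by exists (c * q); rewrite rmorphM qE cE mul_malgC.
Qed.

(** * From Hom_k(A, P) to Hom_P(A, P) *)

Local Notation a0 := (fun r : A => r = 0).

Definition klinear (f : A -> A) := forall c x y, f (c *: x + y) = c *: f x + f y.

Lemma klinearD f : klinear f -> forall x y, f (x + y) = f x + f y.
Proof. by move=> fL x y; rewrite -[x]scale1r fL !scale1r. Qed.

Lemma klinear0 f : klinear f -> f 0 = 0.
Proof. by move=> fL; apply: (addrI (f 0)); rewrite -(klinearD fL) !addr0. Qed.

Lemma klinearZ f : klinear f -> forall c x, f (c *: x) = c *: f x.
Proof. by move=> fL c x; rewrite -[c *: x]addr0 fL klinear0 ?addr0. Qed.

Lemma klinear_eq f g : klinear f -> klinear g -> (forall s, f (X s) = g (X s)) ->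
  f = g.
Proof.
move=> fL gL fg; apply: funext => x.
apply: (@malg_ind (fun x => f x = g x)) => [|y z yE zE|s _].
- by rewrite !klinear0.
- by rewrite !klinearD // yE zE.
- by rewrite !klinearZ // fg.
Qed.

Definition extend (F : K -> A) (x : A) : A := \sum_(s <- msupp x) x@_s *: F s.

Lemma extend_klinear F : klinear (extend F).
Proof.
have E x : extend F x = mmap (@malgC K k) F x.
  by apply: eq_bigr => s _; rewrite -mul_malgC.
move=> c x y; rewrite !E mmapD; congr (_ + _).
rewrite (mmapEw (msuppZ_le _ _)) mmapE scaler_sumr; apply: eq_bigr => s _.
by rewrite mcoeffZ /= mpolyCM -mulrA mul_malgC.
Qed.

Lemma extendX F s : extend F (X s) = F s.
Proof.
by rewrite /extend msuppU1 big_seq_fset1 mcoeffX eqxx scale1r.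
Qed.

(* The span of the monomials in the [th i]; [A] is free over it, with basis *)
(* the monomials in the box.                                                *)
Definition theta_supported (x : A) :=
  forall s, x@_s != 0 -> forall i, (m %| ex s i)%N.

Lemma theta_supported0 : theta_supported 0.
Proof. by move=> s; rewrite mcoeff0 eqxx. Qed.

Lemma theta_supportedL c x y : theta_supported x -> theta_supported y ->
  theta_supported (c *: x + y).
Proof.
move=> Yx Yy s; rewrite mcoeffD mcoeffZ.
have [xs|/Yx//] := eqVneq (x@_s) 0.
by rewrite xs mulr0 add0r => /Yy.
Qed.

Lemma theta_supported_th i x : theta_supported x -> theta_supported (X (th i) * x).
Proof.
move=> Yx s; rewrite mulrC => /[dup] /mcoeffMX_neq0[t ->]; rewrite mcoeffMX => /Yx tY j.
by rewrite exM dvdn_addr // exth; case: eqP.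
Qed.

(** With P the span of the monomials in the [th i], this interpolates between Hom_k(A, P) at j = 0
    and Hom_P(A, P) at j = d. *)
Definition theta_maps j (f : A -> A) := [/\ klinear f,
  forall x, theta_supported (f x) &
  forall i : 'I_d, (i < j)%N -> forall x, f (X (th i) * x) = X (th i) * f x].

Lemma theta_maps_module j : exists (N : lmodType A) (ev : N -> A -> A),
  [/\ forall n n', ev n = ev n' -> n = n',
      forall f, theta_maps j f <-> exists n, ev n = f &
      forall a n n' x, ev (a *: n + n') x = ev n (a * x) + ev n' x].
Proof.
apply: precomposition_module => [|f [fL _ _]|a f g [fL fY fth] [gL gY gth]].
- split=> [c x y|x|i _ x]; rewrite ?scaler0 ?addr0 ?mulr0 //.
  exact: theta_supported0.
- exact: klinearD.
- split=> [c x y|x|i ij x].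
  + by rewrite mulrDr -scalerAr fL gL scalerDr addrACA.
  + by rewrite -[f _]scale1r; apply: theta_supportedL.
  + by rewrite mulrCA fth // gth // mulrDr.
Qed.

Lemma field_retraction (U V : lmodType k) (i : {linear U -> V}) : injective i ->
  exists r : {linear V -> U}, forall w : U, r (i w) = w.
Proof.
move=> ii; have [D g Di Dlin [v nDv]|r rE] := @linear_extension k U V U i idfun ii.
  exists v, 0; split=> // a Dav; rewrite scaler0.
  have [->|a0] := eqVneq a 0.
    by rewrite scale0r -(linear0 i); have [_] := Di 0.
  case: nDv; rewrite -[v]scale1r -(mulVf a0) -scalerA -[_ *: _]addr0.
  by have [+ _] := Di 0; rewrite linear0 => D0; have [] := Dlin a^-1 _ _ Dav D0.
by exists r.
Qed.

(** By adjunction, [A]-linear maps into Hom_k(A, P) are [k]-linear maps into P, and these extend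
    because injections split over a field. *)
Lemma theta_maps0_injective (N : lmodType A) (ev : N -> A -> A) :
  (forall n n', ev n = ev n' -> n = n') ->
  (forall f, theta_maps 0 f <-> exists n, ev n = f) ->
  (forall a n n' x, ev (a *: n + n') x = ev n (a * x) + ev n' x) ->
  rel_injective a0 N.
Proof.
move=> ev_inj evE evL U V i h _ ii.
pose io : {rmorphism k -> A} := @malgC K k.
have [i' i'E] : exists i' : {linear restrict_scalars io U -> restrict_scalars io V},
    forall w : U, i' w = i w.
  by apply: linear_mk => c u v; rewrite !restrict_scaleE linearP.
have ii' : injective i' by move=> u v; rewrite !i'E => /ii.
have [r rE] := field_retraction ii'.
have rD (v w : V) : r (v + w) = (r v : U) + r w := linearD r v w.
have rZ c (v : V) : r (c%:MP *: v) = c%:MP *: (r v : U) := linearZ_LR r c v.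
have evN n : theta_maps 0 (ev n) by apply/evE; exists n.
have ev0 x : ev 0 x = 0.
  apply: (addrI (ev 0 x)); rewrite addr0.
  by have := evL 1 0 0 x; rewrite scale1r addr0 mul1r.
have evD n n' x : ev (n + n') x = ev n x + ev n' x.
  by rewrite -[n]scale1r evL mul1r scale1r.
have evZ a n x : ev (a *: n) x = ev n (a * x).
  by rewrite -[_ *: _]addr0 evL ev0 addr0.
have /choice[g gE] : forall v : V, exists n, ev n = fun a => ev (h (r (a *: v))) 1.
  move=> v; apply/evE; split=> // [c x y|x]; last by case: (evN (h (r (x *: v)))).
  have -> : r ((c *: x + y) *: v) = c%:MP *: (r (x *: v) : U) + r (y *: v).
    by rewrite scalerDl -mul_malgC -scalerA rD rZ.
  rewrite linearP evD evZ mulr1; congr (_ + _).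
  have [L _ _] := evN (h (r (x *: v))).
  by rewrite -[c%:MP]mulr1 mul_malgC (klinearZ L).
have gL : linear g.
  move=> a v w; apply: ev_inj; apply: funext => x; rewrite evL !gE -evD -linearD -rD.
  by rewrite scalerDr !scalerA [x * a]mulrC.
have [g' g'E] := linear_mk gL; exists g' => u; rewrite g'E.
apply: ev_inj; rewrite gE; apply: funext => x.
have -> : r (x *: i u) = x *: u by rewrite -linearZ_LR -i'E rE.
by rewrite linearZ_LR evZ mulr1.
Qed.

Lemma klinear_pre a f : klinear f -> klinear (fun x => f (a * x)).
Proof. by move=> fL c x y; rewrite mulrDr -scalerAr fL. Qed.

Lemma klinear_post a f : klinear f -> klinear (fun x => a * f x).
Proof. by move=> fL c x y; rewrite fL mulrDr -scalerAr. Qed.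

Lemma klinear_sub f g : klinear f -> klinear g -> klinear (fun x => f x - g x).
Proof. by move=> fL gL c x y; rewrite fL gL opprD scalerBr addrACA. Qed.

(** The equation fixes the value of [f] at [th j] times [s] from its value at [s]. So it is solved
    by recursion on the power of [th j], starting from 0, and commutation with the earlier [th i]
    propagates. *)
Lemma theta_koszul_surjective (j : 'I_d) g : theta_maps j g ->
  exists f, theta_maps j f /\ forall x, X (th j) * f x - f (X (th j) * x) = g x.
Proof.
move=> [gL gY gth].
have [dv dvE] : exists dv : K -> K, forall s, dv (mmul (th j) s) = s.
  suff /choice[dv dvE] : forall s, exists t, forall u, s = mmul (th j) u -> t = u.
    by exists dv => s; apply: dvE.
  move=> s; have [[t ->]|nt] := pselect (exists t, s = mmul (th j) t).
    by exists t => u; apply: mmulI.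
  by exists mone => u sE; case: nt; exists u.
(* The fuel [n] will be the number of times that [th j] divides [s]. *)
pose F := fix F n s := if n is n'.+1 then X (th j) * F n' (dv s) - g (X (dv s)) else 0.
have ex_th i s : ex (mmul (th i) s) j = ((if i == j then m else 0) + ex s j)%N.
  by rewrite exM exth.
pose q s := (ex s j %/ m)%N; pose G s := F (q s) s.
have GS s : G (mmul (th j) s) = X (th j) * G s - g (X s).
  by rewrite /G /q ex_th eqxx -{1}[m]mul1n divnMDl //= dvE.
have GY s : theta_supported (G s).
  rewrite /G; move: (q s) => n; elim: n s => [|n IH] s /=; first exact: theta_supported0.
  rewrite addrC -scaleN1r; apply: theta_supportedL; first exact: gY.
  exact: theta_supported_th.
have Gth (i : 'I_d) s : (i < j)%N -> G (mmul (th i) s) = X (th i) * G s.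
  move=> ij; have nij : (i == j) = false by apply/eqP => E; rewrite E ltnn in ij.
  have [n] := ubnP (q s); elim: n s => // n IH s sn.
  have [sm|/th_divides[t sE]] := ltnP (ex s j) m.
    by rewrite /G /q ex_th nij divn_small //= mulr0.
  have tn : (q t < n)%N.
    move: sn; rewrite sE /q ex_th eqxx -{1}[m]mul1n divnMDl //; lia.
  have -> : mmul (th i) s = mmul (th j) (mmul (th i) t).
    by rewrite sE mulmA [mmul (th i) (th j)]mulmC -mulmA.
  by rewrite GS sE GS IH // XM gth // mulrBr mulrCA.
exists (extend G); split.
  split; first exact: extend_klinear.
    move=> x; apply: (@malg_ind (fun x => theta_supported (extend G x))) => [|y z Yy Yz|s _].
    - by rewrite (klinear0 (extend_klinear G)); apply: theta_supported0.
    - rewrite (klinearD (extend_klinear G)) -[extend G y]scale1r.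
      exact: theta_supportedL.
    - rewrite (klinearZ (extend_klinear G)) -[_ *: _]addr0 extendX.
      exact: theta_supportedL (@theta_supported0).
  move=> i ij x; have L := extend_klinear G.
  have E := klinear_eq (klinear_pre (X (th i)) L) (klinear_post (X (th i)) L).
  apply: (congr1 (fun h => h x) (E _)) => s.
  by rewrite -XM !extendX Gth.
move=> x; have L := extend_klinear G.
have E := klinear_eq (klinear_sub (klinear_post (X (th j)) L) (klinear_pre (X (th j)) L)) gL.
apply: (congr1 (fun h => h x) (E _)) => s.
by rewrite -XM !extendX GS opprB addrC subrK.
Qed.

(** Commuting with one more [th] means lying in the kernel of a surjective operator on the previous
    module. *)
Lemma theta_maps_injd j (N : lmodType A) (ev : N -> A -> A) : (j <= d)%N ->
  (forall n n', ev n = ev n' -> n = n') ->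
  (forall f, theta_maps j f <-> exists n, ev n = f) ->
  (forall a n n' x, ev (a *: n + n') x = ev n (a * x) + ev n' x) ->
  injd a0 j N.
Proof.
elim: j N ev => [|j IH] N ev jd ev_inj evE evL.
  by split; [exact: killed0 | exact: theta_maps0_injective evL].
have [N' [ev' [ev_inj' evE' evL']]] := theta_maps_module j.
have dN' := IH _ _ (ltnW jd) ev_inj' evE' evL'.
pose jj := Ordinal jd.
have /choice[i iE] : forall n, exists n', ev' n' = ev n.
  move=> n; apply/evE'; have [|L Y T] := (evE (ev n)).2; first by exists n.
  by split=> // i ij; apply: T; rewrite ltnS ltnW.
have iL : linear i.
  by move=> a u v; apply: ev_inj'; apply: funext => x; rewrite iE evL evL' !iE.
have [i' i'E] := linear_mk iL.
have /choice[p pE] : forall n, exists n',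
    ev' n' = fun x => X (th jj) * ev' n x - ev' n (X (th jj) * x).
  move=> n; apply/evE'; have [|L Y T] := (evE' (ev' n)).2; first by exists n.
  split; first exact: klinear_sub (klinear_post _ L) (klinear_pre _ L).
    move=> x; rewrite addrC -scaleN1r; apply: theta_supportedL => //.
    exact: theta_supported_th.
  move=> l lj x; rewrite [X (th jj) * (X (th l) * x)]mulrCA !(T l lj) mulrBr.
  by rewrite (mulrCA (X (th jj)) (X (th l)) (ev' n x)).
have pL : linear p.
  move=> a u v; apply: ev_inj'; apply: funext => x; rewrite pE !evL' !pE.
  by rewrite mulrDr opprD addrACA mulrCA.
have [p' p'E] := linear_mk pL.
apply: (@injd_kernel _ j N N' N' i' p') => //; split.
- by move=> u v; rewrite !i'E => uv; apply: ev_inj; rewrite -!iE uv.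
- move=> c; have [|f [fT fE]] := @theta_koszul_surjective jj (ev' c).
    by apply/evE'; exists c.
  have /evE'[n nE] := fT; exists n; rewrite p'E; apply: ev_inj'.
  by apply: funext => x; rewrite pE nE fE.
- move=> x; rewrite p'E.
  have ev0 y : ev' 0 y = 0.
    have [|L _ _] := (evE' (ev' 0)).2; first by exists 0.
    apply: (addrI (ev' 0 y)); rewrite addr0.
    by have := evL' 1 0 0 y; rewrite scale1r addr0 mul1r.
  split=> [px0|[n <-]].
    have [|L Y T] := (evE' (ev' x)).2; first by exists x.
    have /evE[n nE] : theta_maps j.+1 (ev' x).
      split=> // l; rewrite ltnS leq_eqVlt => /orP[/eqP lj|/T//] y.
      have -> : l = jj by apply: val_inj.
      apply/esym/subr0_eq; have := congr1 (ev'^~ y) px0.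
      by rewrite /= pE ev0.
    by exists n; apply: ev_inj'; rewrite i'E iE.
  apply: ev_inj'; apply: funext => y; rewrite pE ev0 i'E iE.
  have [|_ _ T] := (evE (ev n)).2; first by exists n.
  by rewrite (T jj) ?subrr.
Qed.

(** * Duality between A and Hom_P(A, P) *)

Section Duality.
Variables (s0 : K).
Hypothesis s0E : forall i, ex s0 i = m.-1.

Definition dual_cond s := forall i, (m %| (ex s i).+1)%N.

Lemma dual_condP s : dual_cond s <->
  exists t, (forall i, (m %| ex t i)%N) /\ s = mmul s0 t.
Proof.
split=> [H|[t [tm ->]] i]; last first.
  by rewrite exM s0E -addSn prednK // dvdn_addr.
have [|t sE] := ex_div (x := s) (y := s0).
  by move=> i; rewrite s0E -ltnS prednK //; apply: dvdn_leq.
exists t; split=> // i; have := H i.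
by rewrite sE exM s0E -addSn prednK // dvdn_addr.
Qed.

(** [h] strips [s0] from the monomials in s0 + m N^d and kills the others; its linear extension is
    the P-coordinate along [s0] in the basis of box monomials. *)
Lemma dual_quotient_exists : exists h : K -> A,
  (forall t, (forall i, m %| ex t i)%N -> h (mmul s0 t) = X t) /\
  (forall s, ~ dual_cond s -> h s = 0).
Proof.
suff /choice[h hE] : forall s, exists y : A,
    (forall t, (forall i, m %| ex t i)%N -> s = mmul s0 t -> y = X t) /\
    (~ dual_cond s -> y = 0).
  exists h; split=> [t tm|s ns]; first by have [+ _] := hE (mmul s0 t); apply.
  by have [_ ->] := hE s.
move=> s; have [/dual_condP[t [tm ->]]|ns] := pselect (dual_cond s).
  exists (X t); split=> [u _ /mmulI-> //|[]].
  by apply/dual_condP; exists t.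
exists 0; split=> // t tm sE; case: ns.
by apply/dual_condP; exists t.
Qed.

Variables (h : K -> A).
Hypotheses (hE : forall t, (forall i, m %| ex t i)%N -> h (mmul s0 t) = X t)
  (h0 : forall s, ~ dual_cond s -> h s = 0).

Lemma h_theta t s : (forall i, m %| ex t i)%N -> h (mmul t s) = X t * h s.
Proof.
move=> tm; have [/dual_condP[u [um ->]]|ns] := pselect (dual_cond s).
  have -> : mmul t (mmul s0 u) = mmul s0 (mmul t u).
    by rewrite mulmA [mmul t s0]mulmC -mulmA.
  by rewrite !hE ?XM // => i; rewrite exM dvdn_add.
rewrite !h0 ?mulr0 //; apply: contra_not ns => H i.
by have := H i; rewrite exM -addnS dvdn_addr.
Qed.

Lemma th_theta i j : (m %| ex (th i) j)%N.
Proof. by rewrite exth; case: ifP. Qed.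

Lemma extend_h_theta x y : theta_supported x -> extend h (x * y) = x * extend h y.
Proof.
move=> Yx; have L := extend_klinear h.
apply: (@malg_ind (fun z => extend h (z * y) = z * extend h y)) => [|u v uE vE|t xt].
- by rewrite !mul0r (klinear0 L).
- by rewrite !mulrDl (klinearD L) uE vE.
rewrite -!scalerAl (klinearZ L); congr (_ *: _).
have E := klinear_eq (klinear_pre (X t) L) (klinear_post (X t) L).
apply: (congr1 (fun g => g y) (E _)) => s.
by rewrite -XM !extendX h_theta //; apply: Yx.
Qed.

Lemma mcoeff_extend_h x t : (forall i, m %| ex t i)%N ->
  (extend h x)@_t = x@_(mmul s0 t).
Proof.
move=> tm; have L := extend_klinear h.
apply: (@malg_ind (fun z => (extend h z)@_t = z@_(mmul s0 t))) => [|u v uE vE|s _].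
- by rewrite (klinear0 L) !mcoeff0.
- by rewrite (klinearD L) !mcoeffD uE vE.
rewrite (klinearZ L) !mcoeffZ; congr (_ * _); rewrite extendX mcoeffX.
have [/dual_condP[u [um ->]]|ns] := pselect (dual_cond s).
  rewrite hE // mcoeffX; congr (_%:R); congr nat_of_bool.
  by apply/eqP/eqP => [->//|/mmulI].
rewrite h0 // mcoeff0; case: eqP => // E; case: ns; rewrite E.
by apply/dual_condP; exists t.
Qed.

Lemma extend_h_supported x : theta_supported (extend h x).
Proof.
move=> t; have L := extend_klinear h.
apply: (@malg_ind (fun z => (extend h z)@_t != 0 -> forall i, (m %| ex t i)%N)) => [|u v uE vE|s _].
- by rewrite (klinear0 L) mcoeff0 eqxx.
- rewrite (klinearD L) mcoeffD; have [u0|/uE //] := eqVneq ((extend h u)@_t) 0.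
  by rewrite u0 add0r => /vE.
rewrite (klinearZ L) mcoeffZ extendX.
have [/dual_condP[u [um ->]]|ns] := pselect (dual_cond s).
  rewrite hE // mcoeffX; case: (u =P t) => [<- //|_].
  by rewrite mulr0 eqxx.
by rewrite h0 // mcoeff0 mulr0 eqxx.
Qed.

Lemma th_monomial (q : 'I_d -> nat) : exists t, forall i, ex t i = (q i * m)%N.
Proof.
suff [t tE] : exists t, forall i, ex t i = (\sum_(j < d) q j * ex (th j) i)%N.
  exists t => i; rewrite tE (bigD1 i) //= exth eqxx big1 ?addn0 // => j ji.
  by rewrite exth (negbTE ji) muln0.
elim: (index_enum _) => [|j r [t tE]].
  by exists mone => i; rewrite ex1 big_nil.
exists (mmul (iter (q j) (mmul (th j)) mone) t) => i.
rewrite exM tE big_cons; congr (_ + _)%N.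
by elim: (q j) => [|n IH]; rewrite ?ex1 // iterS exM IH mulSn.
Qed.

(* [extend h] reads off the part of an element supported on [s0 + m N^d]; the *)
(* next two lemmas make [x, y |-> extend h (x * y)] a perfect pairing.        *)
Lemma extend_h_nondegenerate a : (forall x, extend h (a * x) = 0) -> a = 0.
Proof.
move=> H; apply/malgP => t; rewrite mcoeff0.
(* [s0] plus [z] dominates [t], so multiplying by the quotient [r] moves the coefficient of [t] to a
   place that [extend h] reads. *)
have [z zE] := th_monomial (ex t).
have [|r rE] := ex_div (x := mmul s0 z) (y := t).
  by move=> i; rewrite exM s0E zE; nia.
rewrite -(mcoeffMX a r t) -rE -mcoeff_extend_h ?H ?mcoeff0 //.
by move=> i; rewrite zE dvdn_mull.
Qed.

Lemma extend_h_surjective f : theta_maps d f ->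
  exists a, forall x, extend h (a * x) = f x.
Proof.
move=> [fL fY fth]; have L := extend_klinear h.
have [l lbox] := box_seq.
(* The complements [c r] of the box monomials in [s0] form the basis dual to the box. *)
have [c cE] : exists c : K -> K, forall r, box r -> s0 = mmul r (c r).
  suff /choice[c cE] : forall r, exists u, box r -> s0 = mmul r u by exists c.
  move=> r; have [rb|nb] := pselect (box r); last by exists mone.
  have [|u uE] := ex_div (x := s0) (y := r); last by exists u.
  by move=> i; rewrite s0E -ltnS prednK //; apply: rb.
pose b : seq K := [seq r <- undup l | `[< box r >]].
have bE r : (r \in b) = `[< box r >].
  rewrite mem_filter mem_undup; case: asboolP => //= /lbox -> //.
exists (\sum_(r <- b) X (c r) * f (X r)) => x; pose a := \sum_(r <- b) X (c r) * f (X r).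
rewrite -/a.
have E := klinear_eq (klinear_pre a L) fL.
apply: (congr1 (fun g => g x) (E _)) => {x}.
elim/box_ind => [r' rb'|i s IH]; last first.
  rewrite XM mulrCA extend_h_theta ?IH ?fth //.
  by move=> t; rewrite mcoeffX; case: (_ =P t) => [<- _ j|]; [apply: th_theta | rewrite eqxx].
rewrite /a mulr_suml.
have -> : extend h (\sum_(r <- b) X (c r) * f (X r) * X r') =
    \sum_(r <- b) f (X r) * h (mmul (c r) r').
  elim: (b) => [|r b' IH]; first by rewrite !big_nil (klinear0 L).
  rewrite !big_cons (klinearD L) IH; congr (_ + _).
  by rewrite [X (c r) * _]mulrC -mulrA -XM extend_h_theta ?extendX.
rewrite (bigD1_seq r') ?filter_uniq ?undup_uniq ?bE //=; last exact/asboolP.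
rewrite [mmul (c r') r']mulmC -cE // -[s0]mulm1 hE; last by move=> i; rewrite ex1.
rewrite X1 mulr1 big1_seq ?addr0 // => r /andP[rr']; rewrite bE => /asboolP rb.
(* Each coordinate of [mmul (c r) r'] is at most 2m-2, so if it is congruent to -1 modulo [m] it
   equals m-1, which forces r = r'. *)
rewrite h0 ?mulr0 // => dc; case/eqP: rr'; apply: ex_inj => i.
have := dc i; have := congr1 (ex^~ i) (cE r rb); rewrite /= s0E !exM.
have := rb i; have := rb' i => r'm rm E1 /dvdnP[n E2].
have n1 : n = 1%N by case: n E2 => [|[|n]]; rewrite ?mulSn; lia.
by move: E2; rewrite n1; lia.
Qed.

Lemma injd_dual : injd a0 d (A^o : lmodType A).
Proof.
have [N [ev [ev_inj evE evL]]] := theta_maps_module d.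
have dN := theta_maps_injd (leqnn d) ev_inj evE evL.
have L := extend_klinear h.
have /choice[g gE] : forall a : A^o, exists n, ev n = fun x => extend h (a * x).
  move=> a; apply/evE; split; first exact: klinear_pre.
    by move=> x; apply: extend_h_supported.
  move=> i _ x; rewrite mulrCA extend_h_theta // => t; rewrite mcoeffX.
  by case: (_ =P t) => [<- _ j|]; [apply: th_theta | rewrite eqxx].
have gL : linear g.
  move=> a u v; apply: ev_inj; apply: funext => x; rewrite evL !gE mulrDl (klinearD L).
  by rewrite [a *: u]mulrC -mulrA.
have [g' g'E] := linear_mk gL.
have ig : injective g'.
  move=> a b; rewrite !g'E => /(congr1 ev); rewrite !gE => ab.
  apply/subr0_eq/extend_h_nondegenerate => x.
  rewrite mulrBl -scaleN1r addrC L scaleN1r (congr1 (fun f => f x) ab).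
  exact: addNr.
have gs n : exists a, g' a = n.
  have [|a aE] := @extend_h_surjective (ev n); first by apply/evE; exists n.
  by exists a; rewrite g'E; apply: ev_inj; rewrite gE; apply: funext.
have [n|r rE] := lift_injective (g := idfun) ig; first exact: gs.
apply: (injd_iso (h := r)) dN => [u v uv|a].
  by rewrite -[u]rE -[v]rE uv.
by exists (g' a); apply: ig; rewrite rE.
Qed.

End Duality.

Lemma injd_self_of_dual s0 : (forall i, ex s0 i = m.-1) -> injd a0 d (A^o : lmodType A).
Proof. by move=> s0E; have [h [hE h0]] := dual_quotient_exists s0E; apply: injd_dual hE h0. Qed.

(** [A] is a domain, so the complement of a maximal ideal consists of regular elements and the
    resolution of [A] localizes. *)
Lemma gorenstein_of_dual s0 : (forall i, ex s0 i = m.-1) -> gorenstein_ring A.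
Proof.
move=> s0E; split; first exact/noeth_noetherian/malg_noeth.
move=> M Mmax; have [[M0 M1 _] _] := Mmax.
have MM := maximal_ideal_mul Mmax.
have [S [f [fu ff fk]]] := localization_exists malg_domain M0 M1 MM.
exists S, f; split=> //; exists d; apply: injd_injdim_le.
have [l lE] : exists l : {linear A^o -> restrict_scalars f S^o}, forall a, l a = f a.
  by apply: linear_mk => a u v; rewrite rmorphD rmorphM.
apply: (@injd_localize A S f (fun x : A => x \notin M) malg_noeth M1 MM _ fu ff fk d _ _ l).
- by move=> t r tM /malg_domain[t0|//]; rewrite t0 M0 in tM.
- exact: injd_self_of_dual s0E.
- split=> [a|y].
    rewrite lE; split=> [/fk[s sM sa]|[s [sM sa]]]; first by exists s.
    have [u su] := fu s sM.
    rewrite -[f a]mul1r -su mulrAC -rmorphM /=.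
    by move: sa; rewrite /GRing.scale /= => ->; rewrite rmorph0 mul0r.
  have [a [s [sM E]]] := ff y; exists s, a; split=> //.
  by rewrite lE -E; apply: mulrC.
Qed.

(** * The local ring at the vertex and its Artinian quotient *)

Definition aug : {pred A} := fun x => x@_mone == 0.

Lemma in_aug x : (x \in aug) = (x@_mone == 0).
Proof. by []. Qed.

Lemma aug_maximal : maximal_ideal aug.
Proof.
have aug0 : (0 : A) \in aug by rewrite in_aug mcoeff0.
have augN1 : (1 : A) \notin aug by rewrite in_aug mcoeff1 eqxx oner_eq0.
split; first split=> // a x y x0 y0.
  have {}x0 : x@_mone = 0 by exact/eqP.
  have {}y0 : y@_mone = 0 by exact/eqP.
  by apply/eqP; rewrite mcoeffD mcoeffM1 x0 y0 mulr0 addr0.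
move=> J [J0 J1 JL] sub x Jx; apply: contraNT J1; rewrite in_aug => x0.
have y_aug : 1 - (x@_mone)^-1 *: x \in aug.
  by rewrite in_aug mcoeffB mcoeffZ mcoeff1 eqxx mulVf // subrr.
have -> : 1 = (x@_mone)^-1%:MP * x + (1 - (x@_mone)^-1 *: x).
  by rewrite mul_malgC addrC subrK.
by apply: JL => //; apply: sub.
Qed.

Definition has_big_coord j s := exists i : 'I_d, (i < j)%N /\ (m <= ex s i)%N.

(** The ideal generated by the [th i] with i < j, described through supports. *)
Definition big_ideal j (x : A) := forall s, x@_s != 0 -> has_big_coord j s.

Lemma big_ideal0 j : big_ideal j 0.
Proof. by move=> s; rewrite mcoeff0 eqxx. Qed.

Lemma big_idealD j x y : big_ideal j x -> big_ideal j y -> big_ideal j (x + y).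
Proof.
move=> Hx Hy s; rewrite mcoeffD; have [xs|/Hx //] := eqVneq (x@_s) 0.
by rewrite xs add0r => /Hy.
Qed.

Lemma big_idealM j a x : big_ideal j x -> big_ideal j (a * x).
Proof.
move=> Hx; apply: (@malg_ind (fun z => big_ideal j (z * x))) => [|u v uH vH|t _].
- by rewrite mul0r; apply: big_ideal0.
- by rewrite mulrDl; apply: big_idealD.
move=> s; rewrite -scalerAl mcoeffZ mulf_eq0 negb_or => /andP[_].
rewrite mulrC => /[dup] /mcoeffMX_neq0[u ->]; rewrite mcoeffMX => /Hx[i [ij mi]].
by exists i; rewrite exM (leq_trans mi) ?leq_addr.
Qed.

Lemma ideal_big_ideal j : ideal (big_ideal j).
Proof.
split=> [|r x y Hx Hy]; first exact: big_ideal0.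
by apply: big_idealD => //; apply: big_idealM.
Qed.

(** Multiplying by [th i] changes coordinate [i] only, which [big_ideal i] does not test; thus the
    [th i] form a regular sequence. *)
Lemma big_ideal_regular (i : 'I_d) x : big_ideal i (X (th i) * x) -> big_ideal i x.
Proof.
move=> H s xs; have [|l [li]] := H (mmul s (th i)).
  by rewrite mulrC mcoeffMX.
rewrite exM exth; have -> : (i == l) = false by apply/eqP => E; rewrite E ltnn in li.
by rewrite addn0 => ml; exists l.
Qed.

Lemma big_ideal_succ (i : 'I_d) x : big_ideal i.+1 x ->
  exists y z, big_ideal i y /\ x = y + z * X (th i).
Proof.
move=> H; pose P w := exists y z, big_ideal i y /\ w = y + z * X (th i).
apply: (@malg_ind P) => [|u v [y [z [Hy ->]]] [y' [z' [Hy' ->]]]|s xs].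
- by exists 0, 0; rewrite mul0r addr0; split=> //; apply: big_ideal0.
- exists (y + y'), (z + z'); split; first exact: big_idealD.
  by rewrite mulrDl addrACA.
have [l [li ml]] := H s xs; move: li; rewrite ltnS leq_eqVlt => /orP[/eqP li|li].
  have {}li : l = i by apply: val_inj.
  move: ml; rewrite li => /th_divides[t ->].
  exists 0, (x@_(mmul (th i) t) *: X t); split; first exact: big_ideal0.
  by rewrite add0r -scalerAl -XM [mmul t _]mulmC.
exists (x@_s *: X s), 0; rewrite mul0r addr0; split=> // t.
rewrite mcoeffZ mcoeffX; case: (s =P t) => [<- _|_]; first by exists l.
by rewrite mulr0 eqxx.
Qed.

Lemma big_ideal_pred_succ (i : 'I_d) x : big_ideal i x -> big_ideal i.+1 x.
Proof. by move=> H s /H[l [li ml]]; exists l; rewrite ltnS ltnW. Qed.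

Lemma big_ideal_th (i : 'I_d) : big_ideal i.+1 (X (th i)).
Proof.
move=> s; rewrite mcoeffX; case: (_ =P s) => [<- _|_]; last by rewrite eqxx.
by exists i; rewrite exth eqxx.
Qed.

Lemma box_not_big s j : box s -> ~ has_big_coord j s.
Proof. by move=> sb [i [_]]; rewrite leqNgt sb. Qed.

Lemma deg_not_box s : (d * m < deg s)%N -> has_big_coord d s.
Proof.
move=> sd; apply: contrapT => nb; move: sd; rewrite ltnNge => /negP; apply.
rewrite /deg -[X in (_ <= X * _)%N]card_ord -sum_nat_const; apply: leq_sum => i _.
by rewrite leqNgt; apply/negP => mi; apply: nb; exists i; rewrite ltn_ord ltnW.
Qed.

Section LocalRing.
Variables (S : comNzRingType) (f : {rmorphism A -> S}).
Hypothesis loc : is_localization_at aug f.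
Let fu : forall x, x \notin aug -> exists u : S, f x * u = 1.
Proof. by case: loc. Qed.
Let ff : forall y : S, exists a x : A, x \notin aug /\ y * f x = f a.
Proof. by case: loc. Qed.
Let fk : forall x, f x = 0 -> x = 0.
Proof.
move=> x; case: loc => _ _ H /H[s sM /malg_domain[s0|//]].
by rewrite in_aug s0 mcoeff0 eqxx in sM.
Qed.
Let augM x y : x \notin aug -> y \notin aug -> x * y \notin aug.
Proof. by rewrite !in_aug mcoeffM1 => x0 y0; apply: mulf_neq0. Qed.
Let augN1 : (1 : A) \notin aug.
Proof. by rewrite in_aug mcoeff1 eqxx oner_eq0. Qed.

Definition loc_ext (P : A -> Prop) (y : S) :=
  exists t a : A, [/\ t \notin aug, P a & y * f t = f a].

Lemma ideal_loc_ext P : ideal P -> ideal (loc_ext P).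
Proof.
move=> iP; split=> [|r x y [t [a [tM Pa xt]]] [u [b [uM Pb yu]]]].
  by exists 1, 0; rewrite mul0r rmorph0; split=> //; apply: ideal0.
have [c [s [sM rs]]] := ff r.
exists (s * t * u), (c * u * a + s * t * b); split; first by rewrite !augM.
  by case: (iP) => _; apply; rewrite ?idealM //; apply: idealM.
by rewrite rmorphD !rmorphM -xt -yu -rs; ring.
Qed.

Lemma loc_ext_f P x : ideal P -> loc_ext P (f x) ->
  exists t : A, t \notin aug /\ P (x * t).
Proof.
move=> iP [t [a [tM Pa xt]]]; exists t; split=> //.
suff -> : x * t = a by [].
by apply/subr0_eq/fk; rewrite rmorphB rmorphM xt subrr.
Qed.

Lemma loc_ext_sub P x : P x -> loc_ext P (f x).
Proof. by move=> Px; exists 1, x; rewrite rmorph1 mulr1. Qed.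

Lemma loc_ext_regular (i : 'I_d) (y : S) :
  loc_ext (big_ideal i) (y * f (X (th i))) -> loc_ext (big_ideal i) y.
Proof.
move=> [t [a [tM Pa yt]]]; have [c [s [sM ys]]] := ff y.
exists (s * t), (c * t); split; [exact: augM| |by rewrite !rmorphM -ys; ring].
apply: big_ideal_regular.
suff -> : X (th i) * (c * t) = s * a by apply: big_idealM.
by apply/subr0_eq/fk; rewrite rmorphB !rmorphM -yt -ys; ring.
Qed.

Lemma loc_ext_succ (i : 'I_d) :
  loc_ext (big_ideal i.+1) = add_gen (loc_ext (big_ideal i)) (f (X (th i))).
Proof.
apply: funext => y; apply: propext; split.
  move=> [t [a [tM /big_ideal_succ[b [c [Pb ->]]] yt]]].
  have [u tu] := fu tM; exists (u * f b), (u * f c); split.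
    exists t, b; split=> //.
    by rewrite mulrAC [u * f t]mulrC tu mul1r.
  rewrite -[y]mulr1 -tu mulrA yt rmorphD rmorphM; ring.
move=> [al [rho [[t [a [tM Pa at_]]] ->]]].
have iB := ideal_loc_ext (ideal_big_ideal i.+1); rewrite addrC; case: (iB) => _; apply.
  exact/loc_ext_sub/big_ideal_th.
by exists t, a; split=> //; apply: big_ideal_pred_succ.
Qed.

Lemma loc_ext0 (y : S) : loc_ext (big_ideal 0) y -> y = 0.
Proof.
move=> [t [a [tM Pa yt]]]; have [u tu] := fu tM.
suff a0 : a = 0 by rewrite -[y]mulr1 -tu mulrA yt a0 rmorph0 mul0r.
apply/malgP => s; rewrite mcoeff0; have [//|/Pa[i []//]] := eqVneq (a@_s) 0.
Qed.

(** Rees' lemma, applied along the regular sequence of the images of the [th i]. *)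
Lemma loc_quotients e j : injd (fun y : S => y = 0) e (S^o : lmodType S) -> (j <= d)%N ->
  exists e' (N : lmodType S) (q : {linear S^o -> N}),
    [/\ injd (loc_ext (big_ideal j)) e' N, forall n, exists y : S, q y = n &
        forall y : S, q y = 0 <-> loc_ext (big_ideal j) y].
Proof.
move=> dS; elim: j => [_|j IH jd].
  exists e, S^o, idfun; split=> [|n|y]; last 2 first.
  - by exists n.
  - split=> [/= ->|/loc_ext0//]; exact: (ideal0 (ideal_loc_ext (ideal_big_ideal 0))).
  suff -> : loc_ext (big_ideal 0) = (fun y : S => y = 0) by [].
  apply: funext => y; apply: propext; split=> [/loc_ext0//|->].
  exact: (ideal0 (ideal_loc_ext (ideal_big_ideal 0))).
have [e' [N [q [dN qs qE]]]] := IH (ltnW jd).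
pose i := Ordinal jd; have -> : j.+1 = (i : nat).+1 by [].
rewrite loc_ext_succ -/(nat_of_ord i); set x := f _.
have iB := ideal_loc_ext (ideal_big_ideal j).
have [|b _ _ [n <-] [n' <-]|N' [q' [qs' qE']]] :=
  @quotient_exists S N (fun n => exists n', x *: n' = n).
- by exists 0; rewrite scaler0.
- by exists (b *: n + n'); rewrite scalerDr !scalerA mulrC.
exists e', N', (q' \o q); split=> [|n|y].
- apply: (injd_regular_quotient iB (x := x) _ dN _ qs' qE').
    by move=> r; apply: (@loc_ext_regular i).
  move=> n; have [y <-] := qs n; rewrite -linearZ_LR => /qE; rewrite /GRing.scale /= mulrC.
  by move=> /(@loc_ext_regular i) H; apply/qE.
- by have [n' <-] := qs' n; have [y <-] := qs n'; exists y.
- rewrite /= qE'; split.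
    move=> [n]; have [z <-] := qs n; rewrite -linearZ_LR => E.
    exists (y - x * z), z; split; last by rewrite mulrC subrK.
    by apply/qE; rewrite linearB -E /GRing.scale /= subrr.
  move=> [al [rho [/qE qal ->]]]; exists (q rho).
  by rewrite -linearZ_LR linearD qal add0r; congr (q _); apply: mulrC.
Qed.

Definition aug_pow n (x : A) := forall s, x@_s != 0 -> (n <= deg s)%N.

Lemma aug_powM n p x y : aug_pow n x -> aug_pow p y -> aug_pow (n + p) (x * y).
Proof.
move=> Hx Hy s; rewrite mcoeff_neq0 => /msuppM_le[t [u [tx uy ->]]].
by rewrite degM leq_add ?Hx ?Hy ?mcoeff_neq0.
Qed.

Lemma aug_pow1 x : x \in aug -> aug_pow 1 x.
Proof.
rewrite in_aug => /eqP x0 s; apply: contraR; rewrite -ltnNge ltnS leqn0.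
by move=> /eqP/deg_eq0->; rewrite x0.
Qed.

(** A product of dm + 1 elements without constant term has all its degrees above those of the
    box. *)
Lemma loc_ext_nilpotent (l : seq S) : size l = (d * m).+1 ->
  (forall y : S, y \in l -> loc_ext (fun x => x \in aug) y) ->
  loc_ext (big_ideal d) (\prod_(y <- l) y).
Proof.
move=> ld lM.
have [t [a [tM Pa E]]] : loc_ext (aug_pow (size l)) (\prod_(y <- l) y).
  elim: l lM {ld} => [|y l IH] lM.
    by rewrite big_nil; exists 1, 1; rewrite mul1r; split.
  have [t [a [tM Pa E]]] := lM y (mem_head _ _).
  have [|u [b [uM Pb E']]] := IH; first by move=> z zl; apply: lM; rewrite inE zl orbT.
  exists (t * u), (a * b); split; first exact: augM.
    by rewrite /= -add1n; apply: aug_powM => //; apply: aug_pow1.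
  by rewrite big_cons !rmorphM -E -E'; ring.
by exists t, a; split=> // s /Pa; rewrite ld; apply: deg_not_box.
Qed.

Definition box_maximal s := box s /\ forall t, box (mmul s t) -> t = mone.

Lemma big_ideal_box x s j : big_ideal j x -> box s -> x@_s = 0.
Proof.
move=> H sb; apply/eqP; by apply: contraT => /H /(box_not_big sb).
Qed.

(** A proper multiple of a maximal box monomial leaves the box, so it vanishes modulo the [th i]. *)
Lemma box_maximal_socle s : box_maximal s -> forall r,
  loc_ext (fun x => x \in aug) r -> loc_ext (big_ideal d) (r * f (X s)).
Proof.
move=> [sb smax] r [t [a [tM aM E]]]; exists t, (a * X s); split=> //.
  move=> u aus; have [v uE] := mcoeffMX_neq0 aus.
  move: aus; rewrite uE mcoeffMX => av.
  apply: contrapT => nb; move: aM av; have -> : v = mone; last first.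
    by rewrite in_aug => ->.
  apply: smax => i; rewrite mulmC ltnNge; apply/negP => mi; apply: nb.
  by exists i.
by rewrite mulrAC E rmorphM.
Qed.

(** Both monomials are nonzero socle elements of a self-injective Artinian local ring, so [s2] is a
    multiple of [s1] modulo the [th i]; comparing coefficients, [s1] divides [s2], and maximality
    gives equality. *)
Lemma box_maximal_unique e s1 s2 : injd (fun y : S => y = 0) e (S^o : lmodType S) ->
  box_maximal s1 -> box_maximal s2 -> s1 = s2.
Proof.
move=> dS m1 m2; have [sb1 smax1] := m1; have [sb2 smax2] := m2.
have iB := ideal_loc_ext (ideal_big_ideal d).
have iM : ideal (loc_ext (fun x => x \in aug)).
  apply: ideal_loc_ext; have [[M0 _ Mlin] _] := aug_maximal.
  by split=> // r x y xM yM; apply: Mlin.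
have sub r : loc_ext (big_ideal d) r -> loc_ext (fun x => x \in aug) r.
  move=> [t [a [tM Pa E]]]; exists t, a; split=> //.
  rewrite in_aug; apply/eqP; apply: (big_ideal_box Pa).
  by move=> i; rewrite ex1.
have unit_out r : ~ loc_ext (fun x => x \in aug) r -> exists z : S, z * r = 1.
  move=> nr; have [a [t [tM E]]] := ff r.
  have aM : a \notin aug by apply/negP => aM; apply: nr; exists t, a.
  have [u au] := fu aM; exists (f t * u).
  by rewrite mulrAC [f t * r]mulrC E.
have not_box s : box s -> ~ loc_ext (big_ideal d) (f (X s)).
  move=> sb /(loc_ext_f (ideal_big_ideal d))[t [tM Pt]].
  have := big_ideal_box Pt sb; rewrite mulrC -{1}[s]mul1m mcoeffMX => /eqP.
  by apply/negP.
have [e' [N [q [dN qs qE]]]] := loc_quotients dS (leqnn d).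
have [r [t [a [tM Pa E]]]] := socle_proportional iB iM sub unit_out loc_ext_nilpotent
  (not_box _ sb1) (box_maximal_socle m1) dN qs qE (not_box _ sb1) (box_maximal_socle m2).
have [b [p [pM rp]]] := ff r.
(* Denominators are cleared in [A]; since [t * p] has nonzero constant term, the coefficient of [s2]
   on the left is nonzero. *)
have E2 : X s2 * (t * p) = (b * t) * X s1 + a * p.
  apply/subr0_eq/fk; rewrite rmorphB rmorphD !rmorphM -E -rp; ring.
have := congr1 (mcoeff s2) E2; rewrite mcoeffD.
rewrite mulrC -{1}[s2]mul1m mcoeffMX [a * p]mulrC.
rewrite (big_ideal_box (@big_idealM d p a Pa) sb2) addr0 => E3.
have tp : (t * p)@_mone != 0 by apply: augM.
have [|v vE] := @mcoeffMX_neq0 (b * t) s1 s2; first by rewrite -E3.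
have v1 : v = mone by apply: smax1; rewrite mulmC -vE.
by rewrite vE v1 mul1m.
Qed.

End LocalRing.

Lemma box_below_maximal s : box s -> exists t, box_maximal (mmul s t).
Proof.
move=> sb; have [n] := ubnP (d * m - deg s)%N; elim: n s sb => // n IH s sb sn.
have [smax|/existsNP[t /not_implyP[tb t1]]] := pselect (forall t, box (mmul s t) -> t = mone).
  by exists mone; rewrite mulm1.
have t0 : (0 < deg t)%N by rewrite lt0n; apply/eqP => /deg_eq0.
have dle u : box u -> (deg u <= d * m)%N.
  move=> ub; rewrite leqNgt; apply/negP => /deg_not_box.
  exact: box_not_big.
have [|u uH] := IH (mmul s t) tb.
  by have := dle _ tb; move: sn; rewrite degM; lia.
by exists (mmul t u); rewrite mulmA.
Qed.

(** The unique maximal box element is a multiple of every box element, hence reaches m-1 in each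
    coordinate. *)
Lemma dual_of_gorenstein :
  (forall i, exists t, box t /\ ex t i = m.-1) ->
  gorenstein_ring A -> exists s0, forall i, ex s0 i = m.-1.
Proof.
move=> prim [_ /(_ _ aug_maximal)[S [f [loc [e /injdim_le_injd dS]]]]].
have box1 : box mone by move=> i; rewrite ex1.
have [s smax] := box_below_maximal box1; exists (mmul mone s) => i.
have [x [xb xi]] := prim i; have [t tmax] := box_below_maximal xb.
have E := box_maximal_unique loc dS smax tmax.
have [sb _] := smax; have := sb i.
have -> : ex (mmul mone s) i = (m.-1 + ex t i)%N by rewrite E exM xi.
lia.
Qed.

Lemma box_reduce s : exists t, box t /\ forall i, ex t i = (ex s i %% m)%N.
Proof.
elim/box_ind: s => [s sb|i s [t [tb tE]]].
  by exists s; split=> // i; rewrite modn_small.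
exists t; split=> // j; rewrite exM exth tE.
by case: eqP => _; rewrite ?add0n ?modnDl.
Qed.

Theorem gorenstein_semigroup_ring :
  (forall i, exists t, ex t i = m.-1) ->
  gorenstein_ring A <-> exists s0, forall i, ex s0 i = m.-1.
Proof.
move=> prim; split; last by move=> [s0]; apply: gorenstein_of_dual.
apply: dual_of_gorenstein => i; have [s sE] := prim i; have [t [tb tE]] := box_reduce s.
by exists t; split=> //; rewrite tE sE modn_small // prednK.
Qed.

End SemigroupRing.

(** * The cone over the lecture hall polytope *)

Section LectureHall.
Variables (R : realType) (n : nat) (b : n.-tuple nat).
Hypotheses (n_gt0 : (0 < n)%N) (b_gt0 : forall i, (0 < tnth b i)%N).
Local Notation K := (ehrhart_monomial R b).
Local Notation B := (lh_seq b).
Local Notation N := (lh_lcm b).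

Lemma lh_seqS (i : 'I_n) : B i.+1 = tnth b i.
Proof. by rewrite /lh_seq /= (tnth_nth 1%N). Qed.

Lemma lh_seq_last : B n.+1 = 1%N.
Proof. by rewrite /lh_seq /= nth_default ?size_tuple. Qed.

Lemma lh_seq_gt0 j : (0 < B j)%N.
Proof.
case: j => [//|j]; have [jn|nj] := ltnP j n; first by rewrite (lh_seqS (Ordinal jn)).
by rewrite /lh_seq /= nth_default ?size_tuple.
Qed.

Lemma lh_lcm_gt0 j : (0 < N j)%N.
Proof. by rewrite lcmn_gt0 !lh_seq_gt0. Qed.

(* The homogeneous coordinates (0, x_1, ..., x_n, k) of a lattice point. *)
Definition coord (x : 'rV[int]_n * nat) (j : nat) : int :=
  if j is i.+1 then (if insub i is Some i' then x.1 0 i' else x.2%:Z) else 0.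

Lemma coordS x (i : 'I_n) : coord x i.+1 = x.1 0 i.
Proof. by rewrite /coord valK. Qed.

Lemma coord_last x : coord x n.+1 = x.2%:Z.
Proof. by rewrite /coord insubF ?ltnn. Qed.

Lemma coordD x y j : coord (x.1 + y.1, (x.2 + y.2)%N) j = coord x j + coord y j.
Proof.
case: j => [|j]; first by rewrite addr0.
have [jn|nj] := ltnP j n; first by rewrite !(coordS _ (Ordinal jn)) mxE.
by rewrite /coord insubF //= ltnNge nj.
Qed.

Lemma coord_inj x y : (forall j, (j <= n.+1)%N -> coord x j = coord y j) -> x = y.
Proof.
case: x y => [p h] [q l] H; congr pair; last first.
  by have := H n.+1 (leqnn _); rewrite !coord_last => -[].
by apply/rowP => i; have := H i.+1 (leqW (ltn_ord i)); rewrite !coordS.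
Qed.

(** With b_0 = b_(n+1) = 1, the bounds 0 and k become the two ends of a single chain of ratios. *)
Lemma ehrhart_exponentE x : ehrhart_exponent R b x <->
  forall j, (j <= n)%N -> coord x j * (B j.+1)%:Z <= coord x j.+1 * (B j)%:Z.
Proof.
have B0 j : 0 < (B j)%:R :> R by rewrite ltr0n lh_seq_gt0.
pose q j : R := (coord x j)%:~R / (B j)%:R.
have qE j : (coord x j * (B j.+1)%:Z <= coord x j.+1 * (B j)%:Z) = (q j <= q j.+1).
  rewrite /q ler_pdivrMr // mulrAC ler_pdivlMr //.
  by rewrite -[(B j)%:R]/((B j)%:Z%:~R) -[(B j.+1)%:R]/((B j.+1)%:Z%:~R) -!intrM ler_int.
split=> [/asboolP[u [u0 uu u1] uE] j jn|H].
  have xE (i : 'I_n) : q i.+1 = x.2%:R * (u 0 i / (tnth b i)%:R).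
    by rewrite /q coordS lh_seqS mulrA; move/rowP/(_ i): uE; rewrite !mxE => ->.
  have x0 : 0 <= x.2%:R :> R by [].
  rewrite qE; case: j jn => [|j] jn.
    have -> : q 0%N = 0 by rewrite /q mul0r.
    by rewrite (xE (Ordinal n_gt0)) mulr_ge0.
  have -> : q j.+1 = x.2%:R * (u 0 (Ordinal jn) / (tnth b (Ordinal jn))%:R) by rewrite -xE.
  have [jn'|nj] := ltnP j.+1 n.
    by rewrite (xE (Ordinal jn')) ler_wpM2l // uu.
  have -> : q j.+2 = x.2%:R * 1.
    have -> : j.+2 = n.+1 by congr S; apply/eqP; rewrite eqn_leq jn nj.
    by rewrite /q coord_last lh_seq_last divr1 mulr1.
  by rewrite ler_wpM2l.
have q_mono i j : (i <= j)%N -> (j <= n.+1)%N -> q i <= q j.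
  elim: j => [|j IH]; first by rewrite leqn0 => /eqP->.
  rewrite leq_eqVlt => /orP[/eqP->//|ij] jn.
  by apply: le_trans (IH ij (ltnW jn)) _; rewrite -qE; apply: H.
have q0 : q 0%N = 0 by rewrite /q mul0r.
have qn : q n.+1 = x.2%:R by rewrite /q coord_last lh_seq_last divr1.
have qx (i : 'I_n) : (x.1 0 i)%:~R / (tnth b i)%:R = q i.+1 by rewrite /q coordS lh_seqS.
have in_le (i : 'I_n) : (i.+1 <= n.+1)%N by rewrite ltnS ltnW.
(* In degree 0 the ratios are squeezed between 0 and 0, so the point is the origin. *)
apply/asboolP; have [x0|x0] := eqVneq x.2 0%N.
  exists 0; first by split=> [i|i j _|i]; rewrite !mxE !mul0r ?ler01.
  apply/rowP => i; rewrite x0 scale0r !mxE.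
  have qi : q i.+1 = 0.
    by apply: le_anti; rewrite -{2}q0 q_mono // andbT -[0]/(0%:R : R) -x0 -qn q_mono.
  move: qi; rewrite -qx => /eqP; rewrite mulf_eq0 invr_eq0 => /orP[/eqP-> //|].
  by rewrite -lh_seqS gt_eqF.
have x_gt0 : 0 < x.2%:R :> R by rewrite ltr0n lt0n.
have wE (i : 'I_n) : (x.2%:R^-1 *: map_mx intr x.1 : 'rV[R]_n) 0 i / (tnth b i)%:R =
    x.2%:R^-1 * q i.+1.
  by rewrite !mxE -qx mulrA.
have xV : 0 <= x.2%:R^-1 :> R by rewrite invr_ge0 ltW.
exists (x.2%:R^-1 *: map_mx intr x.1); last first.
  by rewrite scalerA divff ?gt_eqF // scale1r.
split=> [i|i j ij|i]; rewrite !wE.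
- by rewrite mulr_ge0 // -q0 q_mono.
- by rewrite ler_wpM2l // q_mono.
- by rewrite mulrC ler_pdivrMr // mul1r -qn q_mono.
Qed.

(** * Primitive facet equations *)

Definition slope_num j := (N j.+1 %/ B j.+1)%N.
Definition slope_den j := (N j.+1 %/ B j)%N.

Lemma slope_numK j : (slope_num j * B j.+1 = N j.+1)%N.
Proof. by rewrite divnK // dvdn_lcml. Qed.

Lemma slope_denK j : (slope_den j * B j = N j.+1)%N.
Proof. by rewrite divnK // dvdn_lcmr. Qed.

Lemma slope_num_gt0 j : (0 < slope_num j)%N.
Proof. by have := lh_lcm_gt0 j.+1; rewrite -slope_numK muln_gt0 => /andP[]. Qed.

(** A common factor g > 1 would make N/g a common multiple of the two entries of [b] smaller than
    their lcm. *)
Lemma slope_coprime j : coprime (slope_num j) (slope_den j).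
Proof.
rewrite /coprime; set g := gcdn _ _.
have g0 : (0 < g)%N by rewrite gcdn_gt0 slope_num_gt0.
have [a aE] : exists a, slope_num j = (a * g)%N by apply/dvdnP/dvdn_gcdl.
have [c cE] : exists c, slope_den j = (c * g)%N by apply/dvdnP/dvdn_gcdr.
have NE : N j.+1 = (a * B j.+1 * g)%N by rewrite -slope_numK aE mulnAC.
have E : (a * B j.+1 = c * B j)%N.
  by apply/eqP; rewrite -(eqn_pmul2r g0) -NE -slope_denK cE mulnAC.
have : (N j.+1 %| a * B j.+1)%N.
  by rewrite dvdn_lcm dvdn_mull //= E dvdn_mull.
have aB0 : (0 < a * B j.+1)%N by have := lh_lcm_gt0 j.+1; rewrite NE muln_gt0 => /andP[].
move/(dvdn_leq aB0); rewrite NE -{2}[(a * _)%N]muln1 leq_pmul2l // => g1.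
by rewrite eqn_leq g1.
Qed.

(* [form c j] is the primitive integral equation of the [j]-th facet of the *)
(* cone over the polytope.                                                  *)
Definition form (c : nat -> int) j : int :=
  (slope_num j)%:Z * c j.+1 - (slope_den j)%:Z * c j.

Lemma form_ge0 c j : (0 <= form c j) = (c j * (B j.+1)%:Z <= c j.+1 * (B j)%:Z).
Proof.
have BB : 0 < (B j)%:Z * (B j.+1)%:Z :> int.
  by rewrite mulr_gt0 // ltz_nat lh_seq_gt0.
have NN : 0 < (N j.+1)%:Z :> int by rewrite ltz_nat lh_lcm_gt0.
rewrite -(pmulr_lge0 _ BB) -[RHS]subr_ge0 -[RHS](pmulr_rge0 _ NN); congr (0 <= _).
rewrite /form mulrBl mulrBr.
by congr (_ - _); [rewrite -(slope_numK j) | rewrite -(slope_denK j)]; rewrite PoszM; ring.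
Qed.

Lemma form_rat c j : (form c j)%:~R / (N j.+1)%:R =
  (c j.+1)%:~R / (B j.+1)%:R - (c j)%:~R / (B j)%:R :> rat.
Proof.
have B0 i : (B i)%:R != 0 :> rat by rewrite pnatr_eq0 -lt0n lh_seq_gt0.
have a0 : (slope_num j)%:R != 0 :> rat by rewrite pnatr_eq0 -lt0n slope_num_gt0.
have d0 : (slope_den j)%:R != 0 :> rat.
  by rewrite pnatr_eq0 -lt0n; have := lh_lcm_gt0 j.+1; rewrite -slope_denK muln_gt0 => /andP[].
rewrite /form rmorphB !rmorphM /= mulrBl.
congr (_ - _); first by rewrite -(slope_numK j) natrM -!pmulrn; field; rewrite B0 a0.
by rewrite -(slope_denK j) natrM -!pmulrn; field; rewrite B0 d0.
Qed.

(** Nonnegative forms make all coordinates nonnegative, so the last one is a legitimate dilation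
    factor. *)
Lemma lattice_point_exists (c : nat -> int) : c 0%N = 0 ->
  (forall j, (j <= n)%N -> 0 <= form c j) ->
  exists x : K, forall j, (j <= n.+1)%N -> coord x j = c j.
Proof.
move=> c0 cform.
have c_ge0 j : (j <= n.+1)%N -> 0 <= c j.
  elim: j => [|j IH] jn; first by rewrite c0.
  have Bj : 0 < (B j)%:Z :> int by rewrite ltz_nat lh_seq_gt0.
  rewrite -(pmulr_lge0 _ Bj); apply: le_trans (_ : c j * (B j.+1)%:Z <= _).
    by rewrite mulr_ge0 // IH // ltnW.
  by rewrite -form_ge0 cform.
pose x : 'rV[int]_n * nat := (\row_(i < n) c i.+1, absz (c n.+1)).
have xc j : (j <= n.+1)%N -> coord x j = c j.
  case: j => [|j]; first by rewrite c0.
  rewrite ltnS leq_eqVlt => /orP[/eqP->|jn].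
    by rewrite coord_last /= gez0_abs // c_ge0.
  by rewrite (coordS x (Ordinal jn)) mxE.
have xP : ehrhart_exponent R b x.
  apply/ehrhart_exponentE => j jn; rewrite (xc j (leqW jn)) (xc j.+1 jn).
  by rewrite -form_ge0 cform.
by exists (EhrhartMonomial xP).
Qed.

Definition facet (x : K) (i : 'I_n.+1) : nat := absz (form (coord x) i).

Lemma facetE x i : (facet x i)%:Z = form (coord x) i.
Proof.
rewrite /facet gez0_abs // form_ge0; case: x => x /= /ehrhart_exponentE; apply.
by rewrite -ltnS.
Qed.

Lemma coordM (x y : K) j : coord (mmul x y) j = coord x j + coord y j.
Proof. exact: coordD. Qed.

Lemma formD c c' j : form (fun i => c i + c' i) j = form c j + form c' j.
Proof. by rewrite /form; ring. Qed.

Lemma eq_form c c' j : c j = c' j -> c j.+1 = c' j.+1 -> form c j = form c' j.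
Proof. by rewrite /form => -> ->. Qed.

Lemma facet1 i : facet mone i = 0%N.
Proof.
have z j : coord (mone : K) j = 0.
  by case: j => // j; rewrite /coord /=; case: insub => // i'; rewrite mxE.
by rewrite /facet /form !z !mulr0 subr0.
Qed.

Lemma facetM x y i : facet (mmul x y) i = (facet x i + facet y i)%N.
Proof.
apply: (can_inj absz_nat); rewrite PoszD !facetE -formD.
by apply: eq_form; apply: coordM.
Qed.

Lemma facet_inj x y : (forall i, facet x i = facet y i) -> x = y.
Proof.
move=> H; apply: val_inj; apply: coord_inj => j; elim: j => // j IH jn.
have := congr1 Posz (H (Ordinal jn)); rewrite !facetE /= /form (IH (ltnW jn)).
move/addIr; apply: mulfI.
by rewrite eqz_nat -lt0n slope_num_gt0.
Qed.

(** Saturation: the difference of the two points satisfies all facet inequalities. *)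
Lemma facet_div x y : (forall i, facet y i <= facet x i)%N ->
  exists z, x = mmul y z.
Proof.
move=> H; have [//|j jn|z zE] := @lattice_point_exists (fun j => coord x j - coord y j).
  have -> : form (fun j => coord x j - coord y j) j = form (coord x) j - form (coord y) j.
    by rewrite /form; ring.
  have jn' : (j < n.+1)%N by rewrite ltnS.
  by rewrite subr_ge0 -(facetE x (Ordinal jn')) -(facetE y (Ordinal jn')) lez_nat; apply: H.
exists z; apply: val_inj; apply: coord_inj => j jn.
by rewrite coordM zE // addrC subrK.
Qed.

(** * Lattice points with prescribed facet values *)

Definition conductor := (\prod_(i < n.+1) N i.+1)%N.

Lemma conductor_gt0 : (0 < conductor)%N.
Proof. by rewrite prodn_gt0 // => i; apply: lh_lcm_gt0. Qed.

Lemma conductorE (i : 'I_n.+1) : exists q, conductor = (q * N i.+1)%N.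
Proof. by apply/dvdnP; rewrite /conductor (bigD1 i) //= dvdn_mulr. Qed.

Lemma facet_vertex (i : 'I_n.+1) :
  exists x : K, forall j, facet x j = if i == j then conductor else 0%N.
Proof.
have [q qE] := conductorE i.
(* The ratios [c j / B j] jump once, from 0 to [q], right after index [i]. *)
pose c (j : nat) : int := if (j <= i)%N then 0 else ((B j) * q)%N%:Z.
have cform j : form c j = if (i : nat) == j then conductor%:Z else 0.
  have c_le l : (l <= i)%N -> c l = 0 by rewrite /c => ->.
  have c_gt l : (i < l)%N -> c l = (B l * q)%N by rewrite /c ltnNge => /negbTE->.
  rewrite /form; have [ij|ji|ij] := ltngtP i j.
  - by rewrite !c_gt ?leqW // -!PoszM !mulnA slope_numK slope_denK subrr.
  - by rewrite (c_le j.+1 ji) (c_le j (ltnW ji)) !mulr0 subr0.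
  - by rewrite -ij c_gt // c_le // mulr0 subr0 -PoszM mulnA slope_numK qE mulnC.
have [||x xE] := @lattice_point_exists c.
- by rewrite /c.
- by move=> j jn; rewrite cform; case: eqP.
exists x => j; apply: (can_inj absz_nat); rewrite facetE.
rewrite (eq_form (c' := c)) ?xE //; last by rewrite ltnW // ltn_ord.
by rewrite cform -val_eqE; case: eqP.
Qed.

(** Bezout for the coprime coefficients of the form provides coordinates [i] and [i.+1]. Zeros
    before them and the constant ratio [u] after them keep the other forms nonnegative. *)
Lemma facet_primitive (i : 'I_n.+1) : exists x : K, facet x i = conductor.-1.
Proof.
have [u [v [uv iv]]] : exists u v : nat,
    (slope_num i * u = slope_den i * v + conductor.-1)%N /\ ((i : nat) == 0%N -> v = 0%N).
  (* Coordinate 0 must be 0; the leading coefficient is 1 there, so [v = 0] is possible. *)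
  have [i0|i0] := eqVneq (i : nat) 0%N.
    exists conductor.-1, 0%N; split=> //; rewrite i0 muln0 add0n.
    by rewrite /slope_num /lh_lcm /= lcmn1 divnn lh_seq_gt0 mul1n.
  have := egcdnP (slope_den i) (slope_num_gt0 i).
  case=> km kn E _; exists (conductor.-1 * km)%N, (conductor.-1 * kn)%N; split=> //.
  move/eqP: (slope_coprime i) E => -> E.
  rewrite mulnCA [(slope_num i * km)%N]mulnC E mulnDr muln1; congr (_ + _)%N.
  by rewrite mulnA [RHS]mulnC.
pose c (j : nat) : int := if (j < i)%N then 0 else if j == i then v%:Z
  else if j == i.+1 then u%:Z else (B j * u)%N%:Z.
have ci : c i = v by rewrite /c ltnn eqxx.
have ciS : c i.+1 = u by rewrite /c ltnNge leqnSn /= eqn_leq ltnn /= eqxx.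
have clt j : (j < i)%N -> c j = 0 by rewrite /c => ->.
have cgt j : (i.+1 < j)%N -> c j = (B j * u)%N.
  by move=> ij; rewrite /c ltnNge (ltnW (ltnW ij)) /= !gtn_eqF // ltnW.
have fi : form c i = conductor.-1%:Z.
  by rewrite /form ci ciS -!PoszM uv PoszD addrC addKr.
have [||x xE] := @lattice_point_exists c.
- have [i0|i0] := eqVneq (i : nat) 0%N; last by rewrite clt // lt0n.
  by rewrite -{1}i0 ci iv // i0.
- move=> j jn; have [ji|ij|->] := ltngtP j i; last by rewrite fi.
  + rewrite /form (clt j ji) mulr0 subr0 mulr_ge0 //.
    have [ji'|] := ltnP j.+1 i; first by rewrite clt.
    move=> ij; have -> : j.+1 = i :> nat by apply/eqP; rewrite eqn_leq ji ij.
    by rewrite ci.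
  + rewrite /form (cgt j.+1) ?ltnS // -PoszM mulnA slope_numK subr_ge0.
    move: ij; rewrite leq_eqVlt => /orP[/eqP<-|ij].
      rewrite ciS -PoszM lez_nat leq_mul2r -slope_denK leq_pmulr ?orbT //.
      exact: lh_seq_gt0.
    by rewrite cgt // -PoszM mulnA slope_denK.
exists x; apply: (can_inj absz_nat); rewrite facetE -fi.
by apply: eq_form; rewrite xE // ltnW // ltn_ord.
Qed.

Lemma gorenstein_polytope_facet : gorenstein_polytope R b <->
  exists x : K, forall i, facet x i = conductor.-1.
Proof.
have /choice[th thE] := facet_vertex.
exact: (@gorenstein_semigroup_ring R[i] K n.+1 conductor facet th conductor_gt0
  facet1 facetM facet_inj facet_div thE facet_primitive).
Qed.

(** * The integrality condition and finiteness of the solutions *)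

Lemma form1_rat (c : nat -> int) : c 0%N = 0 ->
  (forall j, (j <= n)%N -> form c j = 1) -> forall j, (j <= n.+1)%N ->
  (c j)%:~R = (B j)%:R * \sum_(1 <= i < j.+1) (N i)%:R^-1 :> rat.
Proof.
move=> c0 cf; elim=> [|j IH] jn; first by rewrite c0 big_geq // mulr0.
have B0 i : (B i)%:R != 0 :> rat by rewrite pnatr_eq0 -lt0n lh_seq_gt0.
rewrite big_nat_recr //= mulrDr.
have := form_rat c j; rewrite cf // mul1r => ->.
by rewrite (IH (ltnW jn)); field; rewrite !B0.
Qed.

(** The points with all facet values m-1 and with all values 1 determine each other, one by
    subtraction from the point with all values m, the other by scaling. *)
Lemma facet_rat : (exists x : K, forall i, facet x i = conductor.-1) <->
  forall j, (1 <= j <= n.+1)%N ->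
    (B j)%:R * (\sum_(1 <= i < j.+1) (N i)%:R^-1) \is a @Num.int rat.
Proof.
split=> [[x xE] j /andP[_ jn]|H].
  have q_ex i : exists q, (i <= n)%N -> conductor = (q * N i.+1)%N.
    have [jn'|nj] := leqP i n; last by exists 0%N.
    have jn'' : (i < n.+1)%N by rewrite ltnS.
    by have [q qE] := conductorE (Ordinal jn''); exists q.
  have [q qE] := choice q_ex.
  (* The point with all forms equal to [conductor], minus [x]: all its forms are 1. *)
  pose c j : int := (B j)%:Z * (\sum_(0 <= i < j) q i)%N%:Z - coord x j.
  rewrite -(@form1_rat c _ _ j jn); first exact: intr_int.
    by rewrite /c big_geq // mulr0 subr0.
  move=> {jn}j' jn.
  have -> : form c j' = form (fun j => (B j)%:Z * (\sum_(0 <= i < j) q i)%N%:Z) j' -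
      form (coord x) j'.
    by rewrite /form /c; ring.
  have jn' : (j' < n.+1)%N by rewrite ltnS.
  rewrite -(facetE x (Ordinal jn')) xE /form big_nat_recr //= PoszD.
  rewrite mulrDr mulrDr !mulrA -!PoszM slope_numK slope_denK.
  rewrite [_ + Posz (N _ * q j')%N]addrC addrK [(N _ * q j')%N]mulnC -qE //.
  by have := conductor_gt0; move: conductor => p; lia.
have /choice[c cE] : forall j, exists z : int, (j <= n.+1)%N ->
    z%:~R = (B j)%:R * \sum_(1 <= i < j.+1) (N i)%:R^-1 :> rat.
  case=> [|j]; first by exists 0; rewrite big_geq // mulr0.
  have [jn|nj] := leqP j n; last by exists 0; rewrite leqNgt ltnS nj.
  have /intrP[z zE] := H j.+1 jn.
  by exists z.
have c0 : c 0%N = 0 by apply/eqP; rewrite -(intr_eq0 rat) cE // big_geq // mulr0.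
have cf j : (j <= n)%N -> form c j = 1.
  move=> jn; apply/eqP; rewrite -(eqr_int rat).
  have N0 : (N j.+1)%:R != 0 :> rat by rewrite pnatr_eq0 -lt0n lh_lcm_gt0.
  have B0 i : (B i)%:R != 0 :> rat by rewrite pnatr_eq0 -lt0n lh_seq_gt0.
  rewrite -[X in X == _](divfK N0) form_rat (cE j.+1 jn) (cE j (leqW jn)).
  rewrite [in X in X - _]big_nat_recr //=; apply/eqP; field.
  by rewrite !B0 N0.
have [||x xE] := @lattice_point_exists (fun j => conductor.-1%:Z * c j).
- by rewrite c0 mulr0.
- move=> j jn; have -> : form (fun j => conductor.-1%:Z * c j) j = conductor.-1%:Z * form c j.
    by rewrite /form; ring.
  by rewrite cf // mulr1.
exists x => i; apply: (can_inj absz_nat); rewrite facetE -[RHS]mulr1 -(cf i); last by rewrite -ltnS.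
rewrite (eq_form (c' := fun j => conductor.-1%:Z * c j)) ?xE //; last by rewrite ltnW // ltn_ord.
by rewrite /form; ring.
Qed.

End LectureHall.

(** * Finiteness *)

(** The smallest denominator is at most the number of terms divided by [q]; for each of its finitely
    many values, induction bounds the others. *)
Lemma unit_fractions_bounded (r : nat) (q : rat) : exists bd : nat,
  forall s : seq nat, size s = r -> (forall x, x \in s -> (0 < x)%N) ->
    \sum_(x <- s) x%:R^-1 = q -> forall x, x \in s -> (x <= bd)%N.
Proof.
elim: r q => [|r IH] q; first by exists 0%N => s /size0nil->.
have [bd bdP] := choice (fun v : nat => IH (q - v%:R^-1)).
pose V := Num.bound (r.+1%:R / q).
exists (maxn V (\max_(v < V.+1) bd v)) => s sr s_gt0 sq x xs.
have x0 y : y \in s -> 0 < y%:R^-1 :> rat by move=> /s_gt0; rewrite invr_gt0 ltr0n.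
have [v vs vmin] : exists2 v, v \in s & forall y, y \in s -> (v <= y)%N.
  (* A minimum, obtained from [seq_max] by complementing. *)
  have [v vs vmin] : exists2 v, v \in s & forall y, y \in s ->
      (\max_(y <- s) y - y <= \max_(y <- s) y - v)%N.
    exact: seq_max xs.
  exists v => // y ys; have := vmin y ys.
  have : (v <= \max_(y <- s) y)%N by apply: (leq_bigmax_seq (F := id)).
  lia.
have v0 := s_gt0 v vs.
have q0 : 0 < q.
  rewrite -sq (big_rem v) //= ltr_pwDl ?x0 // big_seq sumr_ge0 // => y /mem_rem/x0.
  exact: ltW.
have vV : (v < V.+1)%N.
  have : v%:R <= r.+1%:R / q.
    rewrite ler_pdivlMr // mulrC -ler_pdivlMr ?ltr0n // -sq -sr.
    have -> : (size s)%:R / v%:R = \sum_(x <- s) v%:R^-1 :> rat.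
      by rewrite big_const_seq count_predT iter_addr_0 mulr_natl.
    rewrite big_seq [leRHS]big_seq; apply: ler_sum => y ys.
    by rewrite lef_pV2 ?posrE ?ltr0n ?s_gt0 // ler_nat vmin.
  move/le_lt_trans => /(_ _ (archi_boundP _)); rewrite ltr_nat ltnS => H.
  by apply/ltnW/H; rewrite divr_ge0 // ltW.
have xE : x = v \/ x \in rem v s.
  by move: xs; rewrite (perm_mem (perm_to_rem vs)) inE => /orP[/eqP|]; [left|right].
rewrite leq_max; case: xE => [->|xv]; first by rewrite -ltnS vV.
apply/orP; right; apply: leq_trans (leq_bigmax (Ordinal vV)).
apply: (bdP v (rem v s)) => //.
- by rewrite size_rem // sr.
- by move=> y /mem_rem/s_gt0.
- by rewrite -sq (big_rem v vs) /= [RHS]addrC addKr.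
Qed.

(** The integer is a sum of n+1 terms at most 1, so it has finitely many values, and each entry of
    [b] divides some [lh_lcm b i]. *)
Lemma lecture_hall_bounded (n : nat) : exists bd : nat, forall b : n.-tuple nat,
  (forall i, (0 < tnth b i)%N) ->
  \sum_(1 <= i < n.+2) (lh_lcm b i)%:R^-1 \is a @Num.int rat ->
  forall i, (tnth b i <= bd)%N.
Proof.
have [bd bdP] := choice (fun z : nat => unit_fractions_bounded n.+1 z%:R).
exists (\max_(z < n.+2) bd z) => b b_gt0 /intrP[z zE] i.
pose s := [seq lh_lcm b i | i <- index_iota 1 n.+2].
have s_gt0 x : x \in s -> (0 < x)%N.
  by move=> /mapP[j _ ->]; apply: lh_lcm_gt0.
have sE : \sum_(x <- s) x%:R^-1 = z%:~R :> rat by rewrite big_map.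
have z0 : 0 <= z.
  by rewrite -(ler0z rat) -sE sumr_ge0 // => x _; rewrite invr_ge0.
case: z z0 sE {zE} => // z _ sE.
have zn : (z < n.+2)%N.
  rewrite ltnS -(ler_nat rat) -[z%:R]/(z%:Z%:~R) -sE.
  have -> : n.+1%:R = \sum_(x <- s) 1 :> rat.
    by rewrite big_const_seq count_predT iter_addr_0 size_map size_iota subn1.
  rewrite big_seq [leRHS]big_seq; apply: ler_sum => x /s_gt0 x0.
  by rewrite invf_le1 ?ltr0n // ler1n.
apply: leq_trans (leq_bigmax (Ordinal zn)) => /=.
have is_s : lh_lcm b i.+1 \in s.
  by apply: map_f; rewrite mem_index_iota /= !ltnS ltnW.
apply: leq_trans (bdP z s _ s_gt0 sE _ is_s); last by rewrite size_map size_iota subn1.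
by rewrite -lh_seqS dvdn_leq ?dvdn_lcml ?lh_lcm_gt0.
Qed.

Lemma finite_bounded_tuples (n bd : nat) :
  finite_set [set b : n.-tuple nat | forall i, (tnth b i <= bd)%N]%classic.
Proof.
pose f (t : n.-tuple 'I_bd.+1) := [tuple (tnth t i : nat) | i < n].
apply: (@sub_finite_set _ _ (f @` setT)%classic); last exact/finite_image/finite_finset.
move=> b H; have H' i : (tnth b i < bd.+1)%N by rewrite ltnS.
exists [tuple Ordinal (H' i) | i < n] => //.
by apply: eq_from_tnth => i; rewrite !tnth_mktuple.
Qed.

Theorem theorem5p5 (R : realType) (n : nat) (hn : (1 <= n)%N) :
  (forall b : n.-tuple nat, (forall i, (0 < tnth b i)%N) ->
     (gorenstein_polytope R b <->
      forall j : nat, (1 <= j <= n.+1)%N ->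
        (lh_seq b j)%:R * (\sum_(1 <= i < j.+1) (lh_lcm b i)%:R^-1)
          \is a @Num.int rat)) /\
  finite_set [set b : n.-tuple nat |
    (forall i, (0 < tnth b i)%N) /\ gorenstein_polytope R b]%classic.
Proof.
have main (b : n.-tuple nat) : (forall i, (0 < tnth b i)%N) ->
    (gorenstein_polytope R b <->
      forall j : nat, (1 <= j <= n.+1)%N ->
        (lh_seq b j)%:R * (\sum_(1 <= i < j.+1) (lh_lcm b i)%:R^-1)
          \is a @Num.int rat).
  by move=> b_gt0; rewrite gorenstein_polytope_facet // facet_rat.
split=> //; have [bd bdP] := lecture_hall_bounded n.
apply: sub_finite_set (finite_bounded_tuples n bd) => b [b_gt0 /(main b b_gt0) H].
apply: bdP => //; have := H n.+1; rewrite leqnn => /(_ isT).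
by rewrite lh_seq_last mul1r.
Qed.
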